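(* There exists a finite positive Borel measure $\nu$ on the open unit disk $\mathbb D$ such that the Toeplitz operator $T_\nu$ is bounded on the Bergman space $L_a^2$ but not invertible on $L_a^2$, while the Berezin transform $\widetilde\nu$ of $\nu$ is bounded below on $\mathbb D$ (there is $\delta>0$ with $\widetilde\nu(z)\geqslant\delta$ for all $z\in\mathbb D$).
   Context: $dA=\frac1\pi dx\,dy$ is the normalized Lebesgue area measure. $\mathbb D=\{z\in\mathbb C:|z|<1\}$. The Bergman space $L_a^2$ is the Hilbert space of analytic functions $f$ on $\mathbb D$ with $\int_{\mathbb D}|f|^2dA<\infty$. For a finite positive Borel measure $\nu$ on $\mathbb D$, the Toeplitz operator is $T_\nu f(z)=\int_{\mathbb D}\frac{f(w)}{(1-z\overline w)^2}\,d\nu(w)$, $f\in L_a^2$, and the Berezin transform is $\widetilde\nu(z)=\int_{\mathbb D}|k_z(w)|^2d\nu(w)$, $z\in\mathbb D$, where $k_z(w)=\frac{1-|z|^2}{(1-\overline z w)^2}$ is the normalized reproducing kernel of $L_a^2$. *)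

(* Defs.v *)
From HB Require Import structures.
From mathcomp Require Import all_boot all_order all_algebra.
From mathcomp Require Import complex.
From mathcomp Require Import all_classical all_reals all_analysis.

Set Implicit Arguments.
Unset Strict Implicit.
Unset Printing Implicit Defensive.

Import Order.TTheory GRing.Theory Num.Theory.
Import ComplexField.Normc.
Import numFieldNormedType.Exports.

Local Open Scope classical_set_scope.
Local Open Scope ring_scope.
Local Open Scope complex_scope.

(* Measures live on the plane, whose product sigma-algebra is the Borel
   sigma-algebra of R^2; analytic functions live on [R[i]].  The two are
   identified by [toC]. *)
Notation plane R := (measurableTypeR R * measurableTypeR R)%type.

Section Bergman.
Context {R : realType}.

Definition toC (p : plane R) : R[i] := (p.1 : R) +i* (p.2 : R).

Definition disk : set R[i] := [set z | normc z < 1].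

Definition pdisk : set (plane R) := toC @^-1` disk.

Lemma invr_pi_ge0 : 0 <= (pi : R)^-1.
Proof. by rewrite invr_ge0 pi_ge0. Qed.

Definition dA : {measure set (plane R) -> \bar R} :=
  mscale (NngNum invr_pi_ge0) (lebesgue_measure \x lebesgue_measure)%E.

(* [derivable] over the scalar field [R[i]], in the direction [1], is complex
   differentiability: the increment [h] tends to 0 in [R[i]]. *)
Definition holomorphic_disk (f : R[i] -> R[i]) : Prop :=
  forall z, disk z -> derivable (f : R[i]^o -> R[i]^o) z 1.

Definition sqnorm (f : R[i] -> R[i]) : \bar R :=
  (\int[dA]_(p in pdisk) (normc (f (toC p)) ^+ 2)%:E)%E.

(* A function on the disk is represented by its extension by 0, so that
   equality of functions on the disk is [=]. *)
Definition bergman : set (R[i] -> R[i]) :=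
  [set f | [/\ holomorphic_disk f, (sqnorm f < +oo)%E
             & forall z, ~ disk z -> f z = 0]].

Definition bergman_norm (f : R[i] -> R[i]) : R := Num.sqrt (fine (sqnorm f)).

Definition bounded_operator (T : (R[i] -> R[i]) -> (R[i] -> R[i])) : Prop :=
  [/\ forall f, bergman f -> bergman (T f),
      forall (a : R[i]) f g, bergman f -> bergman g ->
        T (fun z => a * f z + g z) = (fun z => a * T f z + T g z)
    & exists M : R, forall f, bergman f ->
        bergman_norm (T f) <= M * bergman_norm f].

Definition invertible_operator (T : (R[i] -> R[i]) -> (R[i] -> R[i])) : Prop :=
  exists S, bounded_operator S /\
    forall f, bergman f -> S (T f) = f /\ T (S f) = f.

Section Toeplitz.
Variable nu : {finite_measure set (plane R) -> \bar R}.

Definition cintegrable (F : R[i] -> R[i]) : Prop :=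
  nu.-integrable pdisk (fun p => (complex.Re (F (toC p)))%:E) /\
  nu.-integrable pdisk (fun p => (complex.Im (F (toC p)))%:E).

Definition cintegral (F : R[i] -> R[i]) : R[i] :=
  (\int[nu]_(p in pdisk) complex.Re (F (toC p)))
  +i* (\int[nu]_(p in pdisk) complex.Im (F (toC p))).

Definition toeplitz_integrand (f : R[i] -> R[i]) (z w : R[i]) : R[i] :=
  f w / (1 - z * w^*) ^+ 2.

Definition toeplitz (f : R[i] -> R[i]) : R[i] -> R[i] :=
  fun z => if z \in disk then cintegral (toeplitz_integrand f z) else 0.

(* The integral is a total function in the library, so convergence of the
   integrals defining the operator is part of its boundedness. *)
Definition bounded_toeplitz : Prop :=
  (forall f z, bergman f -> disk z -> cintegrable (toeplitz_integrand f z)) /\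
  bounded_operator toeplitz.

Definition normalized_kernel (z w : R[i]) : R[i] :=
  (1 - normc z ^+ 2)%:C / (1 - z^* * w) ^+ 2.

Definition berezin (z : R[i]) : \bar R :=
  (\int[nu]_(p in pdisk) (normc (normalized_kernel z (toC p)) ^+ 2)%:E)%E.

End Toeplitz.
End Bergman.

(* Main.v *)
(* Put M_k = 34 ^ (k + 1) and r_k = 1 - 1 / M_k, and let nu be the sum over k of
   the M_k point masses M_k ^ -2 at the points r_k w, where w ^ M_k = 1.

   The squares of half-side 1 / (8 M_k) around these points are disjoint and
   contained in the disk, so the sub-mean value property of |f| ^ 2 gives the
   Carleson inequality: the integral of |f| ^ 2 against nu is at most a constant
   times the squared norm of f.  By duality, T_nu is bounded.

   The lacunary product of the factors 1 - (z / r_k) ^ M_k vanishes at all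
   these points.  The factors interact so little that the sum of |a_n| ^ 2 / (n + 1) over
   its Taylor coefficients a_n stays bounded, hence it is a nonzero function of
   the Bergman space in the kernel of T_nu.

   For every z in the disk, 1 - |z| is comparable to some 1 / M_k, and the M_k
   points of that level are dense enough on their circle for the discrete Parseval
   identity to bound the sum of |1 - z^* w| ^ -4 over them from below by a constant
   times M_k ^ 4; hence the Berezin transform is bounded below. *)
Require Import Defs.
From HB Require Import structures.
From mathcomp Require Import all_boot all_order all_algebra.
From mathcomp Require Import complex.
From mathcomp Require Import all_classical all_reals all_analysis.
From mathcomp Require Import measurable_realfun.
From mathcomp Require cyclic separable cyclotomic.
From mathcomp Require Import ring lra zify.

Set Implicit Arguments.
Unset Strict Implicit.
Unset Printing Implicit Defensive.

Import Order.TTheory GRing.Theory Num.Theory.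
Import ComplexField.Normc.
Import numFieldNormedType.Exports.

Local Open Scope classical_set_scope.
Local Open Scope ring_scope.
Local Open Scope complex_scope.

(** * The integral theorem on rectangles *)

Section segment_integrals.
Context {R : realType}.
Local Notation mu := (@lebesgue_measure R).
Implicit Types (f g : R -> R) (a b : R).

(** Two demands pull against each other. A Berezin transform bounded below asks for mass at every
    scale of distance to the circle, whereas a nonzero function in the kernel of the operator asks
    for a support sparse enough to lie in a zero set of the Bergman space. Levels in geometric
    progression meet both: 1 - |z| is always within a factor 34 of some 1 / M_k, which costs only
    powers of 34 in the lower bound, while the ratio is large enough for the product to stay in the
    space. Indeed r_k ^ M_k is at least 1 / 5, so each factor multiplies the plain square sum of the
    coefficients by at most 1 + 25 = 26. The coefficients added by factor k start at degree M_k,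
    where the weight 1 / (n + 1) is below 34 ^ -(k + 1), so the added energies are dominated by a
    geometric series of ratio 26 / 34. The mass M_k ^ -2 is of the order of the area of the square
    around the point, which is what the Carleson inequality compares it with. Only the finiteness of
    constants matters, so contour integrals and moments are estimated, not evaluated: squares
    replace circles, and 4 replaces 2 pi or pi. *)

Definition segment_continuous f a b :=
  forall x, a <= x <= b -> {for x, continuous f}.

Lemma segment_continuousS f a b c d :
  a <= c -> d <= b -> segment_continuous f a b -> segment_continuous f c d.
Proof.
move=> ac db fc x /andP[cx xd]; apply: fc.
by rewrite (le_trans ac cx) (le_trans xd db).
Qed.

Lemma segment_continuousB f g a b : segment_continuous f a b ->
  segment_continuous g a b -> segment_continuous (fun x => f x - g x) a b.
Proof. by move=> fc gc x xab; apply: cvgB; [exact: fc|exact: gc]. Qed.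

Lemma segment_integrable f a b : segment_continuous f a b ->
  mu.-integrable `[a, b] (EFin \o f).
Proof.
move=> fc; apply: continuous_compact_integrable; first exact: segment_compact.
by apply: continuous_in_subspaceT => x; rewrite inE /= in_itv /=; exact: fc.
Qed.

Lemma segment_length a b : a <= b -> fine (mu `[a, b]) = b - a.
Proof.
move=> ab; rewrite lebesgue_measure_itv /= lte_fin.
by case: ltgtP ab => // -> _; rewrite subrr.
Qed.

Lemma segment_split f a m b : a <= m -> m <= b -> segment_continuous f a b ->
  \int[mu]_(x in `[a, b]) f x =
  \int[mu]_(x in `[a, m]) f x + \int[mu]_(x in `[m, b]) f x.
Proof.
move=> am mb fc.
have := @Rintegral_itvB R f (BLeft a) (BRight b) m (segment_integrable fc).
rewrite !bnd_simp => /(_ am mb).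
rewrite Rintegral_itv_obnd_cbnd => [<-|]; first by rewrite addrC subrK.
apply: (integrableS _ _ _ (segment_integrable fc)) => //.
by apply: subset_itvr; rewrite bnd_simp.
Qed.

Lemma segment_integral_near f a b K eta : a <= b -> segment_continuous f a b ->
  (forall x, a <= x <= b -> `|f x - K| <= eta) ->
  `|\int[mu]_(x in `[a, b]) f x - K * (b - a)| <= eta * (b - a).
Proof.
move=> ab fc fK.
have ic (c : R) : mu.-integrable `[a, b] (EFin \o (fun=> c)).
  by apply: segment_integrable => x _; exact: cvg_cst.
rewrite -(segment_length ab) -!Rintegral_cst// -RintegralB//; last first.
  exact: segment_integrable.
apply: le_trans (le_normr_Rintegral _ _) _ => //.
  by apply/segment_integrable/segment_continuousB => // x _; exact: cvg_cst.
apply: le_Rintegral => //.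
apply/segment_integrable => x xab; apply: cvg_norm.
by apply: cvgB; [exact: fc|exact: cvg_cst].
Qed.

Lemma affine_approx_continuous f x0 p :
  (exists2 d, 0 < d & forall x, `|x - x0| < d ->
     `|f x - (f x0 + p * (x - x0))| <= `|x - x0|) ->
  {for x0, continuous f}.
Proof.
move=> [d d0 fd]; apply/cvgrPdist_le => /= e e0.
have k0 : 0 < `|p| + 1 by rewrite ltr_wpDl.
apply/nbhs_ballP; exists (Num.min d (e / (`|p| + 1))) => /=.
  by rewrite lt_min d0 divr_gt0.
move=> x; rewrite /ball /= lt_min distrC => /andP[xd].
rewrite ltr_pdivlMr// => xe.
have := fd _ xd.
rewrite (_ : f x - (f x0 + p * (x - x0)) = (f x - f x0) - p * (x - x0)); last by ring.
move=> h; have := ler_normB (f x - f x0 - p * (x - x0)) (- (p * (x - x0))).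
rewrite opprK subrK normrN normrM distrC => h2.
apply: le_trans h2 _; nra.
Qed.

End segment_integrals.

Section goursat.
Context {R : realType}.
Local Notation mu := (@lebesgue_measure R).
Implicit Types (P Q : R -> R -> R) (a b c d : R).

(** Goursat's setting: differentiability at the single point, with closedness encoded by the shared
    [p2], which is both dP/dy and dQ/dx. *)
Definition closed_form_at P Q x0 y0 := exists p1 p2 q2 : R,
  forall e, 0 < e -> exists2 d, 0 < d & forall x y,
    `|x - x0| < d -> `|y - y0| < d ->
    `|P x y - (P x0 y0 + p1 * (x - x0) + p2 * (y - y0))|
      <= e * (`|x - x0| + `|y - y0|) /\
    `|Q x y - (Q x0 y0 + p2 * (x - x0) + q2 * (y - y0))|
      <= e * (`|x - x0| + `|y - y0|).

Definition closed_form_on P Q a b c d :=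
  forall x y, a <= x <= b -> c <= y <= d -> closed_form_at P Q x y.

(* The integral of [P dx + Q dy] along the boundary of [a, b] x [c, d]. *)
Definition circulation P Q a b c d :=
  \int[mu]_(x in `[a, b]) (P x c - P x d) +
  \int[mu]_(y in `[c, d]) (Q b y - Q a y).

Lemma closed_form_atl P Q x0 y0 :
  closed_form_at P Q x0 y0 -> {for x0, continuous (P^~ y0)}.
Proof.
move=> [p1 [p2 [q2 /(_ _ ltr01)[d d0 PQ]]]].
apply: (@affine_approx_continuous _ _ _ p1); exists d => // x xd.
have [] := PQ x y0 xd; rewrite ?subrr ?normr0// mulr0 !addr0 mul1r => h _.
exact: h.
Qed.

Lemma closed_form_atr P Q x0 y0 :
  closed_form_at P Q x0 y0 -> {for y0, continuous (Q x0)}.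
Proof.
move=> [p1 [p2 [q2 /(_ _ ltr01)[d d0 PQ]]]].
apply: (@affine_approx_continuous _ _ _ q2); exists d => // y yd.
have [||_] := PQ x0 y => //; first by rewrite subrr normr0.
by rewrite subrr normr0 mulr0 addr0 add0r mul1r.
Qed.

Section on_rectangle.
Variables (P Q : R -> R -> R) (a b c d : R).
Hypothesis PQ : closed_form_on P Q a b c d.

Lemma closed_form_contl y : c <= y <= d -> segment_continuous (P^~ y) a b.
Proof. by move=> yd x xab; apply: closed_form_atl (PQ _ _) . Qed.

Lemma closed_form_contr x : a <= x <= b -> segment_continuous (Q x) c d.
Proof. by move=> xab y ycd; apply: closed_form_atr (PQ _ _). Qed.

Lemma circulation_splitx m : a <= m <= b -> c <= d ->
  circulation P Q a b c d = circulation P Q a m c d + circulation P Q m b c d.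
Proof.
move=> /andP[am mb] cd; have ab := le_trans am mb.
have Qc x : a <= x <= b -> mu.-integrable `[c, d] (EFin \o Q x).
  by move=> xab; apply/segment_integrable/closed_form_contr.
rewrite /circulation (segment_split am mb); last first.
  by apply: segment_continuousB; apply: closed_form_contl; rewrite lexx cd.
rewrite !(@RintegralB _ _ _ mu _ (Q _)) ?Qc// ?lexx ?ab ?am ?mb//; ring.
Qed.

Lemma circulation_splity m : c <= m <= d -> a <= b ->
  circulation P Q a b c d = circulation P Q a b c m + circulation P Q a b m d.
Proof.
move=> /andP[cm md] ab; have cd := le_trans cm md.
have Pc y : c <= y <= d -> mu.-integrable `[a, b] (EFin \o (P^~ y)).
  by move=> ycd; apply/segment_integrable/closed_form_contl.
rewrite /circulation [X in _ + X](segment_split cm md); last first.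
  by apply: segment_continuousB; apply: closed_form_contr; rewrite lexx ab.
rewrite !(@RintegralB _ _ _ mu _ (P^~ _)) ?Pc// ?lexx ?cm ?cd ?md//; ring.
Qed.

(* The circulation of the affine part of a closed form vanishes. *)
Lemma circulation_affine x0 y0 p1 p2 q2 eta : a <= b -> c <= d ->
  (forall x y, a <= x <= b -> c <= y <= d ->
    `|P x y - (P x0 y0 + p1 * (x - x0) + p2 * (y - y0))| <= eta /\
    `|Q x y - (Q x0 y0 + p2 * (x - x0) + q2 * (y - y0))| <= eta) ->
  `|circulation P Q a b c d| <= 2 * eta * ((b - a) + (d - c)).
Proof.
move=> ab cd h.
have h1 : `|\int[mu]_(x in `[a, b]) (P x c - P x d) - (p2 * (c - d)) * (b - a)|
    <= (2 * eta) * (b - a).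
  apply: segment_integral_near => //.
    by apply: segment_continuousB; apply: closed_form_contl; rewrite lexx cd.
  move=> x xab; have [+ _] := h x c xab (introT andP (conj (lexx c) cd)).
  have [+ _] := h x d xab (introT andP (conj cd (lexx d))).
  rewrite !ler_norml => /andP[? ?] /andP[? ?]; apply/andP; split; lra.
have h2 : `|\int[mu]_(y in `[c, d]) (Q b y - Q a y) - (p2 * (b - a)) * (d - c)|
    <= (2 * eta) * (d - c).
  apply: segment_integral_near => //.
    by apply: segment_continuousB; apply: closed_form_contr; rewrite lexx ab.
  move=> y ycd; have [_ +] := h a y (introT andP (conj (lexx a) ab)) ycd.
  have [_ +] := h b y (introT andP (conj ab (lexx b))) ycd.
  rewrite !ler_norml => /andP[? ?] /andP[? ?]; apply/andP; split; lra.
rewrite /circulation; move: h1 h2.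
rewrite !ler_norml => /andP[? ?] /andP[? ?]; apply/andP; split; lra.
Qed.

End on_rectangle.

Lemma closed_form_onS P Q a b c d a' b' c' d' : a <= a' -> b' <= b ->
  c <= c' -> d' <= d ->
  closed_form_on P Q a b c d -> closed_form_on P Q a' b' c' d'.
Proof.
move=> aa bb cc dd PQ x y /andP[ax xb] /andP[cy yd]; apply: PQ.
  by rewrite (le_trans aa)// (le_trans xb).
by rewrite (le_trans cc)// (le_trans yd).
Qed.

(** The circulation is the sum of those of the four quarters, so by the triangle inequality they
    cannot all be smaller than a quarter of it. *)
Lemma circulation_quarter P Q x y w h : 0 <= w -> 0 <= h ->
  closed_form_on P Q x (x + 2 * w) y (y + 2 * h) ->
  exists q : R * R, [/\ x <= q.1 <= x + w, y <= q.2 <= y + h &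
    `|circulation P Q x (x + 2 * w) y (y + 2 * h)| <=
    4 * `|circulation P Q q.1 (q.1 + w) q.2 (q.2 + h)|].
Proof.
move=> w0 h0 PQ.
have xw : x <= x + w <= x + 2 * w by apply/andP; split; lra.
have yh : y <= y + h <= y + 2 * h by apply/andP; split; lra.
have yh2 : y <= y + 2 * h by lra.
rewrite (circulation_splitx PQ xw yh2).
have PQl : closed_form_on P Q x (x + w) y (y + 2 * h).
  by apply: closed_form_onS PQ => //; lra.
have PQr : closed_form_on P Q (x + w) (x + 2 * w) y (y + 2 * h).
  by apply: closed_form_onS PQ => //; lra.
rewrite (circulation_splity PQl yh) ?lerDl// (circulation_splity PQr yh); last lra.
have -> : x + 2 * w = (x + w) + w by ring.
have -> : y + 2 * h = (y + h) + h by ring.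
set A := circulation _ _ x _ y _; set B := circulation _ _ x _ (y + h) _.
set C := circulation _ _ (x + w) _ y _.
set D := circulation _ _ (x + w) _ (y + h) _.
set S := (X in `|X|).
have tri : `|S| <= `|A| + `|B| + (`|C| + `|D|).
  by apply: le_trans (ler_normD _ _) _; apply: lerD; exact: ler_normD.
have [hA|hA] := leP `|S| (4 * `|A|).
  by exists (x, y) => /=; split=> //; apply/andP; split; lra.
have [hB|hB] := leP `|S| (4 * `|B|).
  by exists (x, y + h) => /=; split=> //; apply/andP; split; lra.
have [hC|hC] := leP `|S| (4 * `|C|).
  by exists (x + w, y) => /=; split=> //; apply/andP; split; lra.
exists (x + w, y + h) => /=; split; [by apply/andP; split; lra..|].
by rewrite leNgt; apply/negP => hD; rewrite -/D in hD; lra.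
Qed.

(** The left ends increase and every right end bounds all of them from above, so the supremum of the
    left ends lies in every segment. *)
Lemma nested_segments (u : nat -> R) w :
  (forall n, u n <= u n.+1 <= u n + w / 2 ^+ n.+1) ->
  exists x, forall n, u n <= x <= u n + w / 2 ^+ n.
Proof.
move=> hu.
have w0 : 0 <= w.
  have /andP[h1 h2] := hu 0%N; rewrite expr1 in h2; lra.
have wn n : w / 2 ^+ n = w / 2 ^+ n.+1 + w / 2 ^+ n.+1.
  by rewrite exprS; field; rewrite expf_neq0.
have un n m : u n <= u (n + m)%N <= u n + w / 2 ^+ n.
  elim: m n => [|m IH] n.
    by rewrite addn0 lexx lerDl divr_ge0// exprn_ge0.
  rewrite addnS -addSn; have /andP[h1 h2] := IH n.+1; have /andP[h3 h4] := hu n.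
  rewrite (le_trans h3 h1)/= wn; lra.
have ub n : ubound (range u) (u n + w / 2 ^+ n).
  move=> _ [m _ <-]; have [nm|mn] := leqP n m.
    by rewrite -(subnKC nm); have /andP[] := un n (m - n)%N.
  have /andP[h1 _] := un m (n - m)%N; rewrite subnKC in h1; last exact: ltnW.
  by apply: le_trans h1 _; rewrite lerDl divr_ge0// exprn_ge0.
exists (sup (range u)) => n; apply/andP; split.
  by apply: ub_le_sup; [exists (u 0%N + w / 2 ^+ 0); exact: ub|exists n].
by apply: ge_sup; [exists (u 0%N); exists 0%N|exact: ub].
Qed.

(** Repeated quartering keeps at least 4 ^ -n of the circulation in rectangles shrinking to a point.
    Differentiability at that point bounds the circulation of the n-th rectangle by an arbitrarily
    small multiple of 4 ^ -n. *)
Theorem goursat P Q a b c d : a <= b -> c <= d ->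
  closed_form_on P Q a b c d -> circulation P Q a b c d = 0.
Proof.
move=> ab cd PQ; pose w := b - a; pose h := d - c.
pose W n := w / 2 ^+ n; pose H n := h / 2 ^+ n.
have w0 : 0 <= w by rewrite subr_ge0.
have h0 : 0 <= h by rewrite subr_ge0.
have WS n : W n = 2 * W n.+1 by rewrite /W exprS; field; rewrite expf_neq0.
have HS n : H n = 2 * H n.+1 by rewrite /H exprS; field; rewrite expf_neq0.
have W0 n : 0 <= W n by rewrite divr_ge0// exprn_ge0.
have H0 n : 0 <= H n by rewrite divr_ge0// exprn_ge0.
pose inside n (p : R * R) :=
  [/\ a <= p.1, p.1 + W n <= b, c <= p.2 & p.2 + H n <= d].
pose C n (p : R * R) := circulation P Q p.1 (p.1 + W n) p.2 (p.2 + H n).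
(* The implication makes the statement total, as [choice] requires; a corner that is not inside is
   mapped to itself. *)
have step (np : nat * (R * R)) : exists q, inside np.1 np.2 ->
    [/\ np.2.1 <= q.1 <= np.2.1 + W np.1.+1,
        np.2.2 <= q.2 <= np.2.2 + H np.1.+1 &
        `|C np.1 np.2| <= 4 * `|C np.1.+1 q|].
  case: np => n [x y] /=; have [i|ni] := pselect (inside n (x, y)); last first.
    by exists (x, y).
  have [h1 h2 h3 h4] := i; rewrite /= in h1 h2 h3 h4.
  have := @circulation_quarter P Q x y (W n.+1) (H n.+1) (W0 _) (H0 _).
  rewrite -WS -HS => /(_ (closed_form_onS h1 h2 h3 h4 PQ)) [q qP].
  by exists q.
have [F FP] := choice step.
pose fix u n := if n is m.+1 then F (m, u m) else (a, c).
have uI n : inside n (u n).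
  elim: n => [|n IH].
    by rewrite /inside /W /H expr0 !divr1 /=; split; rewrite ?lexx// /w /h; lra.
  have [/andP[h1 h2] /andP[h3 h4] _] := FP (n, u n) IH.
  case: IH => i1 i2 i3 i4; rewrite /= in h1 h2 h3 h4.
  by rewrite WS in i2; rewrite HS in i4; split=> /=; lra.
have uC n : `|C 0%N (u 0%N)| <= 4 ^+ n * `|C n (u n)|.
  elim: n => [|n IH]; first by rewrite expr0 mul1r.
  apply: le_trans IH _; rewrite exprSr -mulrA ler_pM2l ?exprn_gt0//.
  by have [_ _] := FP (n, u n) (uI n).
have C0 : C 0%N (u 0%N) = circulation P Q a b c d.
  by rewrite /C /W /H /= expr0 !divr1 /w /h ![_ + (_ - _)]addrC !subrK.
have [x0 x0P] : exists x, forall n, (u n).1 <= x <= (u n).1 + W n.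
  by apply: nested_segments => n; have [] := FP (n, u n) (uI n).
have [y0 y0P] : exists y, forall n, (u n).2 <= y <= (u n).2 + H n.
  by apply: nested_segments => n; have [] := FP (n, u n) (uI n).
have [p1 [p2 [q2 loc]]] : closed_form_at P Q x0 y0.
  have [i1 i2 i3 i4] := uI 0%N.
  have /andP[? ?] := x0P 0%N; have /andP[? ?] := y0P 0%N.
  by apply: PQ; apply/andP; split; lra.
apply/eqP; rewrite -normr_le0; apply/ler_addgt0Pl => e e0; rewrite addr0.
(* In [4 ^+ n * (2 * k * (W n + H n) ^+ 2)] the powers of 2 cancel, so [k] is fixed on the whole
   rectangle, before [n]. *)
have [k k0 ke] : exists2 k, 0 < k & 2 * k * (w + h) ^+ 2 <= e.
  exists (e / (2 * ((w + h) ^+ 2 + 1))).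
    by rewrite divr_gt0// mulr_gt0// ltr_wpDl ?sqr_ge0.
  have s0 := sqr_ge0 (w + h); set s := (w + h) ^+ 2 in s0 *.
  rewrite (_ : 2 * _ * s = e * (s / (s + 1))); last first.
    by field; apply/eqP; lra.
  rewrite -[leRHS]mulr1; apply: ler_wpM2l; first exact: ltW.
  by rewrite ler_pdivrMr; lra.
have [r r0 {}loc] := loc k k0.
have [n nr] : exists n, (w + h) / 2 ^+ n < r.
  exists (Num.truncn ((w + h) / r)).+1.
  rewrite ltr_pdivrMr ?exprn_gt0// mulrC -ltr_pdivrMr//.
  by rewrite (lt_le_trans (truncnS_gt _))// -natrX ler_nat ltnW// ltn_expl.
have WH : W n + H n < r by rewrite /W /H -mulrDl.
have key : `|C n (u n)| <= 2 * (k * (W n + H n)) * (W n + H n).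
  have [i1 i2 i3 i4] := uI n.
  have := @circulation_affine P Q _ _ _ _ (closed_form_onS i1 i2 i3 i4 PQ) x0 y0
    p1 p2 q2 (k * (W n + H n)); rewrite !lerDl => /(_ (W0 n) (H0 n)).
  have e1 (p q : R) : p + q - p = q by ring.
  rewrite !e1; apply => x y /andP[? ?] /andP[? ?].
  have /andP[? ?] := x0P n; have /andP[? ?] := y0P n.
  have hx : `|x - x0| <= W n by rewrite ler_norml; apply/andP; split; lra.
  have hy : `|y - y0| <= H n by rewrite ler_norml; apply/andP; split; lra.
  have := W0 n; have := H0 n => ? ?.
  have [] := loc x y; [lra|lra|move=> l1 l2].
  split; [apply: le_trans l1 _|apply: le_trans l2 _];
    by apply: ler_wpM2l; [exact: ltW|exact: lerD].
rewrite -C0; apply: le_trans (uC n) _; apply: le_trans ke.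
apply: le_trans (ler_wpM2l _ key) _; first exact: exprn_ge0.
rewrite /W /H (_ : 4 = 2 ^+ 2 :> R); last by ring.
rewrite le_eqVlt; apply/orP; left; apply/eqP.
rewrite -exprM mulnC exprM; field; by rewrite expf_neq0.
Qed.

End goursat.

(** * Rotations of the plane *)

Section plane_measurability.
Context {R : realType}.
Implicit Types (p q : plane R) (A : set (plane R)).

Definition near_plane p (d : R) q :=
  `|(q.1 : R) - p.1| < d /\ `|(q.2 : R) - p.2| < d.

(** Openness for the sup norm: its neighbourhoods are boxes, which belong to the product
    sigma-algebra of [plane]. *)
Definition plane_open A :=
  forall p, A p -> exists2 d : R, 0 < d & near_plane p d `<=` A.

(** An open set is the union of the countably many boxes with rational centre and half-side 1 / (n +
    1) that it contains; [F] replaces the other boxes by the empty set. *)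
Lemma plane_open_measurable A : plane_open A -> measurable A.
Proof.
move=> oA.
have near_center (i x y r d : R) : `|x - r| < i -> 2 * i < d ->
    r - i < y -> y < r + i -> `|y - x| < d.
  by rewrite !ltr_norml => /andP[? ?] ? ? ?; apply/andP; split; lra.
have near_itv (i x r : R) : `|x - r| < i -> (r - i < x) && (x < r + i).
  by rewrite ltr_norml => /andP[? ?]; apply/andP; split; lra.
pose box (c : rat * rat * nat) : set (plane R) :=
  `](ratr c.1.1 - c.2.+1%:R^-1 : R), (ratr c.1.1 + c.2.+1%:R^-1)[%classic `*`
  `](ratr c.1.2 - c.2.+1%:R^-1 : R), (ratr c.1.2 + c.2.+1%:R^-1)[%classic.
pose F c := if pselect (box c `<=` A) then box c else set0.
have -> : A = \bigcup_c F c.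
  apply/seteqP; split=> [p Ap|p [c _]]; last first.
    by rewrite /F; case: pselect => // h; exact: h.
  have [d d0 dA] := oA p Ap.
  have [n nd] : exists n, (2 * n.+1%:R^-1 : R) < d.
    exists (Num.truncn (2 / d)); rewrite ltr_pdivrMr ?ltr0n// mulrC -ltr_pdivrMr//.
    exact: truncnS_gt.
  have n0 : (0 : R) < n.+1%:R^-1 by rewrite invr_gt0 ltr0n.
  have near_rat (x : R) : exists q : rat, `|x - ratr q| < n.+1%:R^-1.
    have [||r [+ [q _ qr]]] := @dense_rat R (ball x n.+1%:R^-1).
    - by exists x; exact: ballxx.
    - exact: ball_open.
    by rewrite -qr /ball /= => xq; exists q.
  have [q1 q1P] := near_rat p.1; have [q2 q2P] := near_rat p.2.
  exists (q1, q2, n) => //; rewrite /F; case: pselect => [bA|h]; last first.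
    exfalso; apply: h => q; rewrite /box /= !in_itv /= => -[/andP[? ?] /andP[? ?]].
    by apply: dA; split; [exact: near_center q1P nd _ _|exact: near_center q2P nd _ _].
  by split; rewrite /= in_itv /=; exact: near_itv.
apply: countable_bigcupT_measurable => // c; rewrite /F; case: pselect => cA /=.
  by apply: measurableX; exact: measurable_itv.
exact: measurable0.
Qed.

Definition plane_continuous_at (u : plane R -> R) p :=
  forall e, 0 < e -> exists2 d, 0 < d &
    forall q, near_plane p d q -> `|u q - u p| < e.

Lemma plane_continuous_measurable A (u : plane R -> R) : plane_open A ->
  (forall p, A p -> plane_continuous_at u p) -> measurable_fun A u.
Proof.
move=> oA cu mA; apply: (measurability _ (RGenOInfty.measurableE R)) => //.
move=> _ [_ [a ->] <-]; apply: plane_open_measurable => p [Ap] /=.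
rewrite in_itv /= andbT => au.
have [d1 d10 h1] := oA p Ap.
have [|d2 d20 h2] := cu p Ap (u p - a); first by rewrite subr_gt0.
exists (Num.min d1 d2); first by rewrite lt_min d10.
move=> q [+ +]; rewrite !lt_min => /andP[q1 q1'] /andP[q2 q2'].
split; first exact: h1.
have := h2 q (conj q1' q2'); rewrite ltr_norml => /andP[+ _].
by rewrite /= in_itv /= andbT opprB ltrBrDr subrK.
Qed.

End plane_measurability.

Section plane_integral.
Context {R : realType}.
Local Notation mu := (@lebesgue_measure R).
Local Notation mu2 := (mu \x mu)%E.
Local Open Scope ereal_scope.

Lemma lebesgue_measureD (c : R) (A : set R) : measurable A ->
  pushforward mu (fun x : R => (x + c)%R : measurableTypeR R) A = mu A.
Proof.
move=> mA; apply/esym/lebesgue_measure_unique => //=; first exact: measurable_funD.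
move=> mc _ [[a b]] _ <-.
rewrite /pushforward (_ : _ @^-1` _ = `](a - c)%R, (b - c)%R]%classic); last first.
  by apply/funext => x; rewrite /= !in_itv /= ltrBlDr lerBrDr.
rewrite !lebesgue_measure_itv/= !lte_fin ltrD2r.
by case: ifPn => // _; rewrite -!EFinD; congr EFin; ring.
Qed.

Lemma integral_translate (c : R) (f : R -> \bar R) :
  measurable_fun [set: R] f -> (forall x, 0 <= f x) ->
  \int[mu]_x f (x + c)%R = \int[mu]_x f x.
Proof.
move=> mf f0; pose T := (fun x => (x + c)%R) : measurableTypeR R -> measurableTypeR R.
have mT : measurable_fun setT T by exact: measurable_funD.
rewrite -[LHS](@ge0_integral_pushforward _ _ _ _ _ T mT mu setT f)//.
by apply: eq_measure_integral => A mA _; exact: lebesgue_measureD.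
Qed.

Lemma integral_reflect (f : R -> \bar R) :
  measurable_fun [set: R] f -> (forall x, 0 <= f x) ->
  \int[mu]_x f (- x)%R = \int[mu]_x f x.
Proof.
move=> mf f0; pose T := (-%R) : measurableTypeR R -> measurableTypeR R.
have mT : measurable_fun setT T by exact: oppr_measurable.
rewrite -[LHS](@ge0_integral_pushforward _ _ _ _ _ T mT mu setT f)//.
by apply: eq_measure_integral => A mA _; exact: lebesgue_measureN.
Qed.

(** After Tonelli, a shear is a translation of the inner variable by an amount that depends on the
    outer one only. *)
Lemma integral_shearl (t c : R) (f : plane R -> \bar R) :
  measurable_fun setT f -> (forall p, 0 <= f p) ->
  \int[mu2]_p f (p.1 + (t * p.2 + c), p.2)%R = \int[mu2]_p f p.
Proof.
move=> mf f0.
have ms : measurable_fun setT (fun p : plane R => f (p.1 + (t * p.2 + c), p.2)%R).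
  apply: measurableT_comp => //; apply: measurable_fun_pair => //.
  apply: measurable_funD => //; apply: measurable_funD => //.
  exact: measurable_funM.
etransitivity; first exact: (@fubini_tonelli2 _ _ (measurableTypeR R) (measurableTypeR R) R mu mu _ ms (fun=> f0 _)).
apply/esym; etransitivity; first exact: (@fubini_tonelli2 _ _ (measurableTypeR R) (measurableTypeR R) R mu mu _ mf f0).
apply/esym.
apply: eq_integral => y _; rewrite /fubini_G /=.
rewrite (integral_translate (t * y + c)%R (f := fun x => f (x, y)))//.
exact: measurableT_comp.
Qed.

Lemma integral_shearr (t c : R) (f : plane R -> \bar R) :
  measurable_fun setT f -> (forall p, 0 <= f p) ->
  \int[mu2]_p f (p.1, p.2 + (t * p.1 + c))%R = \int[mu2]_p f p.
Proof.
move=> mf f0.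
have ms : measurable_fun setT (fun p : plane R => f (p.1, p.2 + (t * p.1 + c))%R).
  apply: measurableT_comp => //; apply: measurable_fun_pair => //.
  apply: measurable_funD => //; apply: measurable_funD => //.
  exact: measurable_funM.
etransitivity; first exact: (@fubini_tonelli1 _ _ (measurableTypeR R) (measurableTypeR R) R mu mu _ ms (fun=> f0 _)).
apply/esym; etransitivity; first exact: (@fubini_tonelli1 _ _ (measurableTypeR R) (measurableTypeR R) R mu mu _ mf f0).
apply/esym.
apply: eq_integral => x _; rewrite /fubini_F /=.
rewrite (integral_translate (t * x + c)%R (f := fun y => f (x, y)))//.
exact: measurableT_comp.
Qed.

Lemma integral_plane_translate (a b : R) (f : plane R -> \bar R) :
  measurable_fun setT f -> (forall p, 0 <= f p) ->
  \int[mu2]_p f (p.1 + a, p.2 + b)%R = \int[mu2]_p f p.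
Proof.
move=> mf f0; rewrite -(integral_shearl 0 a mf f0).
rewrite -[RHS](integral_shearr 0 b) => [|| p]; last exact: f0.
  by apply: eq_integral => -[x y] _ /=; rewrite !mul0r !add0r.
apply: measurableT_comp => //; apply: measurable_fun_pair => //.
apply: measurable_funD => //; apply: measurable_funD => //.
exact: measurable_funM.
Qed.

(* A rotation of angle different from pi is a product of three shears. *)
Lemma integral_rotate (c s : R) (f : plane R -> \bar R) :
  (c ^+ 2 + s ^+ 2 = 1)%R -> (c != -1)%R ->
  measurable_fun setT f -> (forall p, 0 <= f p) ->
  \int[mu2]_p f (c * p.1 - s * p.2, s * p.1 + c * p.2)%R = \int[mu2]_p f p.
Proof.
(* [t] is minus the tangent of half the angle. The rotation is a horizontal shear of slope [t], a
   vertical one of slope [s], and a horizontal one of slope [t] again; the excluded angle is the one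
   where [1 + c] vanishes. *)
move=> cs c1 mf f0; pose t := (- s / (1 + c))%R.
have c10 : (1 + c != 0)%R by rewrite addrC addr_eq0.
have mX (u : R) (g : plane R -> \bar R) : measurable_fun setT g ->
    measurable_fun setT (fun p : plane R => g (p.1 + (u * p.2 + 0), p.2)%R).
  move=> mg; apply: measurableT_comp => //; apply: measurable_fun_pair => //.
  apply: measurable_funD => //; apply: measurable_funD => //.
  exact: measurable_funM.
have mY (u : R) (g : plane R -> \bar R) : measurable_fun setT g ->
    measurable_fun setT (fun p : plane R => g (p.1, p.2 + (u * p.1 + 0))%R).
  move=> mg; apply: measurableT_comp => //; apply: measurable_fun_pair => //.
  apply: measurable_funD => //; apply: measurable_funD => //.
  exact: measurable_funM.
rewrite -(integral_shearl t 0 mf f0).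
rewrite -(integral_shearr s 0 (mX t f mf)) => [|p]; last exact: f0.
rewrite -(integral_shearl t 0 (mY s _ (mX t f mf))) => [|p]; last exact: f0.
apply: eq_integral => -[x y] _ /=.
have tE : (t * (1 + c) = - s)%R by rewrite /t mulfVK.
have cE : (c = 1 + s * t)%R.
  apply: (mulIf c10).
  have -> : ((1 + s * t) * (1 + c) = 1 + c + s * (t * (1 + c)))%R by ring.
  rewrite tE (_ : s * - s = c ^+ 2 - (c ^+ 2 + s ^+ 2))%R; last by ring.
  by rewrite cs; ring.
congr (f (_, _)).
  have -> : (x + (t * y + 0) + (t * (y + (s * (x + (t * y + 0)) + 0)) + 0) =
     (1 + s * t) * x + t * (1 + (1 + s * t)) * y)%R by ring.
  by rewrite -cE tE mulNr.
have -> : (y + (s * (x + (t * y + 0)) + 0) = s * x + (1 + s * t) * y)%R by ring.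
by rewrite -cE.
Qed.

End plane_integral.

(** * Complex derivatives *)

Section normc_theory.
Context {R : realType}.
Implicit Types (z w : R[i]) (x y : R).

Lemma normc_norm z : `|z| = (normc z)%:C.
Proof. by case: z. Qed.

Lemma normc_ge0 z : 0 <= normc z.
Proof. by case: z => x y; rewrite sqrtr_ge0. Qed.

Lemma normcX z n : normc (z ^+ n) = normc z ^+ n.
Proof. by elim: n => [|n IH]; rewrite ?expr0 ?normc1// !exprS normcM IH. Qed.

Lemma normc_sqr z : normc z ^+ 2 = complex.Re z ^+ 2 + complex.Im z ^+ 2.
Proof. by case: z => x y; rewrite sqr_sqrtr// addr_ge0 ?sqr_ge0. Qed.

Lemma normc_real x : normc x%:C = `|x|.
Proof. by rewrite /= expr0n addr0 sqrtr_sqr. Qed.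

Lemma normc_nat m : normc (m%:R : R[i]) = m%:R.
Proof. by rewrite -(rmorph_nat (real_complex R)) normc_real ger0_norm. Qed.

Lemma normc_conj z : normc (Num.conj z) = normc z.
Proof. by case: z => x y; rewrite /= sqrrN. Qed.

Lemma normcBC z w : normc (z - w) = normc (w - z).
Proof. by rewrite -normcN opprB. Qed.

Lemma normc_eq0 z : (normc z == 0) = (z == 0).
Proof. by apply/eqP/eqP => [/eq0_normc//|->]; rewrite normc0. Qed.

Lemma normc_gt0 z : (0 < normc z) = (z != 0).
Proof. by rewrite lt_neqAle normc_ge0 andbT eq_sym normc_eq0. Qed.

Lemma normc_ge_Re z : `|complex.Re z| <= normc z.
Proof. by case: z => x y; rewrite -sqrtr_sqr ler_wsqrtr// lerDl sqr_ge0. Qed.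

Lemma normc_ge_Im z : `|complex.Im z| <= normc z.
Proof. by case: z => x y; rewrite -sqrtr_sqr ler_wsqrtr// lerDr sqr_ge0. Qed.

Lemma normc_le_ReIm z : normc z <= `|complex.Re z| + `|complex.Im z|.
Proof.
rewrite -(@ler_pXn2r _ 2)// ?nnegrE ?normc_ge0 ?addr_ge0//.
rewrite normc_sqr sqrrD !real_normK ?num_real// lerD2r lerDl.
by rewrite mulrn_wge0// mulr_ge0.
Qed.

Lemma normc_sum (I : Type) (r : seq I) (P : pred I) (F : I -> R[i]) :
  normc (\sum_(i <- r | P i) F i) <= \sum_(i <- r | P i) normc (F i).
Proof.
elim/big_ind2: _ => [|x a y b xa yb|//]; first by rewrite normc0.
by apply: le_trans (le_normcD _ _) _; exact: lerD.
Qed.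

Lemma le_normcB z w : normc (z - w) <= normc z + normc w.
Proof. by rewrite -[normc w]normcN; exact: le_normcD. Qed.

Lemma ler_normcB z w : normc z - normc w <= normc (z - w).
Proof. by rewrite lerBlDr; apply: le_trans (le_normcD _ _); rewrite subrK. Qed.

Lemma ReM z w : complex.Re (z * w) =
  complex.Re z * complex.Re w - complex.Im z * complex.Im w.
Proof. by case: z; case: w. Qed.

Lemma ImM z w : complex.Im (z * w) =
  complex.Re z * complex.Im w + complex.Im z * complex.Re w.
Proof. by case: z; case: w. Qed.

Lemma ReD z w : complex.Re (z + w) = complex.Re z + complex.Re w.
Proof. by case: z; case: w. Qed.

Lemma ImD z w : complex.Im (z + w) = complex.Im z + complex.Im w.
Proof. by case: z; case: w. Qed.

Lemma ReN z : complex.Re (- z) = - complex.Re z.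
Proof. by case: z. Qed.

Lemma ImN z : complex.Im (- z) = - complex.Im z.
Proof. by case: z. Qed.

Lemma mulcJ z : z * Num.conj z = (normc z ^+ 2)%:C.
Proof. by rewrite normc_sqr; case: z => x y /=; simpc; congr (_ +i* _); ring. Qed.

End normc_theory.

Section complex_derivative.
Context {R : realType}.
Implicit Types (f g : R[i] -> R[i]) (z w l : R[i]).

(** The division-free form of the derivative, with real [e] and [d]: it covers [w = z] and passes
    directly to real and imaginary parts. *)
Definition has_cderiv f z l := forall e : R, 0 < e ->
  exists2 d : R, 0 < d & forall w, normc (w - z) < d ->
    normc (f w - f z - l * (w - z)) <= e * normc (w - z).

Lemma derivable_has_cderiv f z :
  derivable (f : R[i]^o -> R[i]^o) z 1 -> exists l, has_cderiv f z l.
Proof.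
move=> /cvg_ex[l /= fl]; exists l => e e0.
move/cvgrPdist_le : fl => /(_ e%:C); rewrite ltcR => /(_ e0).
move=> /nbhs_ballP[d /= d0 dP].
(* In the partial order of [R[i]], [0 < d] forces [d] to be real. *)
have dE : d = (complex.Re d)%:C by move: d0; rewrite ltcE => /andP[/eqP]; case: (d) => a b /= ->.
exists (complex.Re d); first by move: d0; rewrite ltcE => /andP[].
move=> w wd; have [->|wz] := eqVneq w z.
  by rewrite !subrr mulr0 subrr normc0 mulr0.
have wz0 : w - z != 0 by rewrite subr_eq0.
have := dP (w - z) _ wz0.
rewrite /ball /= sub0r normrN normc_norm dE ltcR => /(_ wd).
rewrite normc_norm lecR => h.
rewrite -ler_pdivrMr ?normc_gt0// -normcV -normcM.
rewrite (_ : _ * _ = - (l - (w - z)^-1 *: (f ((w - z) *: (1 : R[i]^o) + z) - f z))).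
  by rewrite normcN.
rewrite /GRing.scale /= mulr1 subrK opprB mulrBl mulfK//.
by congr (_ - _); rewrite mulrC.
Qed.

Lemma has_cderiv_derivable f z l :
  has_cderiv f z l -> derivable (f : R[i]^o -> R[i]^o) z 1.
Proof.
move=> fl; apply/cvg_ex; exists l => /=; apply/cvgrPdist_le => /= e e0.
have eE : e = (complex.Re e)%:C by move: e0; rewrite ltcE => /andP[/eqP]; case: (e) => a b /= ->.
have [|d d0 dP] := fl (complex.Re e); first by move: e0; rewrite ltcE => /andP[].
apply/nbhs_ballP; exists d%:C; first by rewrite /= ltcR.
move=> h; rewrite /ball /= sub0r normrN normc_norm ltcR => hd h0.
have := dP (h + z); rewrite addrK => /(_ hd) fh.
rewrite normc_norm eE lecR -normcN.
rewrite (_ : - _ = (f (h + z) - f z - l * h) / h).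
  by rewrite normcM normcV ler_pdivrMr ?normc_gt0.
rewrite /GRing.scale /= mulr1 opprB mulrBl mulfK//.
by congr (_ - _); rewrite mulrC.
Qed.

Lemma has_cderiv_continuous f z l : has_cderiv f z l -> forall e, 0 < e ->
  exists2 d, 0 < d & forall w, normc (w - z) < d -> normc (f w - f z) < e.
Proof.
move=> /(_ _ ltr01)[d d0 dP] e e0.
have l0 : 0 < normc l + 1 by rewrite ltr_wpDl ?normc_ge0.
exists (Num.min d (e / (normc l + 1))); first by rewrite lt_min d0 divr_gt0.
move=> w; rewrite lt_min => /andP[wd]; rewrite ltr_pdivlMr// => we.
apply: le_lt_trans we; rewrite -(subrK (l * (w - z)) (f w - f z)).
apply: le_trans (le_normcD _ _) _; rewrite normcM.
by have := dP w wd; rewrite mul1r => h; lra.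
Qed.

Lemma has_cderivM f g z l m : has_cderiv f z l -> has_cderiv g z m ->
  has_cderiv (fun w => f w * g w) z (l * g z + f z * m).
Proof.
move=> fl gm e e0.
(* The remainder splits into four products, each bounded by [e / K] times the increment times one
   summand of [K]. *)
pose K := normc (g z) + normc (f z) + 1 + normc l.
have K0 : 0 < K by rewrite /K; have := normc_ge0 (g z); have := normc_ge0 (f z);
  have := normc_ge0 l; lra.
have k0 : 0 < e / K by rewrite divr_gt0.
have [d1 d10 h1] := fl _ k0; have [d2 d20 h2] := gm _ k0.
have [d3 d30 h3] := has_cderiv_continuous gm k0.
have [d4 d40 h4] := has_cderiv_continuous gm ltr01.
exists (Num.min (Num.min d1 d2) (Num.min d3 d4)); first by rewrite !lt_min d10 d20 d30.
move=> w; rewrite !lt_min => /andP[/andP[w1 w2] /andP[w3 w4]].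
have -> : f w * g w - f z * g z - (l * g z + f z * m) * (w - z) =
   (f w - f z - l * (w - z)) * (g w - g z) + (f w - f z - l * (w - z)) * g z
   + f z * (g w - g z - m * (w - z)) + l * (w - z) * (g w - g z) by ring.
set N := normc (w - z); have N0 : 0 <= N := normc_ge0 _.
have := h1 w w1; have := h2 w w2; have := h3 w w3; have := h4 w w4.
rewrite -/N; set k := e / K in k0 *.
set A := f w - f z - _; set B := g w - g z - _; set D := g w - g z => hD1 hD hB hA.
have -> : e = k * K by rewrite /k divfK// gt_eqF.
apply: le_trans (le_normcD _ _) _; rewrite !normcM -/N.
apply: le_trans (lerD (le_normcD _ _) (lexx _)) _.
apply: le_trans (lerD (lerD (le_normcD _ _) (lexx _)) (lexx _)) _.
rewrite !normcM /K.
have e1 : normc A * normc D <= k * N * 1.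
  by apply: ler_pM; rewrite ?normc_ge0//; exact: ltW.
have e2 : normc A * normc (g z) <= k * N * normc (g z).
  by apply: ler_wpM2r; rewrite ?normc_ge0.
have e3 : normc (f z) * normc B <= normc (f z) * (k * N).
  by apply: ler_wpM2l; rewrite ?normc_ge0.
have e4 : normc l * N * normc D <= normc l * N * k.
  by apply: ler_wpM2l; rewrite ?mulr_ge0 ?normc_ge0// ltW.
lra.
Qed.

Lemma has_cderivD f g z l m : has_cderiv f z l -> has_cderiv g z m ->
  has_cderiv (fun w => f w + g w) z (l + m).
Proof.
move=> fl gm e e0; have e20 : 0 < e / 2 by rewrite divr_gt0.
have [d1 d10 h1] := fl _ e20; have [d2 d20 h2] := gm _ e20.
exists (Num.min d1 d2); first by rewrite lt_min d10.
move=> w; rewrite lt_min => /andP[w1 w2].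
have -> : f w + g w - (f z + g z) - (l + m) * (w - z) =
  (f w - f z - l * (w - z)) + (g w - g z - m * (w - z)) by ring.
apply: le_trans (le_normcD _ _) _; have := h1 w w1; have := h2 w w2; lra.
Qed.

Lemma has_cderiv_id z : has_cderiv id z 1.
Proof.
move=> e e0; exists 1 => // w _; rewrite mul1r subrr normc0.
by rewrite mulr_ge0 ?normc_ge0// ltW.
Qed.

Lemma has_cderivC c z : has_cderiv (fun=> c) z 0.
Proof. by move=> e e0; exists 1 => // w _; rewrite mul0r !subrr normc0 mulr_ge0 ?normc_ge0 1?ltW. Qed.

Lemma has_cderivV z : z != 0 -> has_cderiv (fun w => w^-1) z (- z ^- 2).
Proof.
move=> z0 e e0; have nz : 0 < normc z by rewrite normc_gt0.
pose d := Num.min (normc z / 2) (e * normc z ^+ 3 / 2).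
exists d; first by rewrite lt_min !divr_gt0// mulr_gt0// exprn_gt0.
move=> w; rewrite lt_min => /andP[w1 w2].
have wz : normc z / 2 <= normc w.
  by have := ler_normcB z (z - w); rewrite subKr normcBC; lra.
have nw : 0 < normc w by lra.
have w0 : w != 0 by rewrite -normc_gt0.
have -> : w^-1 - z^-1 - - z ^- 2 * (w - z) = (w - z) * ((w - z) / (w * z ^+ 2)).
  by field; rewrite w0 z0.
rewrite normcM mulrC; apply: ler_wpM2r; first exact: normc_ge0.
rewrite normcM normcV normcM normcX ler_pdivrMr ?mulr_gt0 ?exprn_gt0//.
apply: le_trans (ltW w2) _.
rewrite (_ : e * normc z ^+ 3 / 2 = e * (normc z / 2 * normc z ^+ 2)); last by ring.
by rewrite ler_pM2l// ler_wpM2r// exprn_ge0// ltW.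
Qed.

Lemma has_cderiv_inv f z l : f z != 0 -> has_cderiv f z l ->
  exists m, has_cderiv (fun w => (f w)^-1) z m.
Proof.
move=> fz0 /has_cderiv_derivable df.
by apply: derivable_has_cderiv; exact: (derivableV fz0 df).
Qed.

Lemma has_cderiv_translate f z c l : has_cderiv f (z + c) l ->
  has_cderiv (fun w => f (w + c)) z l.
Proof.
move=> fl e e0; have [d d0 dP] := fl e e0; exists d => // w wd.
have := dP (w + c); rewrite (_ : w + c - (z + c) = w - z); last by ring.
exact.
Qed.

End complex_derivative.

(** * Mean values over squares *)

Section cauchy_square.
Context {R : realType}.
Local Notation mu := (@lebesgue_measure R).
Implicit Types (h F : R[i] -> R[i]).

Lemma segment_integral_ge (f : R -> R) a b K : a <= b ->
  segment_continuous f a b -> (forall x, a <= x <= b -> K <= f x) ->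
  K * (b - a) <= \int[mu]_(x in `[a, b]) f x.
Proof.
move=> ab fc fK; rewrite -(segment_length ab) -Rintegral_cst//.
apply: le_Rintegral => //; last exact: segment_integrable.
by apply: segment_integrable => x _; exact: cvg_cst.
Qed.

Lemma segment_integral_le (f g : R -> R) a b :
  segment_continuous f a b -> segment_continuous g a b ->
  (forall x, a <= x <= b -> f x <= g x) ->
  \int[mu]_(x in `[a, b]) f x <= \int[mu]_(x in `[a, b]) g x.
Proof. by move=> fc gc fg; apply: le_Rintegral => //; exact: segment_integrable. Qed.

(** The squares differ by two strips of full height and two rectangles between them. The form is
    closed on all four, so [goursat] makes their circulations vanish, and the inner sides cancel. *)
Lemma circulation_annulus (P Q : R -> R -> R) s t : 0 <= s -> s <= t ->
  (forall x y, `|x| <= t -> `|y| <= t -> s <= `|x| \/ s <= `|y| ->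
    closed_form_at P Q x y) ->
  circulation P Q (- t) t (- t) t = circulation P Q (- s) s (- s) s.
Proof.
move=> s0 st PQ.
have tt : - t <= t by lra.
have PQ' x y : -t <= x <= t -> - t <= y <= t ->
    [\/ x <= - s, s <= x, y <= - s | s <= y] -> closed_form_at P Q x y.
  move=> xt yt xy; apply: PQ; rewrite ?ler_norml//.
  by case: xy => h; [left|left|right|right]; rewrite ler_normr; apply/orP; lra.
have l1 : circulation P Q (- t) (- s) (- t) t = 0.
  apply: goursat; [lra|lra|move=> x y /andP[? ?] /andP[? ?]].
  by apply: PQ'; [lra|lra|constructor 1; lra].
have l2 : circulation P Q s t (- t) t = 0.
  apply: goursat; [lra|lra|move=> x y /andP[? ?] /andP[? ?]].
  by apply: PQ'; [lra|lra|constructor 2; lra].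
have l3 : circulation P Q (- s) s (- t) (- s) = 0.
  apply: goursat; [lra|lra|move=> x y /andP[? ?] /andP[? ?]].
  by apply: PQ'; [lra|lra|constructor 3; lra].
have l4 : circulation P Q (- s) s s t = 0.
  apply: goursat; [lra|lra|move=> x y /andP[? ?] /andP[? ?]].
  by apply: PQ'; [lra|lra|constructor 4; lra].
have Pc y : - t <= y <= t -> y <= - s \/ s <= y -> segment_continuous (P^~ y) (- t) t.
  move=> yt ys x xt; apply: (@closed_form_atl _ _ Q); apply: PQ' => //.
  by case: ys => ?; [constructor 3|constructor 4].
have Qc x : - t <= x <= t -> x <= - s \/ s <= x -> segment_continuous (Q x) (- t) t.
  move=> xt xs y yt; apply: (@closed_form_atr _ P); apply: PQ' => //.
  by case: xs => ?; [constructor 1|constructor 2].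
have [tst1 tst2 tst3 tst4] : [/\ - t <= - t <= t, - t <= t <= t,
  - t <= s <= t & - t <= - s <= t] by split; lra.
have [Pt PNt] : segment_continuous (P^~ t) (- t) t /\ segment_continuous (P^~ (- t)) (- t) t.
  by split; apply: Pc => //; [right|left]; lra.
have [Ps PNs] : segment_continuous (P^~ s) (- t) t /\ segment_continuous (P^~ (- s)) (- t) t.
  by split; apply: Pc => //; [right|left]; lra.
have [Qt QNt] : segment_continuous (Q t) (- t) t /\ segment_continuous (Q (- t)) (- t) t.
  by split; apply: Qc => //; [right|left]; lra.
have [Qs QNs] : segment_continuous (Q s) (- t) t /\ segment_continuous (Q (- s)) (- t) t.
  by split; apply: Qc => //; [right|left]; lra.
have sub a b (f : R -> R) : - t <= a -> b <= t -> segment_continuous f (- t) t ->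
  mu.-integrable `[a, b] (EFin \o f).
  by move=> ta bt fc; exact: segment_integrable (segment_continuousS ta bt fc).
have split3 (f : R -> R) : segment_continuous f (- t) t ->
    \int[mu]_(x in `[- t, t]) f x = \int[mu]_(x in `[- t, - s]) f x +
    (\int[mu]_(x in `[- s, s]) f x + \int[mu]_(x in `[s, t]) f x).
  move=> fc; rewrite (@segment_split _ f (- t) (- s)) ?lerN2//; last by lra.
  rewrite [in X in _ + X](@segment_split _ f (- s) s)//; first by lra.
  by apply: segment_continuousS fc => //; lra.
move: l1 l2 l3 l4; rewrite /circulation.
rewrite !(@RintegralB _ _ _ mu _ (P^~ _) (P^~ _)) ?(sub _ _ (P^~ _))//; try lra.
rewrite !(@RintegralB _ _ _ mu _ (Q _) (Q _)) ?(sub _ _ (Q _))//; try lra.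
rewrite !(split3 (P^~ _))// !(split3 (Q _))//; lra.
Qed.

(** This form is the imaginary part of F dz, and its closedness is the Cauchy-Riemann equation
    between d(Im F)/dy and d(Re F)/dx. *)
Lemma cderiv_closed_form F x y l : has_cderiv F (x +i* y) l ->
  closed_form_at (fun x y => complex.Im (F (x +i* y)))
                 (fun x y => complex.Re (F (x +i* y))) x y.
Proof.
move=> Fl; exists (complex.Im l), (complex.Re l), (- complex.Im l) => e e0.
have [d d0 dP] := Fl e e0; exists (d / 2); first by rewrite divr_gt0.
move=> x' y' xd yd.
have le1 : normc (x' +i* y' - x +i* y) <= `|x' - x| + `|y' - y|.
  exact: normc_le_ReIm.
have h : normc (F (x' +i* y') - F (x +i* y) - l * (x' +i* y' - x +i* y))
    <= e * (`|x' - x| + `|y' - y|).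
  apply: le_trans (dP _ _) _; first by lra.
  by rewrite ler_pM2l.
split; apply: le_trans h.
  apply: le_trans (normc_ge_Im _); rewrite !(ImD, ImN, ImM) /=.
  by rewrite le_eqVlt; apply/orP; left; apply/eqP; congr `|_|; ring.
apply: le_trans (normc_ge_Re _); rewrite !(ReD, ReN, ReM) /=.
by rewrite le_eqVlt; apply/orP; left; apply/eqP; congr `|_|; ring.
Qed.

Lemma cderiv_segment_re F a b (y : R) :
  (forall x, a <= x <= b -> exists l, has_cderiv F (x +i* y) l) ->
  segment_continuous (fun x => normc (F (x +i* y))) a b.
Proof.
move=> Fl x xab; have [l Fxl] := Fl x xab.
apply/cvgrPdist_lt => /= e e0; have [d d0 dP] := has_cderiv_continuous Fxl e0.
apply/nbhs_ballP; exists d => // w; rewrite /ball /= distrC => wx.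
have : normc (F (w +i* y) - F (x +i* y)) < e.
  apply: dP; apply: le_lt_trans (normc_le_ReIm _) _.
  by rewrite /= subrr normr0 addr0.
apply: le_lt_trans; rewrite ler_norml.
have := ler_normcB (F (w +i* y)) (F (x +i* y)).
have := ler_normcB (F (x +i* y)) (F (w +i* y)).
by rewrite (normcBC (F (x +i* y))) => ? ?; apply/andP; split; lra.
Qed.

Lemma cderiv_segment_im F a b (x : R) :
  (forall y, a <= y <= b -> exists l, has_cderiv F (x +i* y) l) ->
  segment_continuous (fun y => normc (F (x +i* y))) a b.
Proof.
move=> Fl y yab; have [l Fyl] := Fl y yab.
apply/cvgrPdist_lt => /= e e0; have [d d0 dP] := has_cderiv_continuous Fyl e0.
apply/nbhs_ballP; exists d => // w; rewrite /ball /= distrC => wy.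
have : normc (F (x +i* w) - F (x +i* y)) < e.
  apply: dP; apply: le_lt_trans (normc_le_ReIm _) _.
  by rewrite /= subrr normr0 add0r.
apply: le_lt_trans; rewrite ler_norml.
have := ler_normcB (F (x +i* w)) (F (x +i* y)).
have := ler_normcB (F (x +i* y)) (F (x +i* w)).
by rewrite (normcBC (F (x +i* y))) => ? ?; apply/andP; split; lra.
Qed.

Lemma Re_divc w (x y : R) : complex.Re (w * (x +i* y)^-1) =
  (complex.Re w * x + complex.Im w * y) / (x ^+ 2 + y ^+ 2).
Proof. by case: w => u v /=; rewrite mulrN opprK !mulrA -mulrDl. Qed.

Lemma Im_divc w (x y : R) : complex.Im (w * (x +i* y)^-1) =
  (complex.Im w * x - complex.Re w * y) / (x ^+ 2 + y ^+ 2).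
Proof. by case: w => u v /=; rewrite mulrN !mulrA addrC -mulrBl. Qed.

(* For [w] close to [A], [w / z] has real part at least about [A / (2 s)] on
   the vertical side [Re z = s] of the square [-s, s]^2. *)
Lemma side_lower_bound (A eta u v s y : R) : 0 <= A -> 0 < s -> `|y| <= s ->
  `|u - A| <= eta -> `|v| <= eta ->
  (A / 2 - 2 * eta) / s <= (u * s + v * y) / (s ^+ 2 + y ^+ 2).
Proof.
move=> A0 s0 ys uA vA; have e0 : 0 <= eta by apply: le_trans uA.
have y2 : y ^+ 2 <= s ^+ 2 by rewrite -[y ^+ 2]real_normK ?num_real// lerXn2r ?nnegrE// ltW.
have y20 : 0 <= y ^+ 2 by exact: sqr_ge0.
have s2 : 0 < s ^+ 2 by exact: exprn_gt0.
rewrite ler_pdivlMr; last by lra.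
rewrite mulrAC ler_pdivrMr//.
have vy : - (eta * s) <= v * y.
  have : `|v * y| <= eta * s by rewrite normrM ler_pM.
  by rewrite ler_norml => /andP[].
have us : (A - eta) * s <= u * s.
  by apply: ler_wpM2r; [exact: ltW|move: uA; rewrite ler_norml => /andP[]; lra].
have h : (A - 2 * eta) * s * s <= (u * s + v * y) * s.
  by apply: ler_wpM2r; [exact: ltW|lra].
apply: le_trans h; rewrite -mulrA -expr2.
have : A / 2 * (s ^+ 2 + y ^+ 2) <= A * s ^+ 2 by nra.
have : 0 <= eta * y ^+ 2 by rewrite mulr_ge0.
nra.
Qed.

(** Cauchy's formula as an inequality. With [c] the unimodular number that turns [h 0] into its
    modulus, the circulation attached to c h(z) / z is at most the right-hand side divided by [t].
    It is the same on every smaller square around 0, where the integrand is bounded below side by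
    side, so the integral of dz / z is never computed and 4 stands for 2 pi. *)
Lemma cauchy_square_bound h (t : R) : 0 < t ->
  (forall z, `|complex.Re z| <= t -> `|complex.Im z| <= t ->
     exists l, has_cderiv h z l) ->
  4 * t * normc (h 0) <=
    \int[mu]_(x in `[- t, t]) (normc (h (x +i* - t)) + normc (h (x +i* t))) +
    \int[mu]_(y in `[- t, t]) (normc (h (t +i* y)) + normc (h (- t +i* y))).
Proof.
move=> t0 hd; set L := (X in _ <= X).
pose A := normc (h 0).
have L0 : 0 <= L.
  by apply: addr_ge0; apply: Rintegral_ge0 => x _; rewrite addr_ge0 ?normc_ge0.
have [A0|A0] := eqVneq A 0; first by rewrite -/A A0 mulr0.
have Apos : 0 < A by rewrite lt_neqAle eq_sym A0 normc_ge0.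
pose c := Num.conj (h 0) / A%:C.
have c1 : normc c = 1.
  by rewrite normcM normcV normc_conj normc_real ger0_norm ?normc_ge0// divff.
have ch0 : c * h 0 = A%:C.
  rewrite mulrAC [Num.conj (h 0) * _]mulrC mulcJ rmorphXn /= -/A expr2 mulfK//.
  by rewrite -normc_eq0 normc_real normr_eq0.
pose F z := c * h z * z^-1.
pose P (x y : R) := complex.Im (F (x +i* y)).
pose Q (x y : R) := complex.Re (F (x +i* y)).
have Fd z : z != 0 -> `|complex.Re z| <= t -> `|complex.Im z| <= t ->
    exists l, has_cderiv F z l.
  move=> z0 zx zy; have [l hl] := hd z zx zy.
  by eexists; apply: has_cderivM (has_cderivM (has_cderivC c z) hl) (has_cderivV z0).
have nz (x y : R) : x != 0 \/ y != 0 -> x +i* y != 0.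
  by rewrite eq_complex /= negb_and => -[->|->]; rewrite ?orbT.
have PQ x y : `|x| <= t -> `|y| <= t -> x != 0 \/ y != 0 -> closed_form_at P Q x y.
  move=> xt yt /nz xy; have [l Fl] := Fd _ xy xt yt.
  exact: cderiv_closed_form Fl.
have hc1 y : `|y| <= t -> segment_continuous (fun x => normc (h (x +i* y))) (- t) t.
  by move=> yt; apply: cderiv_segment_re => x xt; apply: hd => //=; rewrite ler_norml.
have hc2 x : `|x| <= t -> segment_continuous (fun y => normc (h (x +i* y))) (- t) t.
  by move=> xt; apply: cderiv_segment_im => y yt; apply: hd => //=; rewrite ler_norml.
have ntt : `|t| <= t by rewrite ger0_norm// ltW.
have nNtt : `|- t| <= t by rewrite normrN.
have Pc u : 0 < u -> u <= t -> segment_continuous (fun x => P x (- u) - P x u) (- u) u.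
  move=> u0 ut; apply: segment_continuousB => x /andP[? ?];
    apply: (@closed_form_atl _ _ Q); apply: PQ;
    rewrite ?ler_norml; try (apply/andP; split; lra);
    by right; rewrite ?oppr_eq0 gt_eqF.
have Qc u : 0 < u -> u <= t -> segment_continuous (fun y => Q u y - Q (- u) y) (- u) u.
  move=> u0 ut; apply: segment_continuousB => x /andP[? ?];
    apply: (@closed_form_atr _ P); apply: PQ;
    rewrite ?ler_norml; try (apply/andP; split; lra);
    by left; rewrite ?oppr_eq0 gt_eqF.
have nF (x y : R) : t <= `|x| \/ t <= `|y| -> normc (F (x +i* y)) <= normc (h (x +i* y)) / t.
  move=> xy; rewrite /F normcM normcM c1 mul1r normcV.
  apply: ler_wpM2l; first exact: normc_ge0.
  have tz : t <= normc (x +i* y).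
    by case: xy => h'; apply: le_trans h' _; [exact: (normc_ge_Re (x +i* y))|
      exact: (normc_ge_Im (x +i* y))].
  by rewrite lef_pV2// posrE (lt_le_trans t0).
have up : circulation P Q (- t) t (- t) t <= L / t.
  rewrite /L mulrDl; apply: lerD.
    rewrite -RintegralZr//; last first.
      by apply/segment_integrable => x xt; apply: cvgD; apply: hc1.
    apply: segment_integral_le => [||x xt]; first exact: Pc.
      move=> x xt; apply: cvgM; last exact: cvg_cst.
      by apply: cvgD; apply: hc1.
    rewrite mulrDl; apply: lerD; (apply: le_trans (nF _ _ _);
      last by right; rewrite ?normrN ger0_norm// ltW).
      by apply: le_trans (ler_norm _) (normc_ge_Im _).
    by apply: le_trans (ler_norm _) _; rewrite normrN normc_ge_Im.
  rewrite -RintegralZr//; last first.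
    by apply/segment_integrable => x xt; apply: cvgD; apply: hc2.
  apply: segment_integral_le => [||y yt]; first exact: Qc.
    move=> y yt; apply: cvgM; last exact: cvg_cst.
    by apply: cvgD; apply: hc2.
  rewrite mulrDl; apply: lerD; (apply: le_trans (nF _ _ _);
    last by left; rewrite ?normrN ger0_norm// ltW).
    by apply: le_trans (ler_norm _) (normc_ge_Re _).
  by apply: le_trans (ler_norm _) _; rewrite normrN normc_ge_Re.
(* The four sides of the small square lose [16 * eta] in all, which becomes [e] after multiplication
   by [t]. *)
apply/ler_addgt0Pl => e e0; pose eta := e / (16 * t).
have eta0 : 0 < eta by rewrite divr_gt0// mulr_gt0.
have [l hl] : exists l, has_cderiv h 0 l by apply: hd; rewrite /= normr0 ltW.
have [d d0 hdist] := has_cderiv_continuous hl eta0.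
pose s := Num.min (d / 3) t.
have s0 : 0 < s by rewrite lt_min t0 divr_gt0.
have st : s <= t by rewrite ge_min lexx orbT.
have sd : s <= d / 3 by rewrite ge_min lexx.
have near0 x y : `|x| <= s -> `|y| <= s ->
    `|complex.Re (c * h (x +i* y)) - A| <= eta /\ `|complex.Im (c * h (x +i* y))| <= eta.
  move=> xs ys; have hz : normc (c * h (x +i* y) - A%:C) <= eta.
    rewrite -ch0 -mulrBr normcM c1 mul1r; apply/ltW/hdist.
    by rewrite subr0; apply: le_lt_trans (normc_le_ReIm _) _ => /=; lra.
  split; apply: le_trans hz.
    by apply: le_trans (normc_ge_Re _); rewrite ReD ReN.
  by apply: le_trans (normc_ge_Im _); rewrite ImD ImN /= oppr0 addr0.
pose k := (A / 2 - 2 * eta) / s.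
have low : (k + k) * (s - - s) + (k + k) * (s - - s) <=
    circulation P Q (- s) s (- s) s.
  have ss : - s <= s by lra.
  have nss : `|s| <= s by rewrite ger0_norm// ltW.
  have nNss : `|- s| <= s by rewrite normrN.
  apply: lerD; apply: segment_integral_ge => //; [exact: Pc| |exact: Qc|].
    move=> x; rewrite -ler_norml => xs.
    rewrite /P /F !Im_divc sqrrN -[- (_ / _)]mulNr [x ^+ 2 + _]addrC; apply: lerD.
      have [? ?] := near0 x (- s) xs nNss.
      by rewrite mulrN opprK [_ * x + _]addrC; apply: side_lower_bound => //; exact: ltW.
    have [? ?] := near0 x s xs nss.
    by rewrite opprB -mulNr; apply: side_lower_bound; rewrite ?normrN//; exact: ltW.
  move=> y; rewrite -ler_norml => ys; rewrite /Q /F !Re_divc sqrrN -[- (_ / _)]mulNr; apply: lerD.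
    by have [? ?] := near0 s y nss ys; apply: side_lower_bound => //; exact: ltW.
  rewrite opprD mulrN opprK -mulNr.
  by have [? ?] := near0 (- s) y nNss ys; apply: side_lower_bound; rewrite ?normrN//; exact: ltW.
have cE : circulation P Q (- t) t (- t) t = circulation P Q (- s) s (- s) s.
  apply: circulation_annulus st _; first exact: ltW.
  move=> x y xt yt xy; apply: PQ => //; rewrite -!normr_gt0.
  by case: xy => h'; [left|right]; exact: lt_le_trans h'.
move: low; rewrite -cE => /le_trans/(_ up).
rewrite (_ : (k + k) * (s - - s) + _ = 4 * A - 16 * eta); last first.
  by rewrite /k; field; rewrite gt_eqF.
rewrite ler_pdivlMr// mulrBl.
have -> : 16 * eta * t = e by rewrite /eta; field; rewrite gt_eqF.
rewrite -/A; lra.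
Qed.

End cauchy_square.

Section area_mean_value.
Context {R : realType}.
Local Notation mu := (@lebesgue_measure R).
Local Notation mu2 := (mu \x mu)%E.

Definition square (x0 y0 r : R) : set (plane R) :=
  `[x0 - r, x0 + r]%classic `*` `[y0 - r, y0 + r]%classic.

Lemma squareP x0 y0 r (p : plane R) : square x0 y0 r p <->
  `|(p.1 : R) - x0| <= r /\ `|(p.2 : R) - y0| <= r.
Proof. by rewrite /square /= !in_itv /= !ler_distl. Qed.

Lemma measurable_square x0 y0 r : measurable (square x0 y0 r).
Proof. by apply: measurableX; exact: measurable_itv. Qed.

Lemma EFin_Rintegral (f : R -> R) a b : segment_continuous f a b ->
  (\int[mu]_(x in `[a, b]) f x)%:E = (\int[mu]_(x in `[a, b]) (f x)%:E)%E.
Proof.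
move=> fc; rewrite /Rintegral fineK//.
exact: integrable_fin_num (segment_integrable fc).
Qed.

Lemma segment_integral_extend (u v : R -> R) (g1 g2 : R -> \bar R) a b :
  segment_continuous (fun x => u x + v x) a b ->
  measurable_fun setT g1 -> measurable_fun setT g2 ->
  (forall x, (0 <= g1 x)%E) -> (forall x, (0 <= g2 x)%E) ->
  (forall x, a <= x <= b -> (u x)%:E = g1 x /\ (v x)%:E = g2 x) ->
  ((\int[mu]_(x in `[a, b]) (u x + v x))%:E <=
   \int[mu]_x g1 x + \int[mu]_x g2 x)%E.
Proof.
move=> uvc m1 m2 g10 g20 uv; rewrite EFin_Rintegral// -ge0_integralD//.
apply: (@le_trans _ _ (\int[mu]_(x in `[a, b]) (g1 x + g2 x))%E).
  rewrite le_eqVlt; apply/orP; left; apply/eqP.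
  apply: eq_integral => x; rewrite inE /= in_itv /= => /uv[<- <-].
  by rewrite EFinD.
apply: ge0_subset_integral => //.
- exact: emeasurable_funD.
- by move=> x _; rewrite adde_ge0.
Qed.

(** The bound on square contours is integrated over half-sides t in [r / 2, r]: on the left 4 t is
    at least 2 r on an interval of length r / 2, and on the right each of the four sides sweeps at
    most the whole area integral. The nonnegative [g] lives on the whole plane so that Tonelli and
    reflections apply to complete lines. *)
Lemma cauchy_area_bound (h : R[i] -> R[i]) (r : R) (g : plane R -> \bar R) :
  0 < r ->
  (forall z, `|complex.Re z| <= r -> `|complex.Im z| <= r ->
     exists l, has_cderiv h z l) ->
  measurable_fun setT g -> (forall p, 0 <= g p)%E ->
  (forall p, square 0 0 r p -> g p = (normc (h (toC p)))%:E) ->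
  ((r ^+ 2 * normc (h 0))%:E <= 4%:E * \int[mu2]_p g p)%E.
Proof.
move=> r0 hd mg g0 gh.
pose G1 (y : R) := (\int[mu]_x g (x, y))%E.
pose G2 (x : R) := (\int[mu]_y g (x, y))%E.
have mG1 : measurable_fun setT G1.
  exact: (@measurable_fun_fubini_tonelli_G _ _ (measurableTypeR R) (measurableTypeR R) R mu).
have mG2 : measurable_fun setT G2.
  exact: (@measurable_fun_fubini_tonelli_F _ _ (measurableTypeR R) (measurableTypeR R) R mu).
have G10 y : (0 <= G1 y)%E by exact: integral_ge0.
have G20 x : (0 <= G2 x)%E by exact: integral_ge0.
have mN (G : R -> \bar R) : measurable_fun setT G -> measurable_fun setT (fun t : R => G (- t)).
  by move=> mG; apply: measurableT_comp => //; exact: oppr_measurable.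
have IG1 : (\int[mu]_y G1 y = \int[mu2]_p g p)%E.
  exact/esym/(@fubini_tonelli2 _ _ (measurableTypeR R) (measurableTypeR R) R mu mu g mg g0).
have IG2 : (\int[mu]_x G2 x = \int[mu2]_p g p)%E.
  exact/esym/(@fubini_tonelli1 _ _ (measurableTypeR R) (measurableTypeR R) R mu mu g mg g0).
pose S (t : R) := ((G1 (- t)%R + G1 t) + (G2 t + G2 (- t)%R))%E.
have mS : measurable_fun setT S.
  by apply: emeasurable_funD; apply: emeasurable_funD => //; exact: mN.
have S0 t : (0 <= S t)%E by apply: adde_ge0; apply: adde_ge0.
have bound t : r / 2 <= t <= r -> ((2 * r * normc (h 0))%:E <= S t)%E.
  move=> /andP[rt tr]; have t0 : 0 < t by lra.
  have hd' z : `|complex.Re z| <= t -> `|complex.Im z| <= t -> exists l, has_cderiv h z l.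
    by move=> ? ?; apply: hd; lra.
  have hc1 y : `|y| <= t -> segment_continuous (fun x => normc (h (x +i* y))) (- t) t.
    by move=> yt; apply: cderiv_segment_re => x xt; apply: hd' => //=; rewrite ler_norml.
  have hc2 x : `|x| <= t -> segment_continuous (fun y => normc (h (x +i* y))) (- t) t.
    by move=> xt; apply: cderiv_segment_im => y yt; apply: hd' => //=; rewrite ler_norml.
  have ntt : `|t| <= t by rewrite ger0_norm// ltW.
  have nNtt : `|- t| <= t by rewrite normrN.
  have inS (x y : R) : `|x| <= t -> `|y| <= t -> (normc (h (x +i* y)))%:E = g (x, y).
    by move=> xt yt; rewrite gh//; apply/squareP; rewrite /= !subr0; split; lra.
  apply: (@le_trans _ _ (4 * t * normc (h 0))%:E).
    by rewrite lee_fin; apply: ler_wpM2r; [exact: normc_ge0|lra].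
  have := cauchy_square_bound t0 hd'; rewrite -lee_fin => /le_trans; apply.
  rewrite EFinD; apply: leeD; apply: segment_integral_extend => //.
  - by move=> x xt; apply: cvgD; apply: hc1.
  - exact: measurableT_comp mg (measurable_pair2 _).
  - exact: measurableT_comp mg (measurable_pair2 _).
  - by move=> x xt; split; apply: inS; rewrite // ler_norml.
  - by move=> x xt; apply: cvgD; apply: hc2.
  - exact: measurableT_comp mg (measurable_pair1 _).
  - exact: measurableT_comp mg (measurable_pair1 _).
  - by move=> x xt; split; apply: inS; rewrite // ler_norml.
apply: (@le_trans _ _ (\int[mu]_(t in `[(r / 2)%R, r]) S t)%E).
  apply: (@le_trans _ _ (\int[mu]_(t in `[(r / 2)%R, r]) (cst (2 * r * normc (h 0))%:E t))%E).
    rewrite integral_cst//= lebesgue_measure_itv /= lte_fin ifT; last by lra.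
    rewrite -EFinB -EFinM lee_fin le_eqVlt; apply/orP; left; apply/eqP.
    by field.
  apply: (@ge0_le_integral _ (measurableTypeR R) R mu `[r / 2, r]%classic _ (cst (2 * r * normc (h 0))%:E) S) => //.
  - by move=> x _; rewrite lee_fin mulr_ge0 ?normc_ge0// mulr_ge0// ltW.
  - exact: measurable_funTS.
apply: (@le_trans _ _ (\int[mu]_t S t)%E).
  by apply: ge0_subset_integral.
have mN1 := mN _ mG1; have mN2 := mN _ mG2.
have -> : (\int[mu]_t S t = (\int[mu]_t G1 (- t)%R + \int[mu]_t G1 t) +
    (\int[mu]_t G2 t + \int[mu]_t G2 (- t)%R))%E.
  rewrite /S ge0_integralD//; last 4 first.
  - by move=> t _; exact: adde_ge0.
  - exact: emeasurable_funD.
  - by move=> t _; exact: adde_ge0.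
  - exact: emeasurable_funD.
  by congr (_ + _)%E; apply: ge0_integralD.
rewrite (integral_reflect mG1)// (integral_reflect mG2)//.
rewrite IG1 IG2; set I := integral _ _ _.
have I0 : (0 <= I)%E by exact: integral_ge0.
have -> : 4%:E = (1 + 1 + (1 + 1))%E :> \bar R.
  by rewrite -!EFinD; congr EFin; ring.
have I2 : ((1 + 1) * I = I + I)%E by rewrite ge0_muleDl ?lee01// mul1e.
by rewrite ge0_muleDl ?adde_ge0 ?lee01// I2.
Qed.

(* The function [f ^+ 2] is holomorphic, so no Cauchy-Schwarz step is needed. *)
Lemma area_mean_value (f : R[i] -> R[i]) (x0 y0 r : R) : 0 < r ->
  (forall z, `|complex.Re z - x0| <= r -> `|complex.Im z - y0| <= r ->
     exists l, has_cderiv f z l) ->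
  measurable_fun (square x0 y0 r) (fun p => normc (f (toC p))) ->
  ((r ^+ 2 * normc (f (x0 +i* y0)) ^+ 2)%:E <=
   4%:E * \int[mu2]_(p in square x0 y0 r) (normc (f (toC p)) ^+ 2)%:E)%E.
Proof.
move=> r0 fd mf; pose h z := f (z + (x0 +i* y0)) * f (z + (x0 +i* y0)).
pose G := ((fun p : plane R => (normc (f (toC p)) ^+ 2)%:E) \_ (square x0 y0 r))%E.
have mG : measurable_fun setT G.
  apply/(measurable_restrictT _ (measurable_square x0 y0 r)).
  by apply/measurable_EFinP; exact: measurable_funX.
have G0 p : (0 <= G p)%E.
  by rewrite /G patchE; case: ifP => // _; rewrite lee_fin exprn_ge0// normc_ge0.
rewrite integral_mkcond -/G -(integral_plane_translate x0 y0 mG G0).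
rewrite -normcX (_ : _ ^+ 2 = h 0); last by rewrite /h add0r expr2.
apply: cauchy_area_bound => //.
- move=> z zx zy; have [|| l fl] := fd (z + (x0 +i* y0)).
  + by rewrite ReD addrK.
  + by rewrite ImD addrK.
  have gl := has_cderiv_translate fl; exists (l * f (z + (x0 +i* y0)) + f (z + (x0 +i* y0)) * l).
  exact: (has_cderivM gl gl).
- apply: measurableT_comp => //; apply: measurable_fun_pair => //; exact: measurable_funD.
- move=> -[x y] /squareP[/= + +]; rewrite !subr0 => xr yr.
  rewrite /G patchE ifT; last by rewrite inE; apply/squareP; rewrite /= !addrK.
  by rewrite /h -expr2 normcX.
Qed.

End area_mean_value.

(** * Roots of unity *)

Section roots_of_unity.
Context {R : realType}.
Implicit Types (w z : R[i]).

Lemma complex_prim_root_exists n :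
  (0 < n)%N -> exists w : R[i], n.-primitive_root w.
Proof.
move=> n_gt0; pose p : {poly R[i]} := 'X^n - 1.
have [r Dp] := closed_field_poly_normal p.
rewrite (monicP _) ?monicXnsubC// scale1r in Dp.
have rn1 : all n.-unity_root r by apply/allP=> z; rewrite -root_prod_XsubC -Dp.
have sz_r : (n < (size r).+1)%N.
  by rewrite -(size_prod_XsubC r id) -Dp size_XnsubC.
have [|w] := hasP (cyclic.has_prim_root n_gt0 rn1 _ sz_r); last by exists w.
by rewrite -separable.separable_prod_XsubC -Dp cyclotomic.separable_Xn_sub_1// pnatr_eq0 -lt0n.
Qed.

Variables (M : nat) (w : R[i]).
Hypothesis wM : M.-primitive_root w.

Let M0 : (0 < M)%N := prim_order_gt0 wM.

Lemma normc_prim_root : normc w = 1.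
Proof.
have h : normc w ^+ M = 1 by rewrite -normcX (prim_expr_order wM) normc1.
by apply/eqP; rewrite -(@pexpr_eq1 _ _ M) ?normc_ge0 ?h// -lt0n.
Qed.

Lemma conj_prim_root : Num.conj w = w^-1.
Proof.
have w0 : w != 0 by rewrite -normc_eq0 normc_prim_root oner_eq0.
by apply: (mulfI w0); rewrite mulcJ normc_prim_root divff// expr1n.
Qed.

Lemma sum_prim_root z : z ^+ M = 1 -> z != 1 -> \sum_(j < M) z ^+ j = 0.
Proof.
move=> zM z1; have := subrX1 z M; rewrite zM subrr => /esym/eqP.
by rewrite mulf_eq0 subr_eq0 (negbTE z1) => /eqP.
Qed.

Lemma prim_root_orthogonal (i l : 'I_M) :
  \sum_(j < M) (w ^+ i * Num.conj (w ^+ l)) ^+ j = (if i == l then M%:R else 0).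
Proof.
have w0 : w != 0 by rewrite -normc_eq0 normc_prim_root oner_eq0.
rewrite rmorphXn /= conj_prim_root.
case: eqP => [->|/eqP il].
  rewrite exprVn divff ?expf_neq0//.
  by under eq_bigr do rewrite expr1n; rewrite sumr_const card_ord.
apply: sum_prim_root.
  have wX k : (w ^+ k) ^+ M = 1.
    by rewrite -exprM mulnC exprM (prim_expr_order wM) expr1n.
  by rewrite exprMn !exprVn !wX invr1 mulr1.
apply: contra il => /eqP h; have : w ^+ i = w ^+ l.
  by apply: (mulIf (expf_neq0 l (invr_neq0 w0))); rewrite h exprVn divff ?expf_neq0.
by move/eqP; rewrite (eq_prim_root_expr wM) !modn_small.
Qed.

Lemma discrete_parseval (A : 'I_M -> R[i]) :
  \sum_(j < M) normc (\sum_(i < M) A i * w ^+ (i * j)) ^+ 2 =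
  M%:R * \sum_(i < M) normc (A i) ^+ 2.
Proof.
apply: (@complexI R); rewrite rmorph_sum /= rmorphM /= rmorph_sum /= rmorph_nat.
under eq_bigr do rewrite -mulcJ rmorph_sum big_distrlr /=.
rewrite exchange_big /= mulr_sumr; apply: eq_bigr => i _.
rewrite exchange_big /= (bigD1 i)//= [X in _ + X]big1 ?addr0; last first.
  move=> l li; transitivity (A i * Num.conj (A l) * \sum_(j < M) (w ^+ i * Num.conj (w ^+ l)) ^+ j).
    rewrite mulr_sumr; apply: eq_bigr => j _.
    by rewrite rmorphM exprMn -rmorphXn -!exprM; ring.
  by rewrite prim_root_orthogonal eq_sym (negbTE li) mulr0.
transitivity (A i * Num.conj (A i) * \sum_(j < M) (w ^+ i * Num.conj (w ^+ i)) ^+ j).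
  rewrite mulr_sumr; apply: eq_bigr => j _.
  by rewrite rmorphM exprMn -rmorphXn -!exprM; ring.
by rewrite prim_root_orthogonal eqxx mulcJ mulrC.
Qed.

(* Summing [1 - z ^+ i] over [i < M] gives [M], while each term is at most
   [i * |1 - z|]. *)
Lemma unity_root_dist z : z ^+ M = 1 -> z != 1 -> 2 <= M.-1%:R * normc (1 - z).
Proof.
move=> zM z1; have nz : normc z = 1.
  have h : normc z ^+ M = 1 by rewrite -normcX zM normc1.
  by apply/eqP; rewrite -(@pexpr_eq1 _ _ M) ?normc_ge0 ?h// -lt0n.
have le1 i : normc (1 - z ^+ i) <= i%:R * normc (1 - z).
  elim: i => [|i IH]; first by rewrite expr0 subrr normc0 mul0r.
  have -> : 1 - z ^+ i.+1 = (1 - z ^+ i) + z ^+ i * (1 - z) by rewrite exprSr; ring.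
  apply: le_trans (le_normcD _ _) _.
  by rewrite normcM normcX nz expr1n mul1r -natr1 mulrDl mul1r lerD2r.
have : (M%:R : R) <= \sum_(i < M) i%:R * normc (1 - z).
  rewrite (_ : M%:R = normc (\sum_(i < M) (1 - z ^+ i))).
    apply: le_trans (normc_sum _ _ _) _; apply: ler_sum => i _; exact: le1.
  rewrite sumrB (sum_prim_root zM z1) subr0 sumr_const card_ord.
  by rewrite -[1 *+ M]/(M%:R) -(rmorph_nat (real_complex R)) normc_real ger0_norm.
have M0' : (0 : R) < M%:R by rewrite ltr0n.
rewrite -mulr_suml -natr_sum -(big_mkord xpredT id) bin2_sum bin2 => h.
have h2 : (M * M.-1)./2%:R <= M%:R * M.-1%:R / 2 :> R.
  rewrite ler_pdivlMr// -natrM -natrM ler_nat muln2.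
  by rewrite -[leqRHS]odd_double_half leq_addl.
rewrite -(ler_pM2l M0'); have := ler_wpM2r (normc_ge0 (1 - z)) h2; lra.
Qed.

End roots_of_unity.

(** * Measurability on the disk and invariance under rotations *)

Section disk_integrals.
Context {R : realType}.
Local Notation mu := (@lebesgue_measure R).
Local Notation mu2 := (mu \x mu)%E.

Lemma normc_near (z z' : R[i]) : `|normc z - normc z'| <= normc (z - z').
Proof.
rewrite ler_norml; have := ler_normcB z z'; have := ler_normcB z' z.
by rewrite (normcBC z') => ? ?; apply/andP; split; lra.
Qed.

Lemma near_plane_normc (p q : plane R) d :
  near_plane p (d / 2) q -> normc (toC q - toC p) < d.
Proof.
by move=> [h1 h2]; apply: le_lt_trans (normc_le_ReIm _) _; rewrite [ltRHS]splitr ltrD.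
Qed.

Lemma plane_open_pdisk : plane_open (@pdisk R).
Proof.
move=> p pD; have p1 : normc (toC p) < 1 := pD.
exists ((1 - normc (toC p)) / 2); first by rewrite divr_gt0// subr_gt0.
move=> q /near_plane_normc qp; rewrite -[pdisk q]/(is_true (normc (toC q) < 1)).
have := ler_normcB (toC q) (toC p); lra.
Qed.

Lemma measurable_pdisk : measurable (@pdisk R).
Proof. exact: plane_open_measurable plane_open_pdisk. Qed.

Lemma cderiv_measurable (f : R[i] -> R[i]) (A : set (plane R)) : plane_open A ->
  (forall p, A p -> exists l, has_cderiv f (toC p) l) ->
  measurable_fun A (fun p : plane R => normc (f (toC p))).
Proof.
move=> oA fd; apply: plane_continuous_measurable oA _ => p pD e e0.
have [l fl] := fd p pD; have [d d0 dP] := has_cderiv_continuous fl e0.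
exists (d / 2); first by rewrite divr_gt0.
move=> q /near_plane_normc qp; exact: le_lt_trans (normc_near _ _) (dP _ qp).
Qed.

Lemma holomorphic_measurable (f : R[i] -> R[i]) : holomorphic_disk f ->
  measurable_fun pdisk (fun p : plane R => normc (f (toC p))).
Proof.
move=> hf; apply: cderiv_measurable plane_open_pdisk _ => p pD.
exact: derivable_has_cderiv (hf _ pD).
Qed.

Lemma integral_disk_rotate (w : R[i]) (F : R[i] -> R) : normc w = 1 -> w != -1 ->
  (forall z, 0 <= F z) -> measurable_fun setT (fun p : plane R => F (toC p)) ->
  (\int[mu2]_(p in pdisk) (F (w * toC p))%:E = \int[mu2]_(p in pdisk) (F (toC p))%:E)%E.
Proof.
case: w => c s w1 wN1 F0 mF.
have cs : c ^+ 2 + s ^+ 2 = 1.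
  by have := normc_sqr (c +i* s); rewrite w1 expr1n.
have cN1 : c != -1.
  apply: contra wN1 => /eqP cE; have /eqP : s ^+ 2 = 0 by move: cs; rewrite cE; lra.
  by rewrite sqrf_eq0 => /eqP ->; rewrite cE eq_complex /= oppr0 !eqxx.
pose G := ((fun p : plane R => (F (toC p))%:E) \_ pdisk)%E.
have mG : measurable_fun setT G.
  apply/(measurable_restrictT _ measurable_pdisk); apply/measurable_EFinP.
  exact: measurable_funTS.
have G0 p : (0 <= G p)%E by rewrite /G patchE; case: ifP => // _; rewrite lee_fin.
rewrite integral_mkcond [RHS]integral_mkcond -/G -(integral_rotate cs cN1 mG G0).
apply: eq_integral => p _.
pose q : plane R := (c * p.1 - s * p.2, s * p.1 + c * p.2).
have pw : toC q = (c +i* s) * toC p.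
  by rewrite /toC /=; simpc; congr (_ +i* _); rewrite addrC.
have qD : (q \in pdisk) = (p \in pdisk).
  apply/idP/idP; rewrite !inE.
    by rewrite -[pdisk q]/(is_true (normc (toC q) < 1)) pw normcM w1 mul1r.
  by move=> pD; rewrite -[pdisk q]/(is_true (normc (toC q) < 1)) pw normcM w1 mul1r.
by rewrite /G !patchE -/q qD pw.
Qed.

End disk_integrals.

(** * Power series in the Bergman space *)

Section disk_moments.
Context {R : realType}.
Local Notation mu := (@lebesgue_measure R).
Local Notation mu2 := (mu \x mu)%E.

Lemma poly_FTC2 (p : {poly R}) (a b : R) : a < b ->
  (\int[mu]_(x in `[a, b]) (p^`().[x])%:E = (p.[b] - p.[a])%:E)%E.
Proof.
have hc (q : {poly R}) : continuous (horner q).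
  by move=> x; apply/differentiable_continuous/derivable1_diffP/derivable_horner.
move=> ab; rewrite EFinB; apply: continuous_FTC2 => //.
- exact/continuous_subspaceT/hc.
- split.
  + by move=> x _; exact: derivable_horner.
  + exact/cvg_at_right_filter/hc.
  + exact/cvg_at_left_filter/hc.
- by move=> x _; rewrite derive1E; apply: (@derive_val _ _ _ _ _ _ _ (is_derive_poly p x)).
Qed.

(* The radial moments are bounded through the divergence theorem: this is
   [d/dx (x (x^2 + b^2)^n)]. *)
Definition moment_density (b : R) n (x : R) : R :=
  (x ^+ 2 + b ^+ 2) ^+ n + (2 * n)%:R * x ^+ 2 * (x ^+ 2 + b ^+ 2) ^+ n.-1.

Lemma moment_density_ge0 b n x : 0 <= moment_density b n x.
Proof.
have xb : 0 <= x ^+ 2 + b ^+ 2 by rewrite addr_ge0 ?sqr_ge0.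
apply: addr_ge0; first exact: exprn_ge0.
by apply: mulr_ge0; [apply: mulr_ge0; rewrite ?sqr_ge0|exact: exprn_ge0].
Qed.

(** The antiderivative x (x^2 + b^2)^n equals x at the ends of the chord, where x^2 + b^2 = 1. The
    integral is thus the length of the chord, whatever [n] is. *)
Lemma moment_segment (b : R) n :
  (\int[mu]_(x in [set x : R | (x ^+ 2 + b ^+ 2 < 1)%R]) (moment_density b n x)%:E
   <= (2 * \1_(`[-1, 1]%classic : set R) b)%:E)%E.
Proof.
have [b1|b1] := ltP (b ^+ 2) 1; last first.
  rewrite (_ : [set x : R | _] = set0) ?integral_set0; last first.
    apply/seteqP; split=> x //= h; have := sqr_ge0 x; lra.
  by rewrite lee_fin mulr_ge0.
pose s := Num.sqrt (1 - b ^+ 2).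
have s0 : 0 < s by rewrite sqrtr_gt0 subr_gt0.
have s2 : s ^+ 2 = 1 - b ^+ 2 by rewrite sqr_sqrtr// subr_ge0 ltW.
have -> : [set x : R | x ^+ 2 + b ^+ 2 < 1] = `]- s, s[%classic.
  apply/seteqP; split=> x /=; rewrite in_itv /=.
    move=> h; rewrite -ltr_norml -(@ltr_pXn2r _ 2)// ?nnegrE ?(ltW s0)//.
    by rewrite real_normK ?num_real// s2; lra.
  rewrite -ltr_norml -(@ltr_pXn2r _ 2)// ?nnegrE ?(ltW s0)//.
  by rewrite real_normK ?num_real// s2; lra.
pose p : {poly R} := 'X * ('X^2 + (b ^+ 2)%:P) ^+ n.
have pE x : p^`().[x] = moment_density b n x.
  rewrite /p derivM derivX mul1r deriv_exp derivD derivXn derivC addr0.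
  rewrite -['X^_ *+ 2]scaler_nat -[_ * _ *+ n]scaler_nat.
  rewrite hornerD hornerM hornerX hornerZ hornerM hornerZ !horner_exp hornerD.
  rewrite hornerC !hornerXn /moment_density natrM expr1 hornerX; ring.
have nn : - s < s by lra.
apply: (@le_trans _ _ (\int[mu]_(x in `[(- s)%R, s]) (moment_density b n x)%:E)%E).
  apply: ge0_subset_integral => //=.
  - apply/measurable_EFinP; rewrite (_ : moment_density b n = horner p^`()).
      apply: measurable_funTS; apply: continuous_measurable_fun => x.
      exact/differentiable_continuous/derivable1_diffP/derivable_horner.
    by apply/funext => x; rewrite pE.
  - by move=> x _; rewrite lee_fin moment_density_ge0.
  - by apply: subset_itv; rewrite bnd_simp.
under eq_integral do rewrite -pE.
rewrite (poly_FTC2 p nn) lee_fin !hornerE sqrrN s2 subrK expr1n.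
have bb : -1 <= b <= 1 by apply/andP; split; nra.
rewrite indicE mem_set /=; last by rewrite in_itv.
have : s <= 1 by rewrite -(@ler_pXn2r _ 2)// ?nnegrE ?(ltW s0)// s2 expr1n; have := sqr_ge0 b; lra.
lra.
Qed.

Lemma pdiskE (x y : R) : (((x, y) : plane R) \in pdisk) = (x ^+ 2 + y ^+ 2 < 1).
Proof.
have h : (normc (x +i* y) < 1) = (x ^+ 2 + y ^+ 2 < 1).
  by rewrite -(@ltr_pXn2r _ 2)// ?nnegrE ?normc_ge0// normc_sqr expr1n.
by apply/idP/idP; rewrite inE -h.
Qed.

Lemma integral_indic_segment : (\int[mu]_b (2 * \1_(`[-1, 1]%classic : set R) b)%:E = 4%:E)%E.
Proof.
under eq_integral do rewrite EFinM.
rewrite ge0_integralZl//; last exact/measurable_EFinP/measurable_indic.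
rewrite integral_indic//= setIT lebesgue_measure_itv /= lte_fin ifT; last by lra.
by rewrite -EFinB -EFinM; congr EFin; ring.
Qed.

Lemma measurable_moment_density1 n :
  measurable_fun setT (fun p : plane R => moment_density p.2 n p.1).
Proof.
have m1 : measurable_fun setT (fun p : plane R => (p.1 : R) ^+ 2 + (p.2 : R) ^+ 2).
  by apply: measurable_funD; apply: measurable_funX.
apply: measurable_funD; first exact: measurable_funX.
apply: measurable_funM; last exact: measurable_funX.
by apply: measurable_funM => //; exact: measurable_funX.
Qed.

Lemma measurable_moment_density2 n :
  measurable_fun setT (fun p : plane R => moment_density p.1 n p.2).
Proof.
have m1 : measurable_fun setT (fun p : plane R => (p.2 : R) ^+ 2 + (p.1 : R) ^+ 2).
  by apply: measurable_funD; apply: measurable_funX.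
apply: measurable_funD; first exact: measurable_funX.
apply: measurable_funM; last exact: measurable_funX.
by apply: measurable_funM => //; exact: measurable_funX.
Qed.

Lemma disk_moment1 n :
  (\int[mu2]_(p in pdisk) (moment_density p.2 n p.1)%:E <= 4%:E)%E.
Proof.
pose G := ((fun p : plane R => (moment_density p.2 n p.1)%:E) \_ pdisk)%E.
have mG : measurable_fun setT G.
  apply/(measurable_restrictT _ (@measurable_pdisk R)); apply/measurable_EFinP.
  exact: (measurable_funTS (measurable_moment_density1 n)).
have G0 p : (0 <= G p)%E.
  by rewrite /G patchE; case: ifP => // _; rewrite lee_fin moment_density_ge0.
rewrite integral_mkcond -/G -integral_indic_segment.
rewrite [leLHS](@fubini_tonelli2 _ _ (measurableTypeR R) (measurableTypeR R) R mu mu _ mG G0).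
apply: ge0_le_integral => //.
- by move=> y _; exact: integral_ge0.
- exact: (@measurable_fun_fubini_tonelli_G _ _ (measurableTypeR R) (measurableTypeR R) R mu).
- by apply/measurable_EFinP; apply: measurable_funM => //; exact: measurable_indic.
- move=> y _; apply: le_trans (moment_segment y n).
  rewrite [leRHS]integral_mkcond le_eqVlt; apply/orP; left; apply/eqP.
  apply: eq_integral => x _; rewrite /G !patchE pdiskE.
  by rewrite (_ : (x \in [set x | x ^+ 2 + y ^+ 2 < 1]) = (x ^+ 2 + y ^+ 2 < 1))//;
    apply/idP/idP; rewrite inE.
Qed.

Lemma disk_moment2 n :
  (\int[mu2]_(p in pdisk) (moment_density p.1 n p.2)%:E <= 4%:E)%E.
Proof.
pose G := ((fun p : plane R => (moment_density p.1 n p.2)%:E) \_ pdisk)%E.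
have mG : measurable_fun setT G.
  apply/(measurable_restrictT _ (@measurable_pdisk R)); apply/measurable_EFinP.
  exact: (measurable_funTS (measurable_moment_density2 n)).
have G0 p : (0 <= G p)%E.
  by rewrite /G patchE; case: ifP => // _; rewrite lee_fin moment_density_ge0.
rewrite integral_mkcond -/G -integral_indic_segment.
rewrite [leLHS](@fubini_tonelli1 _ _ (measurableTypeR R) (measurableTypeR R) R mu mu _ mG G0).
apply: ge0_le_integral => //.
- by move=> x _; exact: integral_ge0.
- exact: (@measurable_fun_fubini_tonelli_F _ _ (measurableTypeR R) (measurableTypeR R) R mu).
- by apply/measurable_EFinP; apply: measurable_funM => //; exact: measurable_indic.
- move=> x _; apply: le_trans (moment_segment x n).
  rewrite [leRHS]integral_mkcond le_eqVlt; apply/orP; left; apply/eqP.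
  apply: eq_integral => y _; rewrite /G !patchE pdiskE addrC.
  by rewrite (_ : (y \in [set y | y ^+ 2 + x ^+ 2 < 1]) = (y ^+ 2 + x ^+ 2 < 1))//;
    apply/idP/idP; rewrite inE.
Qed.

(** The two densities add up to the divergence of |z|^(2n) (x, y), which is 2 (n + 1) |z|^(2n), and
    each of them has integral at most 4. *)
Lemma disk_moment n :
  (\int[mu2]_(p in pdisk) (normc (toC p) ^+ (2 * n))%:E <= (4 / n.+1%:R)%:E)%E.
Proof.
have n0 : (0 : R) < 2 * n.+1%:R by rewrite mulr_gt0.
have mpd := @measurable_pdisk R.
suff h : ((2 * n.+1%:R)%:E * \int[mu2]_(p in pdisk) (normc (toC p) ^+ (2 * n))%:E <= 8%:E)%E.
  move: h; rewrite -lee_pdivlMl// => /le_trans; apply.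
  rewrite -EFinM lee_fin le_eqVlt; apply/orP; left; apply/eqP.
  by move: n0; set m := n.+1%:R => m0; field; rewrite gt_eqF//; lra.
have mf : measurable_fun pdisk (fun p : plane R => (normc (toC p) ^+ (2 * n))%:E).
  apply/measurable_EFinP/measurable_funX.
  apply: (@cderiv_measurable R id) => [|p _]; first exact: plane_open_pdisk.
  by exists 1; exact: has_cderiv_id.
have f0 (p : plane R) : pdisk p -> (0 <= (normc (toC p) ^+ (2 * n))%:E)%E.
  by move=> _; rewrite lee_fin exprn_ge0// normc_ge0.
rewrite -(ge0_integralZl _ mpd mf f0); last by rewrite lee_fin ltW.
rewrite (_ : 8 = 4 + 4); last by ring.
rewrite EFinD; apply: le_trans (leeD (disk_moment1 n) (disk_moment2 n)).
rewrite -ge0_integralD//; last 4 first.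
- by move=> p _; rewrite lee_fin moment_density_ge0.
- by apply/measurable_EFinP; exact: (measurable_funTS (measurable_moment_density1 n)).
- by move=> p _; rewrite lee_fin moment_density_ge0.
- by apply/measurable_EFinP; exact: (measurable_funTS (measurable_moment_density2 n)).
rewrite le_eqVlt; apply/orP; left; apply/eqP; apply: eq_integral => -[x y] _ /=.
rewrite -EFinM -EFinD exprM; congr EFin.
rewrite -[Num.sqrt _]/(normc (x +i* y)) normc_sqr /= /moment_density.
rewrite [y ^+ 2 + x ^+ 2]addrC natrM; set t := x ^+ 2 + y ^+ 2.
case: n {n0 mf f0} => [|n]; first by rewrite !expr0; ring.
by rewrite /= exprS -(natr1 n.+1) /t; ring.
Qed.

End disk_moments.

Section binomial_series.
Context {R : realType}.

Lemma binomial_series_step (rho : R) d K :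
  (1 - rho) * \sum_(n < K) 'C(n + d.+1, d.+1)%:R * rho ^+ n =
  \sum_(n < K) 'C(n + d, d)%:R * rho ^+ n - 'C(K + d, d.+1)%:R * rho ^+ K.
Proof.
elim: K => [|K IH]; first by rewrite !big_ord0 mulr0 add0n bin_small// mul0r subrr.
rewrite !big_ord_recr /= mulrDr IH exprS addSn binS addnS binS !natrD; ring.
Qed.

(** By Pascal's rule each factor [1 - rho] lowers [d] by one, up to a nonnegative term that is
    subtracted; the case [d = 0] is the geometric sum. *)
Lemma binomial_series_bound (rho : R) d K : 0 <= rho -> rho <= 1 ->
  (1 - rho) ^+ d.+1 * \sum_(n < K) 'C(n + d, d)%:R * rho ^+ n <= 1.
Proof.
move=> r0 r1; have s0 : 0 <= 1 - rho by rewrite subr_ge0.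
elim: d => [|d IH].
  under eq_bigr do rewrite bin0 mul1r.
  by rewrite expr1 -opprB mulNr -subrX1 opprB lerBlDr lerDl exprn_ge0.
rewrite exprSr -mulrA binomial_series_step; apply: le_trans IH.
apply: ler_wpM2l; first exact: exprn_ge0.
by rewrite lerBlDr lerDl mulr_ge0 ?exprn_ge0.
Qed.

(** (n + 1)^3 is at most 6 C(n + 3, 3). Cubes arise when a power series is differentiated termwise:
    a linear bound on the coefficients meets a quadratic one on the second-order remainders of the
    powers. *)
Lemma cubic_geometric_bounded (rho : R) : 0 <= rho -> rho < 1 ->
  exists B : R, forall K, \sum_(n < K) n.+1%:R ^+ 3 * rho ^+ n <= B.
Proof.
move=> r0 r1; have s0 : 0 < 1 - rho by rewrite subr_gt0.
exists (6 / (1 - rho) ^+ 4) => K; rewrite ler_pdivlMr ?exprn_gt0//.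
apply: (@le_trans _ _ (6 * ((1 - rho) ^+ 4 * \sum_(n < K) 'C(n + 3, 3)%:R * rho ^+ n))).
  rewrite [leRHS]mulrCA [leLHS]mulrC; apply: ler_wpM2l; first by rewrite exprn_ge0// ltW.
  rewrite mulr_sumr; apply: ler_sum => n _.
  rewrite mulrA; apply: ler_wpM2r; first exact: exprn_ge0.
  rewrite -natrX -natrM ler_nat.
  have E : ('C(n + 3, 3) * 6 = (n + 3) * ((n + 2) * (n + 1)))%N.
    by rewrite -[6%N]/(3`!) bin_ffact !ffactnS ffactn0 !addnS addn0 muln1.
  rewrite mulnC E !expnS expn0 muln1; apply: leq_mul; first by lia.
  by apply: leq_mul; lia.
rewrite -[leRHS]mulr1 ler_pM2l//; apply: binomial_series_bound => //; exact: ltW.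
Qed.

End binomial_series.

Section power_series.
Context {R : realType}.
Local Notation mu := (@lebesgue_measure R).
Local Notation mu2 := (mu \x mu)%E.
Implicit Types (t b : nat -> R[i]) (z w : R[i]).

Definition ccvg (u : nat -> R[i]) (l : R[i]) := forall e : R, 0 < e ->
  exists K0, forall K, (K0 <= K)%N -> normc (u K - l) < e.

Lemma ccvg_normc_le (u : nat -> R[i]) l (B : R) :
  ccvg u l -> (forall K, normc (u K) <= B) -> normc l <= B.
Proof.
move=> ul uB; apply/ler_addgt0Pl => e e0.
have [K /(_ K (leqnn _)) h] := ul e e0.
by have := ler_normcB l (l - u K); rewrite subKr normcBC; have := uB K; lra.
Qed.

Lemma ccvgD (u v : nat -> R[i]) l m :
  ccvg u l -> ccvg v m -> ccvg (fun K => u K + v K) (l + m).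
Proof.
move=> ul vm e e0; have e20 : 0 < e / 2 by rewrite divr_gt0.
have [K1 h1] := ul _ e20; have [K2 h2] := vm _ e20.
exists (maxn K1 K2) => K; rewrite geq_max => /andP[k1 k2].
rewrite opprD addrACA; apply: le_lt_trans (le_normcD _ _) _.
by rewrite [ltRHS]splitr ltrD ?h1 ?h2.
Qed.

Lemma ccvgZ (c : R[i]) (u : nat -> R[i]) l :
  ccvg u l -> ccvg (fun K => c * u K) (c * l).
Proof.
move=> ul e e0; have c0 : 0 < normc c + 1 by rewrite ltr_wpDl ?normc_ge0.
have [K0 h] := ul (e / (normc c + 1)) (divr_gt0 e0 c0).
exists K0 => K /h; rewrite ltr_pdivlMr// => h'.
rewrite -mulrBr normcM; apply: le_lt_trans h'.
by rewrite mulrC ler_wpM2l ?normc_ge0// lerDl.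
Qed.

Lemma ccvg_unique (u : nat -> R[i]) l m : ccvg u l -> ccvg u m -> l = m.
Proof.
move=> ul um; apply/eqP; rewrite -subr_eq0 -normc_eq0 eq_le normc_ge0 andbT.
have -> : l - m = l + -1 * m by ring.
apply: (ccvg_normc_le (ccvgD ul (ccvgZ (-1) um))) => K.
by rewrite mulN1r subrr normc0.
Qed.

Lemma bounded_sum_cvg (u : nat -> R) (B : R) :
  (forall K, \sum_(n < K) `|u n| <= B) -> exists l : R, forall e, 0 < e ->
  exists K0, forall K, (K0 <= K)%N -> `|\sum_(n < K) u n - l| < e.
Proof.
move=> uB; have cu : cvgn (series u).
  apply: normed_cvg; apply: nondecreasing_is_cvgn.
    by apply: (@nondecreasing_series _ (fun n => `|u n|) xpredT 0) => n _ _.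
  by exists B => _ [K _ <-] /=; rewrite /series /= big_mkord.
move/cvg_ex : cu => [l /= ul]; exists l => e e0.
move/cvgrPdist_lt : ul => /(_ e e0)[K0 _ h]; exists K0 => K /h.
by rewrite /series /= big_mkord distrC.
Qed.

Lemma bounded_series_ccvg (u : nat -> R[i]) (B : R) :
  (forall K, \sum_(n < K) normc (u n) <= B) ->
  exists l, ccvg (fun K => \sum_(n < K) u n) l.
Proof.
move=> uB.
have [a ha] : exists a : R, forall e, 0 < e -> exists K0, forall K, (K0 <= K)%N ->
    `|\sum_(n < K) complex.Re (u n) - a| < e.
  apply: (@bounded_sum_cvg (fun n => complex.Re (u n)) B) => K; apply: le_trans (uB K).
  by apply: ler_sum => n _; exact: normc_ge_Re.
have [b hb] : exists b : R, forall e, 0 < e -> exists K0, forall K, (K0 <= K)%N ->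
    `|\sum_(n < K) complex.Im (u n) - b| < e.
  apply: (@bounded_sum_cvg (fun n => complex.Im (u n)) B) => K; apply: le_trans (uB K).
  by apply: ler_sum => n _; exact: normc_ge_Im.
exists (a +i* b) => e e0; have e20 : 0 < e / 2 by rewrite divr_gt0.
have [K1 h1] := ha _ e20; have [K2 h2] := hb _ e20.
exists (maxn K1 K2) => K; rewrite geq_max => /andP[k1 k2].
apply: le_lt_trans (normc_le_ReIm _) _.
have ReS : complex.Re (\sum_(n < K) u n) = \sum_(n < K) complex.Re (u n).
  by elim/big_ind2: _ => // x x' y y' <- <-; rewrite ReD.
have ImS : complex.Im (\sum_(n < K) u n) = \sum_(n < K) complex.Im (u n).
  by elim/big_ind2: _ => // x x' y y' <- <-; rewrite ImD.
by rewrite ReD ImD ReN ImN ReS ImS [ltRHS]splitr ltrD ?h1 ?h2.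
Qed.

Definition psum t K z := \sum_(n < K) t n * z ^+ n.

Lemma psum_cderiv t K z : exists l, has_cderiv (psum t K) z l.
Proof.
elim: K => [|K [l IH]].
  exists 0; rewrite (_ : psum t 0 = fun=> 0); first exact: has_cderivC.
  by apply/funext => w; rewrite /psum big_ord0.
have [m hm] : exists m, has_cderiv (fun w => w ^+ K) z m.
  elim: K {IH} => [|K [m hm]].
    exists 0; rewrite (_ : (fun w => w ^+ 0) = fun=> 1); first exact: has_cderivC.
    by apply/funext => w; rewrite expr0.
  exists (1 * z ^+ K + z * m).
  rewrite (_ : (fun w => w ^+ K.+1) = fun w => w * w ^+ K); last first.
    by apply/funext => w; rewrite exprS.
  exact: has_cderivM (has_cderiv_id z) hm.
exists (l + (0 * z ^+ K + t K * m)).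
rewrite (_ : psum t K.+1 = fun w => psum t K w + t K * w ^+ K); last first.
  by apply/funext => w; rewrite /psum big_ord_recr.
exact: has_cderivD IH (has_cderivM (has_cderivC (t K) z) hm).
Qed.

Lemma measurable_psum t K : measurable_fun setT (fun p : plane R => normc (psum t K (toC p))).
Proof.
apply: cderiv_measurable => [p _|p _]; first by exists 1.
exact: psum_cderiv.
Qed.

Lemma psum_scale t K (c z : R[i]) : psum t K (c * z) = psum (fun n => t n * c ^+ n) K z.
Proof. by apply: eq_bigr => n _; rewrite exprMn mulrA. Qed.

Lemma measurable_psum_scale t K (c : R[i]) :
  measurable_fun setT (fun p : plane R => normc (psum t K (c * toC p)) ^+ 2).
Proof.
under eq_fun do rewrite psum_scale.
by apply: measurable_funX; exact: measurable_psum.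
Qed.

Lemma integral_psum_rotate t K w j : normc w = 1 -> w != -1 ->
  (\int[mu2]_(p in pdisk) (normc (psum t K (w ^+ j * toC p)) ^+ 2)%:E =
   \int[mu2]_(p in pdisk) (normc (psum t K (toC p)) ^+ 2)%:E)%E.
Proof.
move=> w1 wN1; elim: j => [|j IH].
  by apply: eq_integral => p _; rewrite expr0 mul1r.
pose F z := normc (psum t K (w ^+ j * z)) ^+ 2.
have F0 z : 0 <= F z by rewrite /F exprn_ge0 ?normc_ge0.
transitivity (\int[mu2]_(p in pdisk) (F (w * toC p))%:E)%E.
  by apply: eq_integral => p _; rewrite /F (exprSr w j) -mulrA.
rewrite -[RHS]IH; apply: (@integral_disk_rotate R w F w1 wN1 F0).
exact: measurable_psum_scale.
Qed.

(** The integral is unchanged by rotations through M-th roots of unity, and [discrete_parseval] says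
    that the average of |psum|^2 over them is the sum of |t_n|^2 |z|^(2n). This gives orthogonality
    of monomials without polar coordinates. [2 < M] ensures that the generator differs from -1, as
    the rotation by shears demands. *)
Lemma psum_norm_prim t M : (2 < M)%N ->
  (\int[mu2]_(p in pdisk) (normc (psum t M (toC p)) ^+ 2)%:E <=
   (\sum_(n < M) normc (t n) ^+ 2 * (4 / n.+1%:R))%:E)%E.
Proof.
move=> M2; have M0 : (0 < M)%N by apply: leq_trans M2.
have [w wM] := complex_prim_root_exists (R := R) M0.
have w1 := normc_prim_root wM.
have wN1 : w != -1.
  apply/eqP => wE; have : (M %| 2)%N by rewrite (prim_order_dvd wM) wE sqrrN expr1n.
  by move/dvdn_leq => /(_ isT); rewrite leqNgt M2.
have MR : (0 : R) < M%:R by rewrite ltr0n.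
have mpd := @measurable_pdisk R.
have mps j : measurable_fun pdisk (fun p : plane R => (normc (psum t M (w ^+ j * toC p)) ^+ 2)%:E).
  by apply/measurable_EFinP; exact: (measurable_funTS (measurable_psum_scale _ _ _)).
have mz n : measurable_fun pdisk (fun p : plane R => (normc (toC p) ^+ (2 * n))%:E).
  apply/measurable_EFinP/measurable_funX.
  apply: (@cderiv_measurable R id) => [|p _]; first exact: plane_open_pdisk.
  by exists 1; exact: has_cderiv_id.
have f0 j (p : plane R) : pdisk p -> (0 <= (normc (psum t M (w ^+ j * toC p)) ^+ 2)%:E)%E.
  by move=> _; rewrite lee_fin exprn_ge0// normc_ge0.
have z0 n (p : plane R) : pdisk p -> (0 <= (normc (toC p) ^+ (2 * n))%:E)%E.
  by move=> _; rewrite lee_fin exprn_ge0// normc_ge0.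
pose tz n (p : plane R) := ((normc (t n) ^+ 2)%:E * (normc (toC p) ^+ (2 * n))%:E)%E.
have mtz n : measurable_fun pdisk (tz n) by exact: measurable_funeM.
have tz0 n (p : plane R) : pdisk p -> (0 <= tz n p)%E.
  by move=> pD; rewrite mule_ge0 ?z0// lee_fin exprn_ge0// normc_ge0.
set I := integral _ _ _.
have I0 : (0 <= I)%E by apply: integral_ge0 => p _; rewrite lee_fin exprn_ge0// normc_ge0.
pose J := (\int[mu2]_(p in pdisk) (\sum_(n < M) tz n p))%E.
have MI : (M%:R%:E * I = M%:R%:E * J)%E.
  transitivity (\sum_(j < M) \int[mu2]_(p in pdisk) (normc (psum t M (w ^+ j * toC p)) ^+ 2)%:E)%E.
    under eq_bigr do rewrite integral_psum_rotate//.
    rewrite -/I; elim: (M) => [|m IH]; first by rewrite big_ord0 mul0e.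
    by rewrite big_ord_recr /= -IH -natr1 EFinD ge0_muleDl ?lee_fin// mul1e.
  rewrite -(ge0_integral_sum _ mpd (fun j : 'I_M => mps j) (fun j : 'I_M => f0 j)) -ge0_integralZl//; last first.
  - by move=> p pD; apply: sume_ge0 => n _; exact: tz0.
  - exact: emeasurable_sum.
  apply: eq_integral => p _; rewrite /tz sumEFin.
  under [in RHS]eq_bigr do rewrite -EFinM.
  rewrite sumEFin -EFinM; congr EFin.
  transitivity (M%:R * \sum_(n < M) normc (t n * toC p ^+ n) ^+ 2).
    rewrite -(discrete_parseval wM).
    apply: eq_bigr => j _; congr (normc _ ^+ 2); apply: eq_bigr => n _.
    by rewrite exprMn -exprM mulnC; ring.
  congr (_ * _); apply: eq_bigr => n _.
  by rewrite normcM exprMn normcX -exprM mulnC.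
have -> : I = J.
  have Mfin : (M%:R : R)%:E \is a fin_num by [].
  have Mpos : (0 < (M%:R : R)%:E)%E by rewrite lte_fin.
  apply/le_anti/andP; split.
    by rewrite -(lee_pmul2l Mfin Mpos I J) MI.
  by rewrite -(lee_pmul2l Mfin Mpos J I) MI.
rewrite /J (ge0_integral_sum _ mpd (fun n : 'I_M => mtz n) (fun n : 'I_M => tz0 n)) -sumEFin; apply: lee_sum => n _.
rewrite (ge0_integralZl _ mpd (mz n) (z0 n)); last by rewrite lee_fin exprn_ge0// normc_ge0.
rewrite [leRHS]EFinM; apply: lee_wpmul2l; last exact: disk_moment.
by rewrite lee_fin exprn_ge0// normc_ge0.
Qed.

Lemma psum_norm t K :
  (\int[mu2]_(p in pdisk) (normc (psum t K (toC p)) ^+ 2)%:E <=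
   (\sum_(n < K) normc (t n) ^+ 2 * (4 / n.+1%:R))%:E)%E.
Proof.
(* Padding with zeros up to length [K + 3] meets the condition [2 < M]. *)
pose t' n := if (n < K)%N then t n else 0.
have KK : (K <= K + 3)%N by rewrite leq_addr.
have -> : psum t K = psum t' (K + 3).
  apply/funext => z; rewrite /psum (big_ord_widen _ (fun n => t n * z ^+ n) KK).
  rewrite big_mkcond; apply: eq_bigr => n _ /=; rewrite /t'.
  by case: ifP => // _; rewrite mul0r.
apply: le_trans (psum_norm_prim t' _) _; first by rewrite addn3.
rewrite lee_fin (big_ord_widen _ (fun n => normc (t n) ^+ 2 * (4 / n.+1%:R)) KK).
rewrite [leRHS]big_mkcond; apply: ler_sum => n _ /=; rewrite /t'.
by case: ifP => // _; rewrite normc0 expr0n mul0r.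
Qed.

Section limit_function.
Variables (t : nat -> R[i]) (g : R[i] -> R[i]) (E : R).
Hypothesis tE : forall K, \sum_(n < K) normc (t n) ^+ 2 / n.+1%:R <= E.
Hypothesis tg : forall z, disk z -> ccvg (psum t ^~ z) (g z).

(** A single term of the energy gives |t_n|^2 <= E (n + 1); this linear form is cruder but free of
    square roots. *)
Lemma coef_bound n : normc (t n) <= (E + 1) * n.+1%:R.
Proof.
have n1 : (1 : R) <= n.+1%:R by rewrite ler1n.
have tn0 k : 0 <= normc (t k) ^+ 2 / k.+1%:R.
  by rewrite divr_ge0 ?exprn_ge0 ?normc_ge0.
have E0 : 0 <= E by have := tE 0; rewrite big_ord0.
have : normc (t n) ^+ 2 / n.+1%:R <= E.
  apply: le_trans (tE n.+1); rewrite big_ord_recr /= lerDr; exact: sumr_ge0.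
rewrite ler_pdivrMr ?ltr0n// => h.
rewrite -(@ler_pXn2r _ 2)// ?nnegrE ?normc_ge0 ?mulr_ge0 ?addr_ge0//.
apply: le_trans h _; set m := n.+1%:R in n1 *.
have m0 : 0 <= m by lra.
by rewrite exprMn; apply: ler_pM => //; nra.
Qed.

(** The second-order Taylor remainder of the n-th power, by induction on [n]. As [rho] is at least 1
    / 2, the factor 4 pays for replacing the exponent [n.-1] by [n.+1], which puts every term over
    the same power of [rho]. *)
Lemma pow_expansion (z h : R[i]) (rho : R) n : 1 / 2 <= rho -> rho <= 1 ->
  normc z <= rho -> normc (z + h) <= rho ->
  normc ((z + h) ^+ n - z ^+ n - n%:R * z ^+ n.-1 * h) <=
  4 * n%:R ^+ 2 * rho ^+ n * normc h ^+ 2.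
Proof.
move=> r1 r2 zr zhr; have r0 : 0 <= rho by lra.
elim: n => [|n IH]; first by rewrite !expr0 subrr !mul0r subr0 normc0 expr0n /= mulr0 !mul0r.
have -> : (z + h) ^+ n.+1 - z ^+ n.+1 - n.+1%:R * z ^+ n.+1.-1 * h =
  (z + h) * ((z + h) ^+ n - z ^+ n - n%:R * z ^+ n.-1 * h) + n%:R * z ^+ n.-1 * h ^+ 2.
  case: n {IH} => [|n]; first by rewrite /= !expr1 !expr0; ring.
  by rewrite /= !exprS -(natr1 n.+1); ring.
apply: le_trans (le_normcD _ _) _; rewrite [leLHS](_ : _ =
  normc (z + h) * normc ((z + h) ^+ n - z ^+ n - n%:R * z ^+ n.-1 * h) +
  normc (n%:R : R[i]) * normc (z ^+ n.-1) * normc h ^+ 2); last first.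
  by rewrite !normcM expr2.
have nn (m : nat) : normc (m%:R : R[i]) = m%:R.
  by rewrite -(rmorph_nat (real_complex R)) normc_real ger0_norm.
have h2 : 0 <= normc h ^+ 2 by rewrite exprn_ge0// normc_ge0.
have a1 : normc (z + h) * normc ((z + h) ^+ n - z ^+ n - n%:R * z ^+ n.-1 * h) <=
    rho * (4 * n%:R ^+ 2 * rho ^+ n * normc h ^+ 2).
  by apply: ler_pM; rewrite ?normc_ge0.
have a2 : n%:R * rho ^+ n.-1 <= 4 * n%:R * rho ^+ n.+1.
  case: n {IH a1} => [|n]; first by rewrite mulr0 !mul0r.
  have mq : 0 <= n.+1%:R * rho ^+ n by rewrite mulr_ge0 ?exprn_ge0.
  have rr : 1 <= 4 * (rho * rho) by nra.
  by have := ler_wpM2l mq rr; rewrite /= !exprS; lra.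
have a3 : normc (n%:R : R[i]) * normc (z ^+ n.-1) * normc h ^+ 2 <=
    4 * n%:R * rho ^+ n.+1 * normc h ^+ 2.
  apply: ler_wpM2r => //; apply: le_trans a2; rewrite nn normcX.
  by apply: ler_wpM2l => //; apply: lerXn2r; rewrite ?nnegrE ?normc_ge0.
apply: le_trans (lerD a1 a3) _.
have -> : rho * (4 * n%:R ^+ 2 * rho ^+ n * normc h ^+ 2) +
   4 * n%:R * rho ^+ n.+1 * normc h ^+ 2 =
   (n%:R ^+ 2 + n%:R) * (4 * rho ^+ n.+1 * normc h ^+ 2) by rewrite (exprS rho n); ring.
rewrite [leRHS](_ : _ = n.+1%:R ^+ 2 * (4 * rho ^+ n.+1 * normc h ^+ 2)); last by ring.
apply: ler_wpM2r; first by apply: mulr_ge0 => //; rewrite mulr_ge0 ?exprn_ge0.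
rewrite -natr1; have : (0 : R) <= n%:R by []; nra.
Qed.

(** The derivative is the sum [d] of the termwise derivatives. Summing [pow_expansion] against
    [coef_bound] makes the remainder at most a constant times |w - z|^2, on the disk whose radius
    [rho] is midway between |z| and 1. *)
Lemma psum_limit_cderiv z : disk z -> exists l, has_cderiv g z l.
Proof.
move=> zD; have z1 : normc z < 1 := zD.
have nz := normc_ge0 z.
pose rho := (1 + normc z) / 2.
have r1 : 1 / 2 <= rho by rewrite /rho; lra.
have r2 : rho < 1 by rewrite /rho; lra.
have r0 : 0 <= rho by lra.
have zr : normc z <= rho by rewrite /rho; lra.
have E0 : 0 <= E by have := tE 0; rewrite big_ord0.
have [B hB] := cubic_geometric_bounded r0 r2.
have [d hd] : exists d, ccvg (fun K => \sum_(n < K) t n * (n%:R * z ^+ n.-1)) d.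
  apply: (@bounded_series_ccvg (fun n => t n * (n%:R * z ^+ n.-1)) ((E + 1) * 2 * B)) => K.
  apply: le_trans (ler_wpM2l _ (hB K)); last by rewrite mulr_ge0// addr_ge0.
  rewrite mulr_sumr; apply: ler_sum => n _.
  have nn (m : nat) : normc (m%:R : R[i]) = m%:R.
    by rewrite -(rmorph_nat (real_complex R)) normc_real ger0_norm.
  rewrite !normcM nn normcX.
  have b1 : n%:R * normc z ^+ n.-1 <= 2 * n.+1%:R ^+ 2 * rho ^+ n.
    case: (nat_of_ord n) => [|m]; first by rewrite mul0r !mulr_ge0.
    rewrite /= (exprS rho m); have zm : normc z ^+ m <= rho ^+ m.
      by apply: lerXn2r; rewrite ?nnegrE.
    have rm : 0 <= rho ^+ m by exact: exprn_ge0.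
    have m1 : (1 : R) <= m.+1%:R by rewrite ler1n.
    have m2 : (m.+1%:R : R) <= m.+2%:R ^+ 2 by rewrite -natrX ler_nat; nia.
    apply: (@le_trans _ _ (m.+1%:R * rho ^+ m)); first by apply: ler_wpM2l.
    have mq : 0 <= m.+2%:R ^+ 2 * rho ^+ m by rewrite mulr_ge0 ?exprn_ge0.
    have rr : 1 <= 2 * rho by lra.
    by have := ler_wpM2l mq rr; have := ler_wpM2r rm m2; lra.
  apply: (@le_trans _ _ ((E + 1) * n.+1%:R * (2 * n.+1%:R ^+ 2 * rho ^+ n))).
    by apply: ler_pM; rewrite ?normc_ge0 ?coef_bound// mulr_ge0 ?exprn_ge0.
  by rewrite le_eqVlt; apply/orP; left; apply/eqP; ring.
exists d => e e0.
have B0 : 0 <= B by have := hB 0; rewrite big_ord0.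
pose C := (E + 1) * 4 * B.
have C0 : 0 <= C by rewrite !mulr_ge0// addr_ge0.
exists (Num.min (rho - normc z) (e / (C + 1))).
  by rewrite lt_min; apply/andP; split; [rewrite /rho; lra|rewrite divr_gt0// ltr_wpDl].
move=> w; rewrite lt_min => /andP[w1]; rewrite ltr_pdivlMr ?ltr_wpDl// => w2.
have wz : normc (z + (w - z)) <= rho by apply: le_trans (le_normcD _ _) _; lra.
have wD : disk w.
  by rewrite /disk /=; move: wz; rewrite addrC subrK => /le_lt_trans; apply.
have lim : ccvg (fun K => \sum_(n < K) t n * (w ^+ n - z ^+ n - n%:R * z ^+ n.-1 * (w - z)))
    (g w - g z - d * (w - z)).
  rewrite (_ : g w - g z - d * (w - z) = g w + -1 * g z + - (w - z) * d); last by ring.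
  rewrite (_ : (fun K => _) = fun K => psum t K w + -1 * psum t K z +
      - (w - z) * \sum_(n < K) t n * (n%:R * z ^+ n.-1)).
    exact: ccvgD (ccvgD (tg wD) (ccvgZ (-1) (tg zD))) (ccvgZ (- (w - z)) hd).
  apply/funext => K; rewrite /psum !mulr_sumr -!big_split /=.
  by apply: eq_bigr => n _; ring.
have bd : normc (g w - g z - d * (w - z)) <= C * normc (w - z) ^+ 2.
  apply: ccvg_normc_le lim _ => K; apply: le_trans (normc_sum _ _ _) _.
  apply: (@le_trans _ _ ((E + 1) * 4 * normc (w - z) ^+ 2 * \sum_(n < K) n.+1%:R ^+ 3 * rho ^+ n)).
    rewrite mulr_sumr; apply: ler_sum => n _; rewrite normcM.
    have := @pow_expansion z (w - z) rho n r1 (ltW r2) zr wz; rewrite (addrC z) subrK => px.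
    apply: le_trans (ler_pM (normc_ge0 _) (normc_ge0 _) (coef_bound n) px) _.
    have nn1 : (n%:R : R) <= n.+1%:R by rewrite ler_nat.
    have sq : (n%:R : R) ^+ 2 <= n.+1%:R ^+ 2 by apply: lerXn2r; rewrite ?nnegrE.
    rewrite [leLHS](_ : _ = (E + 1) * n.+1%:R * 4 * rho ^+ n * normc (w - z) ^+ 2 * n%:R ^+ 2);
      last by ring.
    rewrite [leRHS](_ : _ = (E + 1) * n.+1%:R * 4 * rho ^+ n * normc (w - z) ^+ 2 * n.+1%:R ^+ 2);
      last by ring.
    by apply: ler_wpM2l => //; rewrite !mulr_ge0 ?exprn_ge0 ?addr_ge0 ?normc_ge0.
  rewrite /C mulrAC; apply: ler_wpM2r; first by rewrite exprn_ge0// normc_ge0.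
  by apply: ler_wpM2l; [rewrite mulr_ge0// addr_ge0|exact: hB].
apply: le_trans bd _; rewrite expr2 mulrA; apply: ler_wpM2r; first exact: normc_ge0.
apply: le_trans (ltW w2); rewrite mulrC; apply: ler_wpM2l; first exact: normc_ge0.
by rewrite lerDl.
Qed.

(** Fatou's lemma along the partial sums, whose norms are controlled by [psum_norm] uniformly in
    [K]. *)
Lemma psum_limit_norm :
  (\int[mu2]_(p in pdisk) (normc (g (toC p)) ^+ 2)%:E <= (4 * E)%:E)%E.
Proof.
have mpd := @measurable_pdisk R.
pose f K (p : plane R) := (normc (psum t K (toC p)) ^+ 2)%:E.
have mf K : measurable_fun pdisk (f K).
  by apply/measurable_EFinP/measurable_funX; exact: (measurable_funTS (measurable_psum t K)).
have f0 K (p : plane R) : pdisk p -> (0 <= f K p)%E.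
  by move=> _; rewrite lee_fin exprn_ge0// normc_ge0.
have -> : (\int[mu2]_(p in pdisk) (normc (g (toC p)) ^+ 2)%:E =
    \int[mu2]_(p in pdisk) limn_einf (f^~ p))%E.
  apply: eq_integral => p; rewrite inE => pD.
  apply/esym; apply: (cvg_limn_einf_sup _).1.
  apply: cvg_EFin; first by apply: nearW => K.
  have cv : (fun K => normc (psum t K (toC p))) @ \oo --> normc (g (toC p)).
    apply/cvgrPdist_lt => /= e e0; have [K0 hK] := tg pD e0.
    exists K0 => // K /hK h; rewrite distrC; exact: le_lt_trans (normc_near _ _) h.
  by under eq_fun do rewrite /f /= expr2; rewrite expr2; exact: (cvgM cv cv).
apply: le_trans (fatou _ mpd mf f0) _.
rewrite limn_einf_lim; apply: lime_le; first exact: is_cvg_einfs.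
apply: nearW => K; apply: (@le_trans _ _ (\int[mu2]_(p in pdisk) f K p)%E).
  by apply: ereal_inf_lbound; exists K => /=.
apply: le_trans (psum_norm t K) _; rewrite lee_fin.
apply: le_trans (ler_wpM2l _ (tE K)); last by [].
by rewrite mulr_sumr; apply: ler_sum => n _; rewrite mulrCA.
Qed.

End limit_function.

End power_series.

Section bergman_series.
Context {R : realType}.
Local Notation mu := (@lebesgue_measure R).
Local Notation mu2 := (mu \x mu)%E.

Lemma sqnormE (f : R[i] -> R[i]) : holomorphic_disk f ->
  sqnorm f = ((pi : R)^-1%:E * \int[mu2]_(p in pdisk) (normc (f (toC p)) ^+ 2)%:E)%E.
Proof.
move=> hf; rewrite /sqnorm /dA ge0_integral_mscale//.
- exact: measurable_pdisk.
- by apply/measurable_EFinP/measurable_funX; exact: holomorphic_measurable.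
- by move=> p _; rewrite lee_fin exprn_ge0// normc_ge0.
Qed.

Lemma sqnorm_ge0 (f : R[i] -> R[i]) : (0 <= sqnorm f)%E.
Proof. by apply: integral_ge0 => p _; rewrite lee_fin exprn_ge0// normc_ge0. Qed.

Lemma bergman_fine (f : R[i] -> R[i]) : bergman f -> (fine (sqnorm f))%:E = sqnorm f.
Proof. by move=> [_ fi _]; rewrite fineK// ge0_fin_numE// sqnorm_ge0. Qed.

Lemma psum_limit_bergman (t : nat -> R[i]) (g : R[i] -> R[i]) (E : R) :
  (forall K, \sum_(n < K) normc (t n) ^+ 2 / n.+1%:R <= E) ->
  (forall z, disk z -> ccvg (psum t ^~ z) (g z)) ->
  (forall z, ~ disk z -> g z = 0) ->
  bergman g /\ fine (sqnorm g) <= 4 / pi * E.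
Proof.
move=> tE tg g0.
have hg : holomorphic_disk g.
  move=> z zD; have [l gl] := psum_limit_cderiv tE tg zD.
  exact: has_cderiv_derivable gl.
have le1 : (sqnorm g <= (4 / pi * E)%:E)%E.
  rewrite sqnormE//; apply: le_trans (lee_wpmul2l _ (psum_limit_norm tE tg)) _.
    by rewrite lee_fin invr_ge0 pi_ge0.
  by rewrite -EFinM lee_fin le_eqVlt; apply/orP; left; apply/eqP; ring.
have gB : bergman g by split=> //; exact: le_lt_trans le1 (ltry _).
by split=> //; rewrite -lee_fin bergman_fine.
Qed.

Definition disk_restrict (g : R[i] -> R[i]) z := if z \in disk then g z else 0.

(** Polynomials are power series with eventually zero coefficients. They serve as test functions in
    the duality argument for the Toeplitz operator. *)
Lemma psum_bergman (t : nat -> R[i]) K :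
  bergman (disk_restrict (psum t K)) /\
  fine (sqnorm (disk_restrict (psum t K))) <=
    4 / pi * \sum_(n < K) normc (t n) ^+ 2 / n.+1%:R.
Proof.
pose t' n := if (n < K)%N then t n else 0.
have tn0 (s : nat -> R[i]) n : 0 <= normc (s n) ^+ 2 / n.+1%:R.
  by rewrite divr_ge0 ?exprn_ge0 ?normc_ge0.
have tE L : \sum_(n < L) normc (t' n) ^+ 2 / n.+1%:R <=
    \sum_(n < K) normc (t n) ^+ 2 / n.+1%:R.
  have KL : (K <= maxn K L)%N by rewrite leq_maxl.
  have LL : (L <= maxn K L)%N by rewrite leq_maxr.
  rewrite (big_ord_widen _ (fun n => normc (t' n) ^+ 2 / n.+1%:R) LL).
  rewrite (big_ord_widen _ (fun n => normc (t n) ^+ 2 / n.+1%:R) KL).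
  rewrite big_mkcond [leRHS]big_mkcond; apply: ler_sum => n _ /=; rewrite /t'.
  by case: ifP; case: ifP => // _ _; rewrite normc0 expr0n mul0r.
apply: psum_limit_bergman tE _ _ => z; rewrite /disk_restrict.
  move=> zD; rewrite mem_set// => e e0; exists K => L KL.
  have <- : psum t' L z = psum t K z; last by rewrite subrr normc0.
  rewrite /psum (big_ord_widen _ (fun n => t n * z ^+ n) KL) [RHS]big_mkcond.
  by apply: eq_bigr => n _; rewrite /t'; case: ifP => // _; rewrite mul0r.
by move=> zD; rewrite memNset.
Qed.

End bergman_series.

(** * Integrals of complex-valued functions *)

Section complex_integral.
Context {R : realType} (nu : {finite_measure set (plane R) -> \bar R}).
Implicit Types (F G : R[i] -> R[i]).

Definition cmeasurable F :=
  measurable_fun pdisk (fun p : plane R => complex.Re (F (toC p))) /\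
  measurable_fun pdisk (fun p : plane R => complex.Im (F (toC p))).

Lemma cmeasurableM F G : cmeasurable F -> cmeasurable G ->
  cmeasurable (fun z => F z * G z).
Proof.
move=> [f1 f2] [g1 g2]; split.
  under eq_fun do rewrite ReM.
  by apply: measurable_funB; exact: measurable_funM.
under eq_fun do rewrite ImM.
by apply: measurable_funD; exact: measurable_funM.
Qed.

Lemma cmeasurableD F G : cmeasurable F -> cmeasurable G ->
  cmeasurable (fun z => F z + G z).
Proof.
move=> [f1 f2] [g1 g2]; split.
  by under eq_fun do rewrite ReD; exact: measurable_funD.
by under eq_fun do rewrite ImD; exact: measurable_funD.
Qed.

Lemma cmeasurable_cst (c : R[i]) : cmeasurable (fun=> c).
Proof. by split; exact: measurable_cst. Qed.

Lemma cmeasurable_conj F : cmeasurable F -> cmeasurable (fun z => Num.conj (F z)).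
Proof.
move=> [f1 f2]; split.
  by rewrite (_ : (fun p => _) = (fun p : plane R => complex.Re (F (toC p))))//;
    apply/funext => p; case: (F _).
rewrite (_ : (fun p => _) = (fun p : plane R => - complex.Im (F (toC p)))).
  exact: measurableT_comp.
by apply/funext => p; case: (F _).
Qed.

Lemma cmeasurable_cderiv F : (forall z, disk z -> exists l, has_cderiv F z l) ->
  cmeasurable F.
Proof.
move=> Fd.
have near (p : plane R) e : pdisk p -> 0 < e -> exists2 d, 0 < d & forall q : plane R,
    near_plane p d q -> normc (F (toC q) - F (toC p)) < e.
  move=> pD e0; have [l fl] := Fd _ pD; have [d d0 dP] := has_cderiv_continuous fl e0.
  exists (d / 2); first by rewrite divr_gt0.
  by move=> q /near_plane_normc; exact: dP.
split; apply: plane_continuous_measurable plane_open_pdisk _ => p pD e e0;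
  have [d d0 dP] := near p e pD e0; exists d => // q /dP; apply: le_lt_trans.
  by apply: le_trans (normc_ge_Re _); rewrite ReD ReN.
by apply: le_trans (normc_ge_Im _); rewrite ImD ImN.
Qed.

Lemma cintegrable_dom F (G : plane R -> R) : cmeasurable F ->
  nu.-integrable pdisk (EFin \o G) ->
  (forall p, pdisk p -> normc (F (toC p)) <= G p) -> cintegrable nu F.
Proof.
move=> [m1 m2] iG FG; have mpd := @measurable_pdisk R.
split; apply: (le_integrable mpd _ _ iG).
- exact/measurable_EFinP.
- move=> p pD; rewrite /= lee_fin [leRHS]ger0_norm.
    exact: le_trans (normc_ge_Re _) (FG _ pD).
  exact: le_trans (normc_ge0 _) (FG _ pD).
- exact/measurable_EFinP.
- move=> p pD; rewrite /= lee_fin [leRHS]ger0_norm.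
    exact: le_trans (normc_ge_Im _) (FG _ pD).
  exact: le_trans (normc_ge0 _) (FG _ pD).
Qed.

(** The factor 2 comes from bounding the real and imaginary parts separately. *)
Lemma normc_cintegral_le F (G : plane R -> R) : cintegrable nu F ->
  nu.-integrable pdisk (EFin \o G) ->
  (forall p, pdisk p -> normc (F (toC p)) <= G p) ->
  normc (cintegral nu F) <= 2 * \int[nu]_(p in pdisk) G p.
Proof.
move=> [i1 i2] iG FG; have mpd := @measurable_pdisk R.
apply: le_trans (normc_le_ReIm _) _; rewrite mulr_natl mulr2n /=; apply: lerD.
  apply: le_trans (le_normr_Rintegral mpd i1) _; apply: le_Rintegral => //.
    exact: integrable_norm i1.
  by move=> p pD; exact: le_trans (normc_ge_Re _) (FG _ pD).
apply: le_trans (le_normr_Rintegral mpd i2) _; apply: le_Rintegral => //.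
  exact: integrable_norm i2.
by move=> p pD; exact: le_trans (normc_ge_Im _) (FG _ pD).
Qed.

Lemma eq_cintegral F G : (forall z, disk z -> F z = G z) ->
  cintegral nu F = cintegral nu G.
Proof.
move=> FG; rewrite /cintegral; congr (_ +i* _);
  by apply: eq_Rintegral => p; rewrite inE => pD; rewrite FG.
Qed.

Lemma cintegrableD F G : cintegrable nu F -> cintegrable nu G ->
  cintegrable nu (fun z => F z + G z).
Proof.
move=> [f1 f2] [g1 g2]; have mpd := @measurable_pdisk R; split.
  by under eq_fun do rewrite ReD EFinD; exact: integrableD.
by under eq_fun do rewrite ImD EFinD; exact: integrableD.
Qed.

Lemma cintegralD F G : cintegrable nu F -> cintegrable nu G ->
  cintegral nu (fun z => F z + G z) = cintegral nu F + cintegral nu G.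
Proof.
move=> [f1 f2] [g1 g2]; have mpd := @measurable_pdisk R.
rewrite {2 3}/cintegral; simpc; rewrite -!RintegralD//.
by rewrite /cintegral; congr (_ +i* _); apply: eq_Rintegral => p _;
  rewrite ?ReD ?ImD.
Qed.

Lemma cintegrableZ (c : R[i]) F : cintegrable nu F -> cintegrable nu (fun z => c * F z).
Proof.
move=> [f1 f2]; have mpd := @measurable_pdisk R; split.
  under eq_fun do rewrite ReM EFinB !EFinM.
  by apply: integrableB => //; exact: integrableZl.
under eq_fun do rewrite ImM EFinD !EFinM.
by apply: integrableD => //; exact: integrableZl.
Qed.

Lemma cintegralZ (c : R[i]) F : cintegrable nu F ->
  cintegral nu (fun z => c * F z) = c * cintegral nu F.
Proof.
move=> [f1 f2]; have mpd := @measurable_pdisk R.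
have i1 r : nu.-integrable pdisk (EFin \o (fun p => r * complex.Re (F (toC p)))).
  exact: (integrableZl mpd r f1).
have i2 r : nu.-integrable pdisk (EFin \o (fun p => r * complex.Im (F (toC p)))).
  exact: (integrableZl mpd r f2).
rewrite {2}/cintegral; case: c => a b; simpc; rewrite -!RintegralZl//.
rewrite /cintegral; congr (_ +i* _).
  rewrite -(RintegralB mpd (i1 a) (i2 b)).
  by apply: eq_Rintegral => p _; rewrite ReM.
rewrite -(RintegralD mpd (i2 a) (i1 b)).
by apply: eq_Rintegral => p _; rewrite ImM.
Qed.

Lemma cintegral0 : cintegral nu (fun=> 0) = 0.
Proof.
by rewrite /cintegral /=; congr (_ +i* _); rewrite /Rintegral integral0.
Qed.

Lemma cintegral_sum K (F : nat -> R[i] -> R[i]) : (forall n, cintegrable nu (F n)) ->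
  cintegrable nu (fun z => \sum_(n < K) F n z) /\
  cintegral nu (fun z => \sum_(n < K) F n z) = \sum_(n < K) cintegral nu (F n).
Proof.
move=> iF; elim: K => [|K [IH1 IH2]].
  under eq_fun do rewrite big_ord0.
  rewrite big_ord0 cintegral0; split=> //.
  by split; rewrite /=; exact: integrable0.
under eq_fun do rewrite big_ord_recr.
by rewrite big_ord_recr /= -IH2; split; [exact: cintegrableD|exact: cintegralD].
Qed.

End complex_integral.

(** * Toeplitz operators of Carleson measures *)

Section toeplitz_series.
Context {R : realType} (nu : {finite_measure set (plane R) -> \bar R}) (C : R).
Hypothesis C0 : 0 <= C.
Hypothesis carleson : forall f : R[i] -> R[i], bergman f ->
  (\int[nu]_(p in pdisk) (normc (f (toC p)) ^+ 2)%:E <= (C * fine (sqnorm f))%:E)%E.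
Implicit Types (f g : R[i] -> R[i]) (z w : R[i]).

Let mpd := @measurable_pdisk R.

Lemma bergman_measurable f : bergman f ->
  measurable_fun pdisk (fun p : plane R => normc (f (toC p))).
Proof. by move=> [hf _ _]; exact: holomorphic_measurable. Qed.

Lemma bergman_cmeasurable f : bergman f -> cmeasurable f.
Proof.
by move=> [hf _ _]; apply: cmeasurable_cderiv => z zD; exact: derivable_has_cderiv (hf z zD).
Qed.

Lemma bergman_sq_integrable f : bergman f ->
  nu.-integrable pdisk (EFin \o (fun p => normc (f (toC p)) ^+ 2)).
Proof.
move=> fB; apply/integrableP; split.
  by apply/measurable_EFinP/measurable_funX; exact: bergman_measurable.
apply: le_lt_trans (ltry (C * fine (sqnorm f))); apply: le_trans (carleson fB).
rewrite le_eqVlt; apply/orP; left; apply/eqP; apply: eq_integral => p _.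
by rewrite /= ger0_norm// exprn_ge0// normc_ge0.
Qed.

(** For a finite measure, square integrability implies integrability, through |f| <= 1 + |f|^2. *)
Lemma bergman_integrable f : bergman f ->
  nu.-integrable pdisk (EFin \o (fun p => normc (f (toC p)))).
Proof.
move=> fB; apply: (@le_integrable _ _ _ nu _ mpd _
    (fun p => (1 + normc (f (toC p)) ^+ 2)%:E)).
- by apply/measurable_EFinP; exact: bergman_measurable.
- move=> p _; rewrite /= lee_fin ger0_norm ?normc_ge0// ger0_norm.
    by have := normc_ge0 (f (toC p)); nra.
  by rewrite addr_ge0// exprn_ge0// normc_ge0.
- under eq_fun do rewrite EFinD.
  apply: integrableD => //; last exact: bergman_sq_integrable.
  exact: finite_measure_integrable_cst.
Qed.

Lemma kernel_denominator z w : disk z -> disk w ->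
  1 - normc z <= normc (1 - z * Num.conj w).
Proof.
move=> zD wD; have w1 : normc w < 1 := wD.
have := ler_normcB 1 (z * Num.conj w); rewrite normc1 normcM normc_conj.
have : normc z * normc w <= normc z by rewrite ler_piMr ?normc_ge0// ltW.
lra.
Qed.

(** The kernel is antiholomorphic in [w]: it is the conjugate of the holomorphic function [K]. *)
Lemma cmeasurable_kernel z : disk z ->
  cmeasurable (fun w => ((1 - z * Num.conj w) ^+ 2)^-1).
Proof.
move=> zD; pose K w := ((1 + - Num.conj z * w) * (1 + - Num.conj z * w))^-1.
have KE w : ((1 - z * Num.conj w) ^+ 2)^-1 = Num.conj (K w).
  by rewrite /K fmorphV rmorphM rmorphD rmorph1 rmorphM rmorphN /= conjCK mulNr expr2.
rewrite (_ : (fun w => _) = fun w => Num.conj (K w)); last by apply/funext => w.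
apply/cmeasurable_conj/cmeasurable_cderiv => w wD.
have d0 : 1 + - Num.conj z * w != 0.
  have : 0 < normc (1 - w * Num.conj z).
    by apply: lt_le_trans (kernel_denominator wD zD); rewrite subr_gt0; exact: wD.
  by rewrite normc_gt0 mulNr mulrC.
have hg := has_cderivD (has_cderivC 1 w)
  (has_cderivM (has_cderivC (- Num.conj z) w) (has_cderiv_id w)).
by apply: has_cderiv_inv (has_cderivM hg hg); rewrite mulf_neq0.
Qed.

Lemma cmeasurable_conj_pow n : cmeasurable (fun w : R[i] => Num.conj w ^+ n).
Proof.
rewrite (_ : (fun w => _) = fun w => Num.conj (w ^+ n)); last first.
  by apply/funext => w; rewrite rmorphXn.
apply/cmeasurable_conj/cmeasurable_cderiv => w _.
have [l hl] := psum_cderiv (fun k => (k == n)%:R) n.+1 w.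
exists l; rewrite (_ : (fun z => _) = psum (fun k => (k == n)%:R) n.+1)//.
apply/funext => z; rewrite /psum big_ord_recr /= eqxx mul1r big1 ?add0r// => k _.
by rewrite ltn_eqF ?mul0r.
Qed.

(** Every integral of the operator has this shape, with [k] a conjugate power, the kernel itself, or
    the difference between the kernel and a partial sum of its series. *)
Lemma bergman_mul_cintegral f (k : R[i] -> R[i]) (b : R) : bergman f ->
  cmeasurable k -> (forall w, disk w -> normc (k w) <= b) ->
  cintegrable nu (fun w => f w * k w) /\
  normc (cintegral nu (fun w => f w * k w)) <=
    2 * (b * \int[nu]_(p in pdisk) normc (f (toC p))).
Proof.
move=> fB mk kb; have iG : nu.-integrable pdisk (EFin \o (fun p => b * normc (f (toC p)))).
  exact: (integrableZl mpd b (bergman_integrable fB)).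
have le p : pdisk p -> normc (f (toC p) * k (toC p)) <= b * normc (f (toC p)).
  by move=> pD; rewrite normcM mulrC ler_wpM2r ?normc_ge0// kb.
have ci : cintegrable nu (fun w => f w * k w).
  exact: cintegrable_dom (cmeasurableM (bergman_cmeasurable fB) mk) iG le.
split=> //; rewrite -(RintegralZl b mpd (bergman_integrable fB)).
exact: normc_cintegral_le.
Qed.

Definition moment f n := cintegral nu (fun w => f w * Num.conj w ^+ n).
(** The Taylor coefficients of the Toeplitz transform of [f], read off from the expansion of (1 -
    u)^-2 as the sum of (n + 1) u^n. *)
Definition toeplitz_coef f n := n.+1%:R * moment f n.

Lemma moment_integrable f n : bergman f -> cintegrable nu (fun w => f w * Num.conj w ^+ n).
Proof.
move=> fB; have [] := @bergman_mul_cintegral f (fun w => Num.conj w ^+ n) 1 fB => //.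
  exact: cmeasurable_conj_pow.
by move=> w wD; rewrite normcX normc_conj exprn_ile1 ?normc_ge0// ltW.
Qed.

Lemma kernel_bound z w : disk z -> disk w ->
  normc ((1 - z * Num.conj w) ^+ 2)^-1 <= (1 - normc z) ^- 2.
Proof.
move=> zD wD; have z1 : 0 < 1 - normc z by rewrite subr_gt0; exact: zD.
have h := kernel_denominator zD wD.
rewrite normcV normcX lef_pV2 ?posrE ?exprn_gt0//; last exact: lt_le_trans h.
by apply: lerXn2r; rewrite ?nnegrE ?normc_ge0// ltW.
Qed.

Lemma toeplitz_integrand_integrable f z : bergman f -> disk z ->
  cintegrable nu (toeplitz_integrand f z).
Proof.
move=> fB zD.
have [] := @bergman_mul_cintegral f (fun w => ((1 - z * Num.conj w) ^+ 2)^-1)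
  ((1 - normc z) ^- 2) fB => //.
  exact: cmeasurable_kernel.
by move=> w wD; exact: kernel_bound.
Qed.

Lemma kernel_partial_sum (u : R[i]) K :
  (1 - u) ^+ 2 * \sum_(n < K) n.+1%:R * u ^+ n =
  1 - K.+1%:R * u ^+ K + K%:R * u ^+ K.+1.
Proof.
elim: K => [|K IH]; first by rewrite big_ord0 mulr0 expr0 mul0r addr0 mulr1 subrr.
by rewrite big_ord_recr /= mulrDr IH !exprS -!natr1; ring.
Qed.

Lemma kernel_tail z w K : disk z -> disk w ->
  normc (\sum_(n < K) n.+1%:R * (z * Num.conj w) ^+ n - ((1 - z * Num.conj w) ^+ 2)^-1)
  <= (1 - normc z) ^- 2 * (2 * (K.+1%:R * normc z ^+ K)).
Proof.
move=> zD wD; set u := z * Num.conj w.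
have z1 : 0 < 1 - normc z by rewrite subr_gt0; exact: zD.
have u0 : (1 - u) ^+ 2 != 0.
  rewrite expf_eq0 /= -normc_eq0 gt_eqF//; apply: lt_le_trans z1 _.
  exact: kernel_denominator.
have -> : \sum_(n < K) n.+1%:R * u ^+ n - ((1 - u) ^+ 2)^-1 =
    ((1 - u) ^+ 2)^-1 * (K%:R * u ^+ K.+1 - K.+1%:R * u ^+ K).
  apply: (mulfI u0); rewrite mulrBr kernel_partial_sum mulfV// mulrA mulfV// mul1r.
  by ring.
rewrite normcM; apply: ler_pM; rewrite ?normc_ge0//; first exact: kernel_bound.
have nn (m : nat) : normc (m%:R : R[i]) = m%:R.
  by rewrite -(rmorph_nat (real_complex R)) normc_real ger0_norm.
apply: le_trans (le_normcB _ _) _; rewrite !normcM !nn !normcX.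
have uz : normc u <= normc z.
  rewrite normcM normc_conj ler_piMr ?normc_ge0//; exact/ltW/wD.
have uK : normc u ^+ K <= normc z ^+ K by apply: lerXn2r; rewrite ?nnegrE ?normc_ge0.
have uK1 : normc u ^+ K.+1 <= normc z ^+ K.
  apply: le_trans uK; rewrite exprS ler_piMl ?exprn_ge0 ?normc_ge0//.
  by apply: le_trans uz _; apply: ltW; exact: zD.
have a1 : K%:R * normc u ^+ K.+1 <= K.+1%:R * normc z ^+ K.
  by apply: ler_pM; rewrite ?exprn_ge0 ?normc_ge0// ler_nat.
have a2 : K.+1%:R * normc u ^+ K <= K.+1%:R * normc z ^+ K.
  by apply: ler_wpM2l.
lra.
Qed.

(** The last term of the cubic sum alone is at most [B], so (K + 1) rho^K is at most B / (K + 1). *)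
Lemma kernel_tail_cvg (rho : R) (e : R) : 0 <= rho -> rho < 1 -> 0 < e ->
  exists K0, forall K, (K0 <= K)%N -> K.+1%:R * rho ^+ K < e.
Proof.
move=> r0 r1 e0; have [B hB] := cubic_geometric_bounded r0 r1.
exists (Num.truncn (B / e)) => K hK.
have BK : B < e * K.+1%:R.
  rewrite -ltr_pdivrMl// mulrC; apply: lt_le_trans (truncnS_gt _) _.
  by rewrite ler_nat ltnS.
have K1 : (1 : R) <= K.+1%:R by rewrite ler1n.
have h : K.+1%:R ^+ 3 * rho ^+ K <= B.
  apply: le_trans (hB K.+1); rewrite big_ord_recr /= lerDr; apply: sumr_ge0 => n _.
  by rewrite mulr_ge0 ?exprn_ge0.
have r2 : 0 <= rho ^+ K by exact: exprn_ge0.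
set m := K.+1%:R in BK K1 h *; set q := rho ^+ K in h r2 *.
have mq : m * (m * q) <= m ^+ 3 * q.
  rewrite mulrA; apply: ler_wpM2r => //; rewrite -expr2 (exprS m 2).
  by rewrite ler_peMl ?exprn_ge0//; lra.
have m0 : 0 < m by lra.
rewrite -(ltr_pM2l m0); lra.
Qed.

(** A partial sum of the series is the integral of [f] against a partial sum [s K] of the kernel,
    and the tail of the kernel is small uniformly in [w]. *)
Lemma toeplitz_ccvg f z : bergman f -> disk z ->
  ccvg (psum (toeplitz_coef f) ^~ z) (toeplitz nu f z).
Proof.
move=> fB zD; rewrite /toeplitz mem_set//.
pose k (w : R[i]) := ((1 - z * Num.conj w) ^+ 2)^-1.
pose s K (w : R[i]) := \sum_(n < K) n.+1%:R * (z * Num.conj w) ^+ n.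
have sE K : cintegrable nu (fun w => f w * s K w) /\
    psum (toeplitz_coef f) K z = cintegral nu (fun w => f w * s K w).
  pose F n w := (n.+1%:R * z ^+ n) * (f w * Num.conj w ^+ n).
  have FE : (fun w => f w * s K w) = fun w => \sum_(n < K) F n w.
    apply/funext => w; rewrite /s mulr_sumr; apply: eq_bigr => n _.
    by rewrite /F exprMn; ring.
  have iF n : cintegrable nu (F n) by apply/cintegrableZ/moment_integrable.
  have [h1 h2] := cintegral_sum K iF; rewrite FE; split=> //.
  rewrite h2 /psum; apply: eq_bigr => n _.
  by rewrite (cintegralZ _ (moment_integrable n fB)) /toeplitz_coef /moment; ring.
have ms K : cmeasurable (s K).
  rewrite /s; elim: K => [|K IH].
    by under eq_fun do rewrite big_ord0; exact: cmeasurable_cst.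
  under eq_fun do rewrite big_ord_recr /=.
  apply: cmeasurableD => //; apply: cmeasurableM; first exact: cmeasurable_cst.
  under eq_fun do rewrite exprMn.
  by apply: cmeasurableM; [exact: cmeasurable_cst|exact: cmeasurable_conj_pow].
pose I := \int[nu]_(p in pdisk) normc (f (toC p)).
have I0 : 0 <= I by apply: Rintegral_ge0 => p _; exact: normc_ge0.
have z1 : 0 < 1 - normc z by rewrite subr_gt0; exact: zD.
move=> e e0; pose c := 4 * (1 - normc z) ^- 2 * (I + 1).
have c0 : 0 < c by rewrite mulr_gt0 ?ltr_wpDl// mulr_gt0// invr_gt0 exprn_gt0.
have [K0 hK] := kernel_tail_cvg (normc_ge0 z) zD (divr_gt0 e0 c0).
exists K0 => K /hK hKe; have [iS ->] := sE K.
have -> : cintegral nu (fun w => f w * s K w) - cintegral nu (toeplitz_integrand f z) =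
    cintegral nu (fun w => f w * (s K w - k w)).
  rewrite -mulN1r -(cintegralZ _ (toeplitz_integrand_integrable fB zD)).
  rewrite -cintegralD//; last exact/cintegrableZ/toeplitz_integrand_integrable.
  by apply: eq_cintegral => w wD; rewrite /toeplitz_integrand /k; ring.
have [|w wD|_ le1] := @bergman_mul_cintegral f (fun w => s K w - k w)
    ((1 - normc z) ^- 2 * (2 * (K.+1%:R * normc z ^+ K))) fB.
- under eq_fun do rewrite -mulN1r.
  apply: cmeasurableD => //; apply: cmeasurableM; first exact: cmeasurable_cst.
  exact: cmeasurable_kernel.
- exact: kernel_tail.
apply: le_lt_trans le1 _; rewrite -/I.
move: hKe; rewrite ltr_pdivlMr// => hKe; apply: le_lt_trans hKe.
rewrite /c; set q := _ * normc z ^+ K; set x := (1 - normc z) ^- 2.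
have q0 : 0 <= q by rewrite mulr_ge0 ?exprn_ge0 ?normc_ge0.
have x0 : 0 <= x by rewrite invr_ge0 exprn_ge0// ltW.
have : 0 <= q * x by rewrite mulr_ge0.
lra.
Qed.

(* Duality: with [g] the K-th partial sum of the Toeplitz transform of [f], the
   left-hand side below is the integral of [f] times the conjugate of [g]. *)
Lemma toeplitz_energy f K : bergman f ->
  \sum_(n < K) normc (toeplitz_coef f n) ^+ 2 / n.+1%:R <=
  4 * (4 / pi * C + 1) * C * fine (sqnorm f).
Proof.
move=> fB; set E := (X in X <= _).
pose t := toeplitz_coef f; pose g := psum t K; pose C' := 4 / pi * C + 1.
have pi0 : (0 : R) < pi := pi_gt0 R.
have C'0 : 0 < C' by rewrite ltr_wpDl// mulr_ge0// divr_ge0// ltW.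
have nn (m : nat) : normc (m%:R : R[i]) = m%:R.
  by rewrite -(rmorph_nat (real_complex R)) normc_real ger0_norm.
have [gB gn] := psum_bergman t K.
have E0 : 0 <= E.
  by apply: sumr_ge0 => n _; rewrite divr_ge0 ?exprn_ge0 ?normc_ge0.
have EE : E%:C = cintegral nu (fun w => f w * Num.conj (disk_restrict g w)).
  pose F n w := Num.conj (t n) * (f w * Num.conj w ^+ n).
  have -> : cintegral nu (fun w => f w * Num.conj (disk_restrict g w)) =
      cintegral nu (fun w => \sum_(n < K) F n w).
    apply: eq_cintegral => w wD; rewrite /disk_restrict mem_set//.
    rewrite /g /psum rmorph_sum mulr_sumr; apply: eq_bigr => n _ /=.
    by rewrite /F rmorphM rmorphXn /=; ring.
  have iF n : cintegrable nu (F n) by apply/cintegrableZ/moment_integrable.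
  have [_ ->] := cintegral_sum K iF.
  rewrite /E rmorph_sum /=; apply: eq_bigr => n _.
  rewrite (cintegralZ _ (moment_integrable n fB)) -/(moment f n).
  have n0 : (n.+1%:R : R[i]) != 0 by rewrite pnatr_eq0.
  rewrite rmorphM /= fmorphV rmorph_nat -mulcJ -/t.
  have -> : moment f n = t n / n.+1%:R by rewrite /t /toeplitz_coef mulrAC divff ?mul1r.
  by ring.
(* Young's inequality with weight [C']. The Carleson inequality for [g] bounds the integral of |g|^2
   by [C' * E], so the second term contributes at most [E / 4]; doubled, this is [E / 2], absorbed
   on the left. Absorption is legitimate since [E] is a finite sum. *)
have le1 : E <= 2 * \int[nu]_(p in pdisk)
    (C' * normc (f (toC p)) ^+ 2 + (4 * C')^-1 * normc (disk_restrict g (toC p)) ^+ 2).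
  have -> : E = normc E%:C by rewrite normc_real ger0_norm.
  have iG : nu.-integrable pdisk (EFin \o (fun p =>
      C' * normc (f (toC p)) ^+ 2 + (4 * C')^-1 * normc (disk_restrict g (toC p)) ^+ 2)).
    rewrite /comp; under eq_fun do rewrite EFinD.
    apply: integrableD => //; first exact: (integrableZl mpd _ (bergman_sq_integrable fB)).
    exact: (integrableZl mpd _ (bergman_sq_integrable gB)).
  have le p : pdisk p -> normc (f (toC p) * Num.conj (disk_restrict g (toC p))) <=
      C' * normc (f (toC p)) ^+ 2 + (4 * C')^-1 * normc (disk_restrict g (toC p)) ^+ 2.
    move=> _; rewrite normcM normc_conj; set a := normc _; set b := normc _.
    have : 0 <= C' * (a - (2 * C')^-1 * b) ^+ 2 by rewrite mulr_ge0 ?sqr_ge0 ?ltW.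
    rewrite (_ : C' * _ = C' * a ^+ 2 + (4 * C')^-1 * b ^+ 2 - a * b); first by rewrite subr_ge0.
    by field; rewrite gt_eqF.
  rewrite EE; apply: normc_cintegral_le => //.
  apply: cintegrable_dom iG le; apply: cmeasurableM; first exact: bergman_cmeasurable.
  by apply: cmeasurable_conj; exact: bergman_cmeasurable.
have Cf : \int[nu]_(p in pdisk) (normc (f (toC p)) ^+ 2) <= C * fine (sqnorm f).
  have h := integrable_fin_num mpd (bergman_sq_integrable fB).
  by rewrite -lee_fin /Rintegral fineK// carleson.
have Cg : \int[nu]_(p in pdisk) (normc (disk_restrict g (toC p)) ^+ 2) <= C' * E.
  have h := integrable_fin_num mpd (bergman_sq_integrable gB).
  rewrite -lee_fin /Rintegral fineK//; apply: le_trans (carleson gB) _.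
  rewrite lee_fin; apply: le_trans (ler_wpM2l C0 gn) _.
  rewrite -/E mulrA; apply: ler_wpM2r => //; rewrite /C'; lra.
move: le1; rewrite RintegralD//; last 2 first.
- exact: (integrableZl mpd _ (bergman_sq_integrable fB)).
- exact: (integrableZl mpd _ (bergman_sq_integrable gB)).
rewrite !RintegralZl//; [|exact: bergman_sq_integrable..].
move=> le1; have a1 := ler_wpM2l (ltW C'0) Cf.
have i0 : 0 <= (4 * C')^-1 by rewrite invr_ge0 mulr_ge0// ltW.
have a2 := ler_wpM2l i0 Cg.
have e2 : (4 * C')^-1 * (C' * E) = E / 4 by field; rewrite gt_eqF.
rewrite e2 in a2; rewrite -/C'; lra.
Qed.

Lemma toeplitz_bergman f : bergman f -> bergman (toeplitz nu f) /\
  fine (sqnorm (toeplitz nu f)) <=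
    4 / pi * (4 * (4 / pi * C + 1) * C) * fine (sqnorm f).
Proof.
move=> fB; rewrite -mulrA.
apply: (psum_limit_bergman (fun K => toeplitz_energy K fB)).
  by move=> z zD; exact: toeplitz_ccvg.
by move=> z zD; rewrite /toeplitz memNset.
Qed.

Theorem carleson_bounded_toeplitz : bounded_toeplitz nu.
Proof.
split; first by move=> f z; exact: toeplitz_integrand_integrable.
split; first by move=> f /toeplitz_bergman[].
  move=> a f g fB gB; apply/funext => z; rewrite /toeplitz.
  case: ifPn => [|_]; last by rewrite mulr0 addr0.
  rewrite inE => zD.
  have iF := toeplitz_integrand_integrable fB zD.
  have iG := toeplitz_integrand_integrable gB zD.
  rewrite -(cintegralZ a iF) -(cintegralD (cintegrableZ a iF) iG).
  by apply: eq_cintegral => w _; rewrite /toeplitz_integrand; ring.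
exists (Num.sqrt (4 / pi * (4 * (4 / pi * C + 1) * C))) => f fB.
have [_ h] := toeplitz_bergman fB.
have c0 : 0 <= 4 / pi * (4 * (4 / pi * C + 1) * C).
  have q0 : (0 : R) <= 4 / pi by rewrite divr_ge0 ?pi_ge0.
  apply: mulr_ge0 => //; apply: mulr_ge0 => //; apply: mulr_ge0 => //.
  by apply: addr_ge0 => //; exact: mulr_ge0.
by rewrite /bergman_norm -sqrtrM// ler_wsqrtr.
Qed.

End toeplitz_series.

(** * The lattice measure *)

Section lattice.
Context {R : realType} (N : nat) (om : nat -> R[i]).
Hypothesis N34 : (33 < N)%N.

(** The exponent starts at 1: a level of size 1 would have radius 0 and put a zero of the lacunary
    product at the origin. *)
Definition level_size k := (N ^ k.+1)%N.
Local Notation lev := level_size.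
Hypothesis omP : forall k, (lev k).-primitive_root (om k).
Local Notation mu := (@lebesgue_measure R).
Local Notation mu2 := (mu \x mu)%E.

Definition level_radius k : R := 1 - (lev k)%:R^-1.
Local Notation radius := level_radius.
Definition lattice_point k j : R[i] := (radius k)%:C * om k ^+ j.
Local Notation latt := lattice_point.
Definition lattice_cell k j : set (plane R) :=
  square (complex.Re (latt k j)) (complex.Im (latt k j)) (8 * (lev k)%:R)^-1.

Lemma level_size_ge k : (N <= lev k)%N.
Proof. by rewrite /level_size expnS leq_pmulr// expn_gt0; case: (N) N34. Qed.

Lemma level_size_ge34 k : (34 : R) <= (lev k)%:R.
Proof. by rewrite ler_nat; apply: leq_trans (level_size_ge k). Qed.

Lemma level_sizeS k : lev k.+1 = (N * lev k)%N.
Proof. by rewrite /level_size expnS. Qed.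

Lemma level_size_inv k : 0 < ((lev k)%:R^-1 : R) /\ ((lev k)%:R^-1 : R) <= 34^-1.
Proof.
have h := level_size_ge34 k; split; first by rewrite invr_gt0; lra.
by rewrite lef_pV2// posrE; lra.
Qed.

Lemma radius_ge0 k : 0 <= radius k.
Proof. rewrite /level_radius; have [] := level_size_inv k; lra. Qed.

Lemma normc_lattice_point k j : normc (latt k j) = radius k.
Proof.
by rewrite normcM normcX (normc_prim_root (omP k)) expr1n mulr1 normc_real
  ger0_norm// radius_ge0.
Qed.

Lemma lattice_point_disk k j : disk (latt k j).
Proof. by rewrite /disk /= normc_lattice_point /level_radius; have [] := level_size_inv k; lra. Qed.

(** Distinct M-th roots of unity are at distance at least 2 / (M - 1) by [unity_root_dist], and the
    radius (M - 1) / M turns this into 2 / M. *)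
Lemma lattice_point_sep k (j i : nat) : (j < lev k)%N -> (i < lev k)%N -> j != i ->
  2 * (lev k)%:R^-1 <= normc (latt k j - latt k i).
Proof.
move=> jM iM ji; have wP := omP k; have w1 := normc_prim_root wP.
have w0 : om k != 0 by rewrite -normc_eq0 w1 oner_eq0.
pose z := om k ^+ j / om k ^+ i.
have zM : z ^+ lev k = 1.
  rewrite expr_div_n -!exprM ![(_ * lev k)%N]mulnC !exprM (prim_expr_order wP).
  by rewrite !expr1n divr1.
have z1 : z != 1.
  apply: contra ji => /eqP h; have : om k ^+ j = om k ^+ i.
    by rewrite -[RHS]mul1r -h mulfVK ?expf_neq0.
  by move/eqP; rewrite (eq_prim_root_expr wP) !modn_small.
have h := unity_root_dist wP zM z1.
have -> : latt k j - latt k i = - ((radius k)%:C * om k ^+ i * (1 - z)).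
  by rewrite mulrBr mulr1 -mulrA [om k ^+ i * z]mulrC mulfVK ?expf_neq0// /lattice_point opprB.
rewrite normcN !normcM normcX w1 expr1n mulr1 normc_real ger0_norm ?radius_ge0//.
have M0 := level_size_ge34 k.
have Mp : (lev k).-1%:R = (lev k)%:R - 1 :> R.
  have : (0 < lev k)%N by apply: leq_trans (level_size_ge k); apply: leq_trans N34.
  by case: (lev k) => // m _; rewrite -natr1 addrK.
rewrite Mp in h; rewrite /level_radius; set m := (lev k)%:R in M0 h *.
have mi : 0 < m^-1 by rewrite invr_gt0; lra.
have -> : 1 - m^-1 = m^-1 * (m - 1) by rewrite mulrBr mulVf ?mulr1// gt_eqF//; lra.
by rewrite mulrC -mulrA; apply: ler_wpM2l => //; exact: ltW.
Qed.

Lemma lattice_cell_near k j p : lattice_cell k j p -> normc (toC p - latt k j) <= (4 * (lev k)%:R)^-1.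
Proof.
move=> /squareP[h1 h2]; have M0 := level_size_ge34 k.
have -> : (4 * (lev k)%:R : R)^-1 = (8 * (lev k)%:R)^-1 + (8 * (lev k)%:R)^-1.
  by field; rewrite gt_eqF//; lra.
apply: le_trans (normc_le_ReIm _) _.
rewrite !(ReD, ImD, ReN, ImN); exact: lerD.
Qed.

Lemma lattice_cell_normc k j p : lattice_cell k j p ->
  1 - 5 / 4 * (lev k)%:R^-1 <= normc (toC p) <= 1 - 3 / 4 * (lev k)%:R^-1.
Proof.
move=> /lattice_cell_near; rewrite invfM => h; have := normc_near (toC p) (latt k j).
rewrite normc_lattice_point /level_radius ler_norml => /andP[h1 h2].
by apply/andP; split; lra.
Qed.

Lemma lattice_cell_disk k j : lattice_cell k j `<=` pdisk.
Proof.
move=> p /lattice_cell_normc /andP[_ h]; rewrite -[pdisk p]/(is_true (normc (toC p) < 1)).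
have [] := level_size_inv k; lra.
Qed.

(** Cells of level k stay within 1 - (3/4) / M_k of the origin, those of level l beyond 1 - (5/4) /
    M_l, and M_l is at least 34 M_k. *)
Lemma lattice_cell_level_disjoint k l j i p : (k < l)%N -> lattice_cell k j p -> lattice_cell l i p -> False.
Proof.
move=> kl /lattice_cell_normc/andP[_ h1] /lattice_cell_normc/andP[h2 _].
have : ((lev l)%:R^-1 : R) <= 34^-1 * (lev k)%:R^-1.
  have a := level_size_ge34 k; rewrite -invfM lef_pV2 ?posrE; [|have := level_size_ge34 l; lra|lra].
  rewrite -natrM ler_nat; apply: (@leq_trans (lev k.+1)).
    by rewrite level_sizeS leq_mul2r N34 orbT.
  by rewrite /level_size leq_exp2l ?ltnS//; apply: leq_trans N34.
have [] := level_size_inv k; lra.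
Qed.

Lemma lattice_cell_inj k l (j i : nat) p : (j < lev k)%N -> (i < lev l)%N ->
  lattice_cell k j p -> lattice_cell l i p -> k = l /\ j = i.
Proof.
move=> jM iM pj pi; case: (ltngtP k l) => [kl|lk|kl].
- by case: (lattice_cell_level_disjoint kl pj pi).
- by case: (lattice_cell_level_disjoint lk pi pj).
split=> //; subst l; apply/eqP/negPn/negP => ji.
have := lattice_point_sep jM iM ji; have := lattice_cell_near pj; have := lattice_cell_near pi.
have := le_normcB (toC p - latt k i) (toC p - latt k j).
rewrite (_ : _ - _ - _ = latt k j - latt k i); last by ring.
rewrite invfM; have [] := level_size_inv k; lra.
Qed.

(** The constant 256 is 64 times 4: the mass is 64 times the square of the half-side 1 / (8 M_k),
    and 4 comes from [area_mean_value]. The factor pi undoes the normalization of [dA]. *)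
Lemma lattice_carleson (f : R[i] -> R[i]) : bergman f ->
  (\sum_(0 <= k <oo) \sum_(j < lev k)
     (((lev k)%:R ^- 2 * normc (f (latt k j)) ^+ 2)%:E) <=
   (256 * pi * fine (sqnorm f))%:E)%E.
Proof.
move=> fB; have [hf _ _] := fB; have mpd := @measurable_pdisk R.
have mf := holomorphic_measurable hf.
pose F (p : plane R) := (normc (f (toC p)) ^+ 2)%:E.
have mF : measurable_fun pdisk F by exact/measurable_EFinP/measurable_funX.
have F0 p : (0 <= F p)%E by rewrite lee_fin exprn_ge0// normc_ge0.
have mc k j : measurable (lattice_cell k j) by exact: measurable_square.
pose U k := \big[setU/set0]_(j <- index_enum 'I_(lev k)) lattice_cell k j.
have UP k p : U k p -> exists j : 'I_(lev k), lattice_cell k j p.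
  by rewrite /U -bigcup_seq => -[j _ pj]; exists j.
have Ud k : U k `<=` pdisk by move=> p /UP[j]; exact: lattice_cell_disk.
have mU k : measurable (U k) by apply: bigsetU_measurable.
have intU k : (\int[mu2]_(p in U k) F p = \sum_(j < lev k) \int[mu2]_(p in lattice_cell k j) F p)%E.
  apply: ge0_integral_bigsetU => //; first exact: index_enum_uniq.
  - move=> j i _ _ [p [pj pi]].
    by have [_ h] := lattice_cell_inj (ltn_ord j) (ltn_ord i) pj pi; apply: val_inj.
  - exact: (measurable_funS mpd (@Ud k) mF).
have tU : trivIset setT U.
  move=> k l _ _ [p [/UP[j pj] /UP[i pi]]].
  by have [] := lattice_cell_inj (ltn_ord j) (ltn_ord i) pj pi.
have UD : \bigcup_k U k `<=` pdisk by apply: bigcup_sub => k _; exact: Ud.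
have cellbound k (j : 'I_(lev k)) : (((lev k)%:R ^- 2 * normc (f (latt k j)) ^+ 2)%:E <=
    256%:E * \int[mu2]_(p in lattice_cell k j) F p)%E.
  have M0 := level_size_ge34 k.
  have r0 : 0 < (8 * (lev k)%:R : R)^-1 by rewrite invr_gt0; lra.
  have := @area_mean_value R f (complex.Re (latt k j)) (complex.Im (latt k j)) _ r0 _
    (measurable_funS mpd (@lattice_cell_disk k j) mf).
  rewrite (_ : _ +i* _ = latt k j); last by case: (latt k j).
  move=> /(_ _)/le_trans h.
  rewrite (_ : 256%:E = 64%:E * 4%:E)%E; last by rewrite -EFinM; congr EFin; ring.
  rewrite -muleA; apply: (@le_trans _ _ (64%:E * (((8 * (lev k)%:R)^-1 ^+ 2 * normc (f (latt k j)) ^+ 2))%:E)%E).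
    rewrite -EFinM lee_fin le_eqVlt; apply/orP; left; apply/eqP.
    by field; rewrite gt_eqF//; lra.
  apply: lee_wpmul2l => //; apply: h => // z zx zy.
  have zD : pdisk ((complex.Re z, complex.Im z) : plane R).
    by apply: (@lattice_cell_disk k j); apply/squareP.
  have zE : toC ((complex.Re z, complex.Im z) : plane R) = z by case: (z).
  by apply: derivable_has_cderiv; apply: hf; rewrite -zE.
have le1 : (\sum_(0 <= k <oo) \sum_(j < lev k)
     (((lev k)%:R ^- 2 * normc (f (latt k j)) ^+ 2)%:E) <=
    \sum_(0 <= k <oo) (256%:E * \int[mu2]_(p in U k) F p))%E.
  apply: lee_nneseries => [k _ _|k _].
    by apply: sume_ge0 => j _; rewrite lee_fin mulr_ge0 ?exprn_ge0 ?normc_ge0// invr_ge0 exprn_ge0.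
  rewrite intU ge0_sume_distrr; last by move=> j _; exact: integral_ge0.
  by apply: lee_sum => j _; exact: cellbound.
apply: le_trans le1 _.
rewrite nneseriesZl; last by move=> k _; exact: integral_ge0.
rewrite -(ge0_integral_bigcup _ mU (measurable_funS mpd UD mF) (fun p _ => F0 p) tU).
apply: (@le_trans _ _ (256%:E * \int[mu2]_(p in pdisk) F p)%E).
  by apply: lee_wpmul2l => //; apply: ge0_subset_integral => //; exact: bigcupT_measurable.
rewrite EFinM bergman_fine// sqnormE// [(256 * pi)%:E]EFinM -muleA; apply: lee_wpmul2l => //.
have pi0 : (pi : R) != 0 by rewrite gt_eqF// pi_gt0.
by rewrite muleA -EFinM mulfV// mul1e.
Qed.

End lattice.

Section lattice_measure.
Context {R : realType} (N : nat) (om : nat -> R[i]).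
Hypothesis N34 : (33 < N)%N.
Hypothesis omP : forall k, (level_size N k).-primitive_root (om k).
Local Notation lev := (level_size N).
Local Notation latt := (lattice_point N om).

Definition toP (z : R[i]) : plane R := (complex.Re z, complex.Im z).

Lemma toPK z : toC (toP z) = z.
Proof. by case: z. Qed.

Lemma lattice_point_pdisk k j : pdisk (toP (latt k j)).
Proof. by rewrite /pdisk /= toPK; exact: lattice_point_disk. Qed.

Lemma weight_ge0 k : (0 : R) <= (lev k)%:R ^- 2.
Proof. by rewrite invr_ge0 exprn_ge0. Qed.

Definition atom k j : {measure set (plane R) -> \bar R} :=
  mscale (NngNum (weight_ge0 k)) (dirac (toP (latt k j))).

Definition level_measure k : {measure set (plane R) -> \bar R} := msum (atom k) (lev k).

Definition lattice_measure0 : set (plane R) -> \bar R := mseries level_measure 0.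

HB.instance Definition _ := Measure.on lattice_measure0.

Lemma integral_lattice (F : plane R -> \bar R) : measurable_fun pdisk F ->
  (forall p, pdisk p -> (0 <= F p)%E) ->
  (\int[lattice_measure0]_(p in pdisk) F p =
   \sum_(0 <= k <oo) \sum_(j < lev k) ((lev k)%:R ^- 2)%:E * F (toP (latt k j)))%E.
Proof.
move=> mF F0; have mpd := @measurable_pdisk R.
rewrite ge0_integral_measure_series//; apply: eq_eseriesr => k _.
rewrite ge0_integral_measure_sum//; apply: eq_bigr => j _.
rewrite ge0_integral_mscale// integral_dirac// diracE mem_set ?mul1e//.
exact: lattice_point_pdisk.
Qed.

Lemma lattice_measureE (U : set (plane R)) :
  (lattice_measure0 U =
   \sum_(0 <= k <oo) \sum_(j < lev k) ((lev k)%:R ^- 2)%:E * \d_(toP (latt k j)) U)%E.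
Proof. by []. Qed.

(** The total mass is the left-hand side of [lattice_carleson] for the constant function 1, here a
    power series cut after one term. *)
Lemma lattice_measure_finite : fin_num_fun lattice_measure0.
Proof.
move=> U mU; rewrite ge0_fin_numE ?measure_ge0// lattice_measureE.
have [fB _] := psum_bergman (fun=> 1 : R[i]) 1.
have h := lattice_carleson N34 omP fB; apply: le_lt_trans (ltry _).
apply: le_trans h; apply: lee_nneseries => [k _ _|k _].
  by apply: sume_ge0 => j _; rewrite mule_ge0// lee_fin weight_ge0.
apply: lee_sum => j _; rewrite /disk_restrict mem_set; last exact: lattice_point_disk.
have -> : psum (fun=> 1) 1 (latt k j) = 1.
  by rewrite /psum big_ord1 mul1r; exact: expr0.
rewrite normc1 expr1n mulr1.
rewrite diracE -[leRHS]mule1; apply: lee_wpmul2l; first by rewrite lee_fin weight_ge0.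
by rewrite lee_fin; case: (_ \in _).
Qed.

HB.instance Definition _ := Measure_isFinite.Build _ _ _ lattice_measure0 lattice_measure_finite.

Definition lattice_measure : {finite_measure set (plane R) -> \bar R} := lattice_measure0.

Lemma lattice_measure_pdiskC : lattice_measure (~` pdisk) = 0%E.
Proof.
rewrite [LHS]lattice_measureE eseries0// => k _ _; apply: big1 => j _.
by rewrite diracE memNset ?mule0//= => /(_ (lattice_point_pdisk k j)).
Qed.

Lemma lattice_measure_carleson (f : R[i] -> R[i]) : bergman f ->
  (\int[lattice_measure]_(p in pdisk) (normc (f (toC p)) ^+ 2)%:E <=
   (256 * pi * fine (sqnorm f))%:E)%E.
Proof.
move=> fB; rewrite [leLHS]integral_lattice; last 2 first.
- by apply/measurable_EFinP/measurable_funX; exact: bergman_measurable.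
- by move=> p _; rewrite lee_fin exprn_ge0// normc_ge0.
apply: le_trans (lattice_carleson N34 omP fB).
rewrite le_eqVlt; apply/orP; left; apply/eqP.
by apply: eq_eseriesr => k _; apply: eq_bigr => j _; rewrite toPK -EFinM.
Qed.

End lattice_measure.

(** * A function vanishing on the lattice *)

Section lacunary_product.
Context {R : realType} (N : nat) (om : nat -> R[i]).
Hypothesis N34 : (33 < N)%N.
Hypothesis omP : forall k, (level_size N k).-primitive_root (om k).
Local Notation lev := (level_size N).
Local Notation radius := (level_radius (R := R) N).
Local Notation latt := (lattice_point N om).

Lemma bernoulli_inequality (x : R) n : 0 <= x -> x <= 1 -> 1 - n%:R * x <= (1 - x) ^+ n.
Proof.
move=> x0 x1; elim: n => [|n IH]; first by rewrite expr0 mul0r subr0.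
rewrite exprS -natr1; have y0 : 0 <= 1 - x by lra.
have := ler_wpM2l y0 IH; have : (0 : R) <= n%:R by [].
nra.
Qed.

(** Over the full exponent, Bernoulli's inequality yields only 0. Over half of it, rounded up, it
    yields 33 / 68, whose square exceeds 1 / 5. *)
Lemma radius_pow_ge k : 5^-1 <= radius k ^+ lev k.
Proof.
have [i0 i1] := level_size_inv (R := R) N34 k; have r0 := radius_ge0 (R := R) N34 k.
have M34 := level_size_ge34 (R := R) N34 k.
have r1 : radius k <= 1 by rewrite /level_radius; lra.
apply: (@le_trans _ _ (radius k ^+ ((uphalf (lev k)) * 2))); last first.
  by apply: ler_wiXn2l => //; rewrite muln2 uphalfE -{1}(odd_double_half (lev k).+1) -addnn; lia.
have h := @bernoulli_inequality (lev k)%:R^-1 (uphalf (lev k)) (ltW i0) _.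
have b : (2 * uphalf (lev k))%:R <= (lev k)%:R + 1 :> R.
  by rewrite natr1 ler_nat uphalfE; lia.
have c : 33 / 68 <= radius k ^+ uphalf (lev k).
  apply: le_trans (h _); last by lra.
  rewrite natrM in b; have := ler_wpM2r (ltW i0) b.
  have -> : ((lev k)%:R + 1) * (lev k)%:R^-1 = 1 + (lev k)%:R^-1 :> R.
    by field; rewrite gt_eqF//; lra.
  lra.
rewrite exprM expr2; nra.
Qed.

Lemma radius_pow_le k : radius k ^+ lev k <= 1 / 2.
Proof.
have [i0 i1] := level_size_inv (R := R) N34 k; have r0 := radius_ge0 (R := R) N34 k.
have M34 := level_size_ge34 (R := R) N34 k.
have r1 : 0 < radius k by rewrite /level_radius; lra.
pose x := radius k ^+ lev k; have x0 : 0 < x by exact: exprn_gt0.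
(* The inverse of the radius is [1 + 1 / (M - 1)]; two terms of the binomial
   expansion suffice. *)
have bern n : 1 + n%:R * (lev k)%:R^-1 <= (radius k)^-1 ^+ n.
  elim: n => [|n IH]; first by rewrite mul0r addr0 expr0.
  rewrite exprS -natr1; have y1 : 1 + (lev k)%:R^-1 <= (radius k)^-1.
    by rewrite -[leRHS]div1r ler_pdivlMr// /level_radius; nra.
  have n0 : 0 <= n%:R * (lev k)%:R^-1 :> R by rewrite mulr_ge0// ltW.
  have y0 : 0 <= (radius k)^-1 by rewrite invr_ge0.
  apply: le_trans (ler_wpM2l y0 IH); nra.
have := bern (lev k); rewrite divff; last by rewrite gt_eqF//; lra.
rewrite exprVn -[_^-1]div1r ler_pdivlMr//; lra.
Qed.

Definition lac_coef k : R[i] := (radius k ^+ lev k)^-1%:C.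
Definition lac_factor k : {poly R[i]} := 1 - (lac_coef k)%:P * 'X^(lev k).
Definition lac_poly K : {poly R[i]} := \prod_(k < K) lac_factor k.

Lemma lac_coef_norm k : normc (lac_coef k) ^+ 2 <= 25.
Proof.
have h := radius_pow_ge k; have x0 : 0 < radius k ^+ lev k by lra.
rewrite normc_real ger0_norm ?invr_ge0 ?(ltW x0)//.
have i5 : (radius k ^+ lev k)^-1 <= 5.
  by rewrite -[leRHS]invrK lef_pV2 ?posrE ?invr_gt0.
have i0 : 0 <= (radius k ^+ lev k)^-1 by rewrite invr_ge0 ltW.
nra.
Qed.

Lemma lac_polyS K : lac_poly K.+1 = lac_poly K - lac_coef K *: (lac_poly K * 'X^(lev K)).
Proof.
rewrite /lac_poly big_ord_recr /= /lac_factor mulrBr mulr1; congr (_ - _).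
by rewrite mulrCA mul_polyC.
Qed.

Lemma size_lac_poly K : (size (lac_poly K) <= lev K)%N.
Proof.
elim: K => [|K IH].
  rewrite /lac_poly big_ord0 size_poly1 /level_size expn1; exact: leq_trans N34.
rewrite lac_polyS (leq_trans (size_polyD _ _))// geq_max size_polyN.
rewrite (level_sizeS N K) (leq_trans IH) ?leq_pmull ?(leq_trans _ N34)//=.
rewrite (leq_trans (size_scale_leq _ _))// (leq_trans (size_mul_leq _ _))//.
rewrite size_polyXn addnS /= (@leq_trans (2 * lev K))//; first by rewrite mul2n -addnn leq_add2r.
by rewrite leq_mul2r (leq_trans _ N34) ?orbT.
Qed.

Lemma coef_lac_polyS K n : (lac_poly K.+1)`_n =
  (lac_poly K)`_n - lac_coef K * (if (n < lev K)%N then 0 else (lac_poly K)`_(n - lev K)).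
Proof. by rewrite lac_polyS coefB coefZ coefMXn. Qed.

(** By [size_lac_poly], the shifted copy added by factor [K] starts where the coefficients of
    [lac_poly K] end, so no cross term appears. *)
Lemma normc_coef_lac_polyS K n : normc (lac_poly K.+1)`_n ^+ 2 <=
  normc (lac_poly K)`_n ^+ 2 +
  25 * (if (n < lev K)%N then 0 else normc (lac_poly K)`_(n - lev K) ^+ 2).
Proof.
rewrite coef_lac_polyS; case: ltnP => nK; first by rewrite !mulr0 subr0 addr0.
rewrite (nth_default _ (leq_trans (size_lac_poly K) nK)) sub0r normcN normcM.
rewrite normc0 expr0n /= add0r exprMn; apply: ler_wpM2r (lac_coef_norm K).
by rewrite exprn_ge0// normc_ge0.
Qed.

Lemma shifted_sum (L M : nat) (F : nat -> R) :
  \sum_(n < L) (if (n < M)%N then 0 else F (n - M)%N) = \sum_(n < L - M) F n.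
Proof.
have [LM|ML] := leqP L M.
  rewrite (eqP (_ : L - M == 0)%N) ?subn_eq0// big_ord0; apply: big1 => n _.
  by rewrite ifT// (leq_trans (ltn_ord n)).
rewrite -!(big_mkord xpredT (fun n => if (n < M)%N then 0 else F (n - M)%N)).
rewrite (big_cat_nat _ (ltnW ML))//= big_nat big1 ?add0r => [|n /andP[_ ->]//].
rewrite -{1}[M]add0n big_addn big_mkord; apply: eq_bigr => n _.
by rewrite addnK ltnNge leq_addl.
Qed.

Lemma lac_poly_l2 K L : \sum_(n < L) normc (lac_poly K)`_n ^+ 2 <= 26 ^+ K.
Proof.
elim: K L => [|K IH] L.
  rewrite /lac_poly big_ord0; case: L => [|L]; first by rewrite big_ord0.
  rewrite big_ord_recl coef1 normc1 expr1n big1 ?addr0// => n _.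
  by rewrite coef1 normc0 expr0n.
apply: le_trans (ler_sum _ (fun (n : 'I_L) _ => normc_coef_lac_polyS K n)) _.
rewrite big_split /= -mulr_sumr.
rewrite (shifted_sum L (lev K) (fun n => normc (lac_poly K)`_n ^+ 2)).
by have := IH L; have := IH (L - lev K)%N; rewrite exprS; lra.
Qed.

(** Factor [K] adds at most 25 / M_K times 26^K, that is 25 / 34 times (26 / 34)^K. The bound is
    shaped for induction: it grows by 4 (1 - 26 / 34) (26 / 34)^K, which is 32 / 34 times the same
    power. *)
Lemma lac_poly_bergman K L :
  \sum_(n < L) normc (lac_poly K)`_n ^+ 2 / n.+1%:R <= 5 - 4 * (26 / 34) ^+ K.
Proof.
elim: K L => [|K IH] L.
  rewrite /lac_poly big_ord0; case: L => [|L]; first by rewrite big_ord0 expr0; lra.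
  rewrite big_ord_recl coef1 normc1 expr1n big1 ?addr0 => [|n _].
    by rewrite divr1 expr0; lra.
  by rewrite coef1 normc0 expr0n mul0r.
have M34 := level_size_ge34 (R := R) N34 K.
have le1 (n : 'I_L) : normc (lac_poly K.+1)`_n ^+ 2 / n.+1%:R <=
    normc (lac_poly K)`_n ^+ 2 / n.+1%:R + 25 / (lev K)%:R *
    (if (n < lev K)%N then 0 else normc (lac_poly K)`_(n - lev K) ^+ 2).
  have n0 : (0 : R) <= n.+1%:R^-1 by rewrite invr_ge0.
  apply: le_trans (ler_wpM2r n0 (normc_coef_lac_polyS K n)) _.
  rewrite mulrDl lerD2l; case: ltnP => nK; first by rewrite !mulr0 mul0r.
  rewrite -[leLHS]mulrA -[leRHS]mulrA ler_pM2l// [leRHS]mulrC; apply: ler_wpM2l; first by rewrite exprn_ge0// normc_ge0.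
  have n1 : (0 : R) < n.+1%:R by rewrite ltr0n.
  by rewrite lef_pV2 ?posrE//; [rewrite ler_nat leqW|lra].
apply: le_trans (ler_sum _ (fun n _ => le1 n)) _; rewrite big_split /= -mulr_sumr.
rewrite (shifted_sum L (lev K) (fun n => normc (lac_poly K)`_n ^+ 2)).
have a1 := IH L.
have a2 : 25 / (lev K)%:R * \sum_(n < L - lev K) normc (lac_poly K)`_n ^+ 2 <=
    25 / 34 * (26 / 34) ^+ K.
  have iM : 25 / (lev K)%:R <= 25 * 34^-1 * (34^-1) ^+ K :> R.
    rewrite -mulrA ler_pM2l// -exprS exprVn lef_pV2 ?posrE ?exprn_gt0//; last by lra.
    by rewrite -natrX ler_nat /level_size leq_exp2r.
  apply: le_trans (ler_pM _ _ iM (lac_poly_l2 K _)) _.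
  - by rewrite divr_ge0.
  - by apply: sumr_ge0 => n _; rewrite exprn_ge0// normc_ge0.
  by rewrite exprMn le_eqVlt; apply/orP; left; apply/eqP; ring.
have q0 : 0 <= (26 / 34 : R) ^+ K by rewrite exprn_ge0.
rewrite exprS; lra.
Qed.

Lemma lac_poly_stable K L n : (K <= L)%N -> (n < lev K)%N ->
  (lac_poly L)`_n = (lac_poly K)`_n.
Proof.
move=> KL nK; rewrite -(subnKC KL); elim: (L - K)%N => [|d IH]; first by rewrite addn0.
rewrite addnS coef_lac_polyS IH ifT ?mulr0 ?subr0//; apply: leq_trans nK _.
by rewrite /level_size leq_exp2l ?(leq_trans _ N34)// ltnS leq_addr.
Qed.

(** The coefficients of the infinite product, taken diagonally: as [n < lev n], the factors of index
    at least [n] leave the n-th coefficient unchanged. *)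
Definition lac_seq n := (lac_poly n)`_n.

Lemma ltn_level_size n : (n < lev n)%N.
Proof.
apply: (@leq_trans (lev n)) => //; rewrite /level_size.
by apply: leq_trans (ltnW (ltn_expl n.+1 (leq_trans _ N34))).
Qed.

Lemma lac_seqE K n : (n < lev K)%N -> lac_seq n = (lac_poly K)`_n.
Proof.
move=> nK; rewrite /lac_seq; case: (leqP K n) => h; first exact: lac_poly_stable.
by apply/esym/lac_poly_stable; [exact: ltnW|exact: ltn_level_size].
Qed.

Lemma lac_seq_bergman L : \sum_(n < L) normc (lac_seq n) ^+ 2 / n.+1%:R <= 5.
Proof.
apply: (@le_trans _ _ (\sum_(n < L) normc (lac_poly L)`_n ^+ 2 / n.+1%:R)).
  apply: ler_sum => n _; rewrite (@lac_seqE L)//.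
  by apply: ltn_trans (ltn_level_size L).
apply: le_trans (lac_poly_bergman L L) _.
by rewrite lerBlDr lerDl mulr_ge0// exprn_ge0.
Qed.

(** Along these lengths the partial sums are the finite products themselves, and this is how their
    zeros pass to the limit function. *)
Lemma psum_lac_seq K z : psum lac_seq (lev K) z = (lac_poly K).[z].
Proof.
rewrite (horner_coef_wide z (size_lac_poly K)); apply: eq_bigr => n _.
by rewrite (@lac_seqE K).
Qed.

Lemma lac_poly_root K k j : (k < K)%N -> (lac_poly K).[latt k j] = 0.
Proof.
move=> kK; rewrite /lac_poly horner_prod (bigD1 (Ordinal kK))//=.
rewrite /lac_factor !hornerE /lattice_point exprMn -rmorphXn /=.
rewrite -exprM mulnC exprM (prim_expr_order (omP k)) expr1n mulr1.
have h := radius_pow_ge k.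
rewrite /lac_coef -rmorphM /= mulVf; last by rewrite gt_eqF//; lra.
by rewrite subrr mul0r.
Qed.

Lemma lacunary_function : exists f : R[i] -> R[i],
  [/\ bergman f, f 0 = 1 & forall k j, f (latt k j) = 0].
Proof.
have [f fP] : exists f : R[i] -> R[i], forall z,
    (disk z -> ccvg (psum lac_seq ^~ z) (f z)) /\ (~ disk z -> f z = 0).
  suff h z : exists l, (disk z -> ccvg (psum lac_seq ^~ z) l) /\ (~ disk z -> l = 0).
    by have [f fP] := choice h; exists f.
  have [zD|zD] := pselect (disk z); last by exists 0; split.
  have [B hB] := cubic_geometric_bounded (normc_ge0 z) zD.
  have [l hl] : exists l, ccvg (fun K => \sum_(n < K) lac_seq n * z ^+ n) l.
    apply: (@bounded_series_ccvg R (fun n => lac_seq n * z ^+ n) (6 * B)) => K.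
    apply: le_trans (ler_wpM2l _ (hB K)); last by [].
    rewrite mulr_sumr; apply: ler_sum => n _; rewrite normcM normcX mulrA.
    apply: ler_wpM2r; first by rewrite exprn_ge0// normc_ge0.
    apply: le_trans (coef_bound lac_seq_bergman n) _.
    rewrite (_ : 5 + 1 = 6); last by ring.
    by rewrite ler_pM2l// ler_eXnr// ler1n.
  by exists l.
have f1 z : disk z -> ccvg (psum lac_seq ^~ z) (f z) by have [] := fP z.
have f2 z : ~ disk z -> f z = 0 by have [] := fP z.
have [fB _] := psum_limit_bergman lac_seq_bergman f1 f2.
exists f; split=> // [|k j].
  have D0 : disk (0 : R[i]) by rewrite -[disk 0]/(is_true (normc (0 : R[i]) < 1)) normc0 ltr01.
  apply: (ccvg_unique (f1 0 D0)) => e e0; exists 1%N => -[//|K] _.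
  rewrite /psum big_ord_recl expr0 mulr1 big1 => [|n _]; last first.
    by rewrite expr0n /= mulr0.
  by rewrite addr0 /lac_seq /lac_poly big_ord0 coef1 eqxx subrr normc0.
apply/eqP; rewrite -normc_eq0 eq_le normc_ge0 andbT.
apply/ler_addgt0Pl => e e0; rewrite addr0.
have [K0 hK] := f1 _ (lattice_point_disk N34 omP k j) e e0.
pose K := maxn K0 k.+1.
have KK : (K0 <= lev K)%N by apply: leq_trans (ltnW (ltn_level_size K)); exact: leq_maxl.
have := hK _ KK; rewrite psum_lac_seq lac_poly_root ?leq_maxr//.
by rewrite sub0r normcN => /ltW.
Qed.

End lacunary_product.

(** * The Berezin transform *)

Section berezin_bound.
Context {R : realType} (N : nat) (om : nat -> R[i]).
Hypothesis N34 : (33 < N)%N.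
Hypothesis omP : forall k, (level_size N k).-primitive_root (om k).
Local Notation lev := (level_size N).
Local Notation radius := (level_radius (R := R) N).
Local Notation latt := (lattice_point N om).

(** The series of (1 - u)^-2 folded modulo M: collecting the exponents i + M l gives u^i times ((i +
    1) / (1 - tau) + M tau / (1 - tau)^2), and (1 - tau)^2 clears denominators. The result has
    degree below M in [u], as [discrete_parseval] requires. *)
Lemma kernel_root_sum (u tau : R[i]) M : u ^+ M = tau ->
  (1 - u) ^+ 2 * \sum_(i < M) u ^+ i * ((1 - tau) * i.+1%:R + M%:R * tau) =
  (1 - tau) ^+ 2.
Proof.
move=> uM.
have -> : \sum_(i < M) u ^+ i * ((1 - tau) * i.+1%:R + M%:R * tau) =
    (1 - tau) * \sum_(i < M) i.+1%:R * u ^+ i + M%:R * tau * \sum_(i < M) u ^+ i.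
  by rewrite !mulr_sumr -big_split /=; apply: eq_bigr => i _; ring.
have geo : (1 - u) * \sum_(i < M) u ^+ i = 1 - tau.
  by rewrite -opprB mulNr -subrX1 opprB uM.
rewrite mulrDr mulrCA kernel_partial_sum.
have -> : (1 - u) ^+ 2 * (M%:R * tau * \sum_(i < M) u ^+ i) =
    M%:R * tau * (1 - u) * ((1 - u) * \sum_(i < M) u ^+ i) by ring.
by rewrite geo exprS uM -natr1; ring.
Qed.

Lemma sum_succ M : \sum_(i < M) (i.+1%:R : R) = M%:R * (M%:R + 1) / 2.
Proof.
elim: M => [|M IH]; first by rewrite big_ord0 !mul0r.
by rewrite big_ord_recr /= IH -natr1; field.
Qed.

(* [a ^+ 2 >= 2 t a - t ^+ 2] with [t = M / 4], summed over [i < M]. *)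
Lemma root_coef_sum (tau : R[i]) M : normc tau <= 1 / 2 ->
  M%:R ^+ 3 / 16 <=
  \sum_(i < M) normc ((1 - tau) * i.+1%:R + M%:R * tau) ^+ 2.
Proof.
move=> t2; have m0 : (0 : R) <= M%:R by [].
pose t : R := M%:R / 4.
apply: (@le_trans _ _ (\sum_(i < M) (t * (3 * i.+1%:R - M%:R) - t ^+ 2))).
  rewrite sumrB -mulr_sumr sumrB -mulr_sumr !sumr_const card_ord sum_succ /t.
  by rewrite -(mulr_natl (M%:R)) -mulr_natl; nra.
apply: ler_sum => i _; set a := normc _.
have ia : (3 * i.+1%:R - M%:R) / 2 <= a.
  have -> : a = normc (i.+1%:R - (i.+1%:R - M%:R) * tau) by rewrite /a; congr normc; ring.
  apply: le_trans (ler_normcB _ _); rewrite normcM normc_nat.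
  have -> : (i.+1%:R - M%:R : R[i]) = - (M - i.+1)%:R.
    by rewrite natrB ?opprB.
  rewrite normcN normc_nat natrB//.
  have d0 : (0 : R) <= M%:R - i.+1%:R by rewrite subr_ge0 ler_nat.
  have := ler_wpM2l d0 t2; lra.
have t0 : 0 <= t by rewrite divr_ge0.
have := ler_wpM2l t0 ia; have := sqr_ge0 (a - t); nra.
Qed.

(** All the products of the conjugate of z with points of level k share the same M-th power [tau],
    so [kernel_root_sum] makes their kernel values a discrete Fourier transform of the sequence
    [zeta ^+ i * B i]. In the constant, 625 comes from |zeta^i| >= 1 / 25, and 96 is 16, from
    [root_coef_sum], times 6, an upper bound for |1 - tau|^4. *)
Lemma level_kernel_sum (z : R[i]) k : disk z -> 1 - (lev k)%:R^-1 <= normc z ->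
  (lev k)%:R ^+ 4 / (625 * 96) <=
  \sum_(j < lev k) normc ((1 - Num.conj z * latt k j) ^+ 2)^-1 ^+ 2.
Proof.
move=> zD zr; have w := omP k; set M := lev k.
have M34 : 34 <= (M%:R : R) := level_size_ge34 N34 k.
pose zeta := Num.conj z * (radius k)%:C.
pose tau := zeta ^+ M.
have r0 := radius_ge0 (R := R) N34 k.
have rM1 := @radius_pow_le R N N34 k; have rM5 := @radius_pow_ge R N N34 k.
have z1 : normc z <= 1 by exact/ltW/zD.
have nzeta : normc zeta = normc z * radius k.
  by rewrite normcM normc_conj normc_real ger0_norm.
have zeta1 : normc zeta <= 1.
  rewrite nzeta mulr_ile1 ?normc_ge0//; rewrite /level_radius; have [] := level_size_inv (R := R) N34 k; lra.
have zetaM : 25^-1 <= normc zeta ^+ M.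
  have zM : radius k ^+ M <= normc z ^+ M by apply: lerXn2r; rewrite ?nnegrE ?normc_ge0.
  rewrite nzeta exprMn -/M in rM5 *.
  have i5 : (0 : R) <= 5^-1 by [].
  apply: le_trans _ (ler_pM i5 i5 (le_trans rM5 zM) rM5); lra.
have tau2 : normc tau <= 1 / 2.
  rewrite /tau normcX nzeta exprMn -/M in rM1 *.
  apply: le_trans rM1; rewrite ler_piMl ?exprn_ge0// exprn_ile1 ?normc_ge0//.
pose B i := (1 - tau) * i.+1%:R + M%:R * tau.
have tau0 : normc (1 - tau) <= 3 / 2.
  by apply: le_trans (le_normcB _ _) _; rewrite normc1; lra.
have taup : 0 < normc (1 - tau).
  by have := ler_normcB 1 tau; rewrite normc1; lra.
have term (j : 'I_M) : normc (\sum_(i < M) zeta ^+ i * B i * om k ^+ (i * j)) ^+ 2 <=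
    6 * normc ((1 - Num.conj z * latt k j) ^+ 2)^-1 ^+ 2.
  pose u := zeta * om k ^+ j.
  have uE : Num.conj z * latt k j = u by rewrite /u /zeta /lattice_point mulrA.
  have uM : u ^+ M = tau.
    by rewrite exprMn -exprM mulnC exprM (prim_expr_order w) expr1n mulr1.
  have -> : \sum_(i < M) zeta ^+ i * B i * om k ^+ (i * j) = \sum_(i < M) u ^+ i * B i.
    apply: eq_bigr => i _; rewrite (_ : u ^+ i = zeta ^+ i * om k ^+ (i * j)).
      by ring.
    by rewrite exprMn -exprM mulnC.
  have := kernel_root_sum uM; rewrite -/B; set S := \sum_(i < M) _ => hS.
  have d0 : (1 - u) ^+ 2 != 0.
    apply: contra_neq (lt0r_neq0 taup) => h; apply/eqP.
    by move: hS; rewrite h mul0r => /esym/eqP; rewrite expf_eq0 /= normc_eq0.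
  have -> : S = (1 - tau) ^+ 2 * ((1 - u) ^+ 2)^-1.
    by rewrite -hS mulrC mulrA mulVf// mul1r.
  rewrite uE normcM exprMn; apply: ler_wpM2r; first by rewrite exprn_ge0// normc_ge0.
  rewrite normcX -exprM; set q := normc (1 - tau) in tau0 taup *.
  have : q ^+ (2 * 2) <= (3 / 2) ^+ (2 * 2) by apply: lerXn2r; rewrite ?nnegrE// ltW.
  by move=> /le_trans; apply; rewrite !exprS expr0; lra.
have par := discrete_parseval w (fun i => zeta ^+ i * B i).
have lower : M%:R * (625^-1 * (M%:R ^+ 3 / 16)) <= M%:R * \sum_(i < M) normc (zeta ^+ i * B i) ^+ 2.
  apply: ler_wpM2l => //.
  have i625 : (0 : R) <= 625^-1 by rewrite invr_ge0 ler0n.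
  apply: le_trans (ler_wpM2l i625 (root_coef_sum M tau2)) _.
  rewrite mulr_sumr; apply: ler_sum => i _; rewrite normcM [leRHS]exprMn.
  apply: ler_wpM2r; first by rewrite exprn_ge0// normc_ge0.
  have zi : 25^-1 <= normc zeta ^+ i.
    by apply: le_trans zetaM _; apply: ler_wiXn2l; rewrite ?normc_ge0// ltnW.
  by rewrite normcX; nra.
have upper := ler_sum (index_enum _) (fun (j : 'I_M) (_ : true) => term j).
rewrite -mulr_sumr in upper.
rewrite -par in lower.
have := le_trans lower upper; rewrite !exprS expr0; lra.
Qed.

Lemma level_exists (x : R) : 0 < x -> x < N%:R^-1 ->
  exists k, (lev k.+1)%:R^-1 < x <= (lev k)%:R^-1.
Proof.
move=> x0 xN.
have ex : exists k, (lev k.+1)%:R^-1 < x.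
  exists (Num.truncn x^-1); rewrite -[ltRHS]invrK ltf_pV2 ?posrE ?invr_gt0//.
    apply: lt_le_trans (truncnS_gt _) _; rewrite ler_nat.
    by apply: leq_trans (ltnW (ltn_level_size N34 _)); rewrite ltnS.
  by have := level_size_ge34 (R := R) N34 (Num.truncn x^-1).+1; lra.
case: (ex_minnP ex) => k kx kmin; exists k; rewrite kx /=.
case: k kx kmin => [|k] kx kmin; first by rewrite /level_size expn1 ltW.
by rewrite leNgt; apply/negP => /kmin; rewrite ltnn.
Qed.

Lemma normalized_kernel_measurable (z : R[i]) : disk z ->
  measurable_fun pdisk (fun p : plane R => normc (normalized_kernel z (toC p))).
Proof.
move=> zD; apply: (@cderiv_measurable R (normalized_kernel z)) => [|p pD].
  exact: plane_open_pdisk.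
set w := toC p; have wD : disk w := pD.
have d0 : 1 + - Num.conj z * w != 0.
  have : 0 < normc (1 - w * Num.conj z).
    by apply: lt_le_trans (kernel_denominator wD zD); rewrite subr_gt0; exact: wD.
  by rewrite normc_gt0 mulNr mulrC.
have hg := has_cderivD (has_cderivC 1 w)
  (has_cderivM (has_cderivC (- Num.conj z) w) (has_cderiv_id w)).
have [m hm] := @has_cderiv_inv R (fun w => (1 + - Num.conj z * w) * (1 + - Num.conj z * w))
  w _ (mulf_neq0 d0 d0) (has_cderivM hg hg).
have h := has_cderivM (has_cderivC (1 - normc z ^+ 2)%:C w) hm.
exists (0 * ((1 + - Num.conj z * w) * (1 + - Num.conj z * w))^-1 + (1 - normc z ^+ 2)%:C * m).
rewrite (_ : normalized_kernel z = fun w => (1 - normc z ^+ 2)%:C *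
  ((1 + - Num.conj z * w) * (1 + - Num.conj z * w))^-1)//.
by apply/funext => v; rewrite /normalized_kernel mulNr expr2.
Qed.

(** The integrand is nonnegative, so the levels other than [k] may be dropped. *)
Lemma berezin_level (z : R[i]) k : disk z ->
  (((lev k)%:R ^- 2 * ((1 - normc z ^+ 2) ^+ 2 *
   \sum_(j < lev k) normc ((1 - Num.conj z * latt k j) ^+ 2)^-1 ^+ 2))%:E
  <= berezin (lattice_measure N34 omP) z)%E.
Proof.
move=> zD; rewrite /berezin [leRHS](integral_lattice N34 omP); last 2 first.
- by apply/measurable_EFinP/measurable_funX; exact: normalized_kernel_measurable.
- by move=> p _; rewrite lee_fin exprn_ge0// normc_ge0.
pose v l := (\sum_(j < lev l) ((lev l)%:R ^- 2)%:E *
  (normc (normalized_kernel z (toC (toP (latt l j)))) ^+ 2)%:E)%E.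
have v0 l : (0 <= v l)%E.
  apply: sume_ge0 => j _; apply: mule_ge0; rewrite lee_fin; first exact: weight_ge0.
  by rewrite exprn_ge0// normc_ge0.
apply: (@le_trans _ _ (v k)); last first.
  rewrite -/(v _) (nneseriesD1 (n := k) (fun l _ => v0 l))//.
  by rewrite leeDl//; apply: nneseries_ge0.
rewrite /v mulr_sumr mulr_sumr -sumEFin; apply: lee_sum => j _.
rewrite -EFinM lee_fin toPK /normalized_kernel normcM exprMn normc_real.
by rewrite real_normK ?num_real.
Qed.

(** When 1 - |z| >= 1 / N, level 0 suffices: its kernel denominators have modulus at most 2, whence
    a bound 1 / (16 N^3). Otherwise 1 - |z| lies between consecutive values 1 / M_(k+1) and 1 / M_k,
    and level k gives 1 / (625 * 96 * N^2). The stated constant is below both. *)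
Lemma berezin_bounded_below (z : R[i]) : disk z ->
  ((625 * 96 * N%:R ^+ 3)^-1%:E <= berezin (lattice_measure N34 omP) z)%E.
Proof.
move=> zD; have z1 : normc z < 1 := zD; have z0 := normc_ge0 z.
have NR : (34 : R) <= N%:R by rewrite ler_nat.
have N0 : 0 < (N%:R : R) by lra.
have iN : 0 < (N%:R^-1 : R) by rewrite invr_gt0.
have zz : 1 - normc z <= 1 - normc z ^+ 2 by nra.
have [c cE c16] : exists2 c : R, c = 625 * 96 & 16 <= c.
  by exists (625 * 96) => //; lra.
have c0 : 0 < c by lra.
rewrite -cE.
have [zN|zN] := leP (N%:R^-1) (1 - normc z).
  apply: le_trans (berezin_level 0 zD); rewrite lee_fin.
  have L0 : lev 0 = N by rewrite /level_size expn1.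
  rewrite L0.
  have s : N%:R * 16^-1 <= \sum_(j < N) normc ((1 - Num.conj z * latt 0 j) ^+ 2)^-1 ^+ 2.
    apply: (@le_trans _ _ (\sum_(j < N) (16^-1 : R))).
      by rewrite sumr_const card_ord mulr_natl.
    apply: ler_sum => j _.
    have d2 : normc (1 - Num.conj z * latt 0 j) <= 2.
      apply: le_trans (le_normcB _ _) _; rewrite normc1 normcM normc_conj.
      have lD : normc (latt 0 j) < 1 := lattice_point_disk N34 omP 0 j.
      have := normc_ge0 (latt 0 j); nra.
    have dp : 0 < normc (1 - Num.conj z * latt 0 j).
      have := kernel_denominator (lattice_point_disk N34 omP 0 j) zD.
      rewrite mulrC; apply: lt_le_trans; rewrite subr_gt0.
      exact: (lattice_point_disk N34 omP 0 j).
    rewrite normcV normcX -exprVn -exprM exprVn lef_pV2 ?posrE ?exprn_gt0//.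
    set d := normc _ in d2 dp *.
    have : d ^+ (2 * 2) <= 2 ^+ (2 * 2) by apply: lerXn2r; rewrite ?nnegrE// ltW.
    by move=> /le_trans; apply; rewrite !exprS expr0; lra.
  have q : N%:R^-1 ^+ 2 <= (1 - normc z ^+ 2) ^+ 2.
    by apply: lerXn2r; rewrite ?nnegrE; lra.
  have iN2 : 0 <= N%:R^-1 ^+ 2 :> R by rewrite sqr_ge0.
  apply: (@le_trans _ _ (N%:R ^- 2 * (N%:R^-1 ^+ 2 * (N%:R * 16^-1)))).
    rewrite [leRHS](_ : _ = (16 * N%:R ^+ 3)^-1); last by field; rewrite gt_eqF.
    have N3 : 0 < (N%:R : R) ^+ 3 by rewrite exprn_gt0.
    rewrite lef_pV2 ?posrE ?(mulr_gt0 c0 N3) ?mulr_gt0//.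
    by apply: ler_wpM2r => //; exact: ltW.
  rewrite -exprVn; apply: ler_wpM2l => //; apply: (ler_pM iN2 _ q s).
  by rewrite divr_ge0.
have x0 : 0 < 1 - normc z by lra.
have [k /andP[k1 k2]] := level_exists x0 zN.
apply: le_trans (berezin_level k zD); rewrite lee_fin.
have M34 := level_size_ge34 (R := R) N34 k.
have zr : 1 - (lev k)%:R^-1 <= normc z by lra.
have s := level_kernel_sum zD zr; rewrite -cE in s.
rewrite level_sizeS natrM in k1; set M : R := (lev k)%:R in M34 s k1 *.
have M0 : 0 < M by lra.
have iNM : 0 < (N%:R * M)^-1 by rewrite invr_gt0 mulr_gt0.
have q : (N%:R * M)^-1 ^+ 2 <= (1 - normc z ^+ 2) ^+ 2.
  by apply: lerXn2r; rewrite ?nnegrE; lra.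
apply: (@le_trans _ _ (M ^- 2 * ((N%:R * M)^-1 ^+ 2 * (M ^+ 4 / c)))).
  rewrite [leRHS](_ : _ = (c * N%:R ^+ 2)^-1); last first.
    by field; rewrite !gt_eqF.
  have N2 : 0 < (N%:R : R) ^+ 2 by rewrite exprn_gt0.
  have N3 : 0 < (N%:R : R) ^+ 3 by rewrite exprn_gt0.
  rewrite lef_pV2 ?posrE ?(mulr_gt0 c0 N3) ?(mulr_gt0 c0 N2)//.
  by rewrite ler_pM2l// (exprS _ 2) ler_peMl ?(ltW N2)//; lra.
apply: ler_wpM2l; first by rewrite invr_ge0 exprn_ge0// ltW.
have M4 : 0 <= M ^+ 4 / c by rewrite divr_ge0 ?exprn_ge0 ?ltW.
by apply: ler_pM => //; exact: sqr_ge0.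
Qed.

End berezin_bound.

(** * Boundedness and non-invertibility for the lattice measure *)

Section conclusion.
Context {R : realType} (N : nat) (om : nat -> R[i]).
Hypothesis N34 : (33 < N)%N.
Hypothesis omP : forall k, (level_size N k).-primitive_root (om k).
Local Notation nu := (lattice_measure N34 omP).

Lemma lattice_bounded_toeplitz : bounded_toeplitz nu.
Proof.
apply: (@carleson_bounded_toeplitz R nu (256 * pi)).
  by rewrite mulr_ge0// pi_ge0.
by move=> f fB; exact: lattice_measure_carleson.
Qed.

(** The modulus of the transform at [z] is at most a constant times the integral of |f|, and that
    integral sees the lattice points only. *)
Lemma toeplitz_vanishing (f : R[i] -> R[i]) : bergman f ->
  (forall k j, f (lattice_point N om k j) = 0) -> toeplitz nu f = fun=> 0.
Proof.
move=> fB f0; apply/funext => z; rewrite /toeplitz; case: ifPn => // /set_mem zD.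
have carl g : bergman g -> (\int[nu]_(p in pdisk) (normc (g (toC p)) ^+ 2)%:E <=
    (256 * pi * fine (sqnorm g))%:E)%E by exact: lattice_measure_carleson.
have [_] := @bergman_mul_cintegral R nu (256 * pi) carl f
  (fun w => ((1 - z * Num.conj w) ^+ 2)^-1) ((1 - normc z) ^- 2) fB
  (cmeasurable_kernel zD) (fun w => kernel_bound zD).
rewrite /Rintegral integral_lattice//; last 2 first.
- by apply/measurable_EFinP; exact: bergman_measurable.
- by move=> p _; rewrite lee_fin normc_ge0.
rewrite eseries0 => [|k _ _]; last first.
  by apply: big1 => j _; rewrite toPK f0 normc0 mule0.
by rewrite !mulr0 => h; apply/eqP; rewrite -normc_eq0 eq_le normc_ge0 h.
Qed.

Lemma lattice_not_invertible : ~ invertible_operator (toeplitz nu).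
Proof.
move=> [S [_ ST]]; have [f [fB f1 fl]] := lacunary_function N34 omP.
have zB : bergman (fun=> 0 : R[i]).
  have [+ _] := psum_bergman (fun=> 0 : R[i]) 0.
  rewrite (_ : disk_restrict _ = fun=> 0)//; apply/funext => z.
  by rewrite /disk_restrict /psum big_ord0 if_same.
have [Sf _] := ST _ fB; have [S0 _] := ST _ zB.
have TE : toeplitz nu f = toeplitz nu (fun=> 0) by rewrite !toeplitz_vanishing.
have f00 : f 0 = 0 by rewrite -Sf TE S0.
by move/eqP: f1; rewrite f00 eq_sym oner_eq0.
Qed.

End conclusion.

Theorem theorem3p11 (R : realType) :
  exists nu : {finite_measure set (plane R) -> \bar R},
    [/\ nu (~` pdisk)%classic = 0%E,
        bounded_toeplitz nu,
        ~ invertible_operator (toeplitz nu)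
      & exists delta : R, 0 < delta /\
          forall z : R[i], disk z -> (delta%:E <= berezin nu z)%E].
Proof.
have N34 : (33 < 34)%N by [].
have om_exists k : exists w : R[i], (level_size 34 k).-primitive_root w.
  by apply: complex_prim_root_exists; rewrite expn_gt0.
have [om omP] := choice om_exists.
exists (lattice_measure N34 omP); split.
- exact: lattice_measure_pdiskC.
- exact: lattice_bounded_toeplitz.
- exact: lattice_not_invertible.
exists (625 * 96 * 34%:R ^+ 3)^-1; split; last by move=> z; exact: berezin_bounded_below.
have c0 : (0 : R) < 625 * 96 by lra.
have n0 : (0 : R) < 34%:R ^+ 3 by apply: exprn_gt0; rewrite ltr0n.
by rewrite invr_gt0; exact: mulr_gt0.
Qed.
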